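(* Let $\boldsymbol T_1$ and $\boldsymbol T_2$ be two ($\mathbb K$-homogeneous) operator tuples in $\mathcal A\mathbb K(\Omega)$. Suppose that $\boldsymbol T_1$ is unitarily equivalent to $\boldsymbol M^{(a)}$ and $\boldsymbol T_2$ is unitarily equivalent to $\boldsymbol M^{(b)}$, where $(a_{\underline s})$ and $(b_{\underline s})$ are families of positive real numbers with $a_{\underline0}=b_{\underline0}=1$. Then the following statements are equivalent. (i) $\boldsymbol T_1$ and $\boldsymbol T_2$ are unitarily equivalent. (ii) $a_{\underline s}=b_{\underline s}$ for all $\underline s\in\overrightarrow{\mathbb N}^r_0$. (iii) $K^{(a)}=K^{(b)}$.
   Context: Domain. $\Omega\subset Z=\mathbb C^d$ is an irreducible bounded symmetric domain of rank $r$ of classical type, realized as the open unit ball of a Cartan factor $Z$: (I) $n\times m$ complex matrices ($m\ge n$) of operator norm $<1$; (II) symmetric $n\times n$ matrices of norm $<1$; (III) antisymmetric $n\times n$ matrices of norm $<1$; (IV) $z\in\mathbb C^d$ ($d\ge5$) with $\bar z^tz<2$ and $\bar z^tz<1+|\frac12z^tz|^2$. The coordinates $z_1,\dots,z_d$ on $Z\cong\mathbb C^d$ are taken with respect to an orthonormal basis for the $\mathbb K$-invariant Hermitian inner product for which minimal tripotents have norm $1$ (matrix entries in type I; $z_{ii}$ and $\sqrt2z_{ij}$, $i<j$, in type II; $z_{ij}$, $i<j$, in type III; $z_i$ in type IV). $G$ is the identity component of the group of biholomorphic automorphisms of $\Omega$, and $\mathbb K=\{\phi\in G:\phi(0)=0\}$,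 which consists of linear maps and is contained in $\mathcal U(d)$. The class $\mathcal A\mathbb K(\Omega)$. For $k\in\mathbb K$ write $k(\boldsymbol z)=(k_1(\boldsymbol z),\dots,k_d(\boldsymbol z))$ with $k_j$ linear polynomials. A commuting $d$-tuple $\boldsymbol T=(T_1,\dots,T_d)$ of bounded operators on a complex separable Hilbert space $\mathcal H$ is $\mathbb K$-homogeneous if for every $k\in\mathbb K$ there is a unitary $\Gamma(k)$ on $\mathcal H$ with $T_j\Gamma(k)=\Gamma(k)k_j(T_1,\dots,T_d)$, $j=1,\dots,d$. Put $\boldsymbol T^*=(T_1^*,\dots,T_d^* )$, $D_{\boldsymbol T}h=(T_1h,\dots,T_dh)$, and $\sigma_p(\boldsymbol T)=\{\boldsymbol w\in\mathbb C^d:\ker D_{\boldsymbol T-\boldsymbol wI}\ne0\}$. $\boldsymbol T$ is in $\mathcal A\mathbb K(\Omega)$ if it is $\mathbb K$-homogeneous and (i) $\dim\ker D_{\boldsymbol T^*}=1$; (ii) every non-zero $e\in\ker D_{\boldsymbol T^*}$ is cyclic for $\boldsymbol T$; (iii) $\Omega\subseteq\sigma_p(\boldsymbol T^* )$. Unitary equivalence of tuples means simultaneous unitary equivalence of the components by one unitary. Polynomials. $\mathcal P$ is the space of all analytic polynomials on $Z$. A signature is $\underline s=(s_1,\dots,s_r)$ of integers with $s_1\ge\dots\ge s_r\ge0$; $\overrightarrow{\mathbb N}^r_0$ is the set of signatures. Fix a frame $e_1,\dots,e_r$ of pairwise orthogonal minimal tripotents with joint Peirce decomposition $Z=\bigoplus_{0\le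 i\le j\le r}Z_{ij}$. For $1\le j\le r$ let $\Delta_j$ be the Jordan determinant polynomial (normalized to be $1$ at the unit $e_1+\dots+e_j$) of the Jordan algebra $\bigoplus_{1\le i\le k\le j}Z_{ik}$, extended to $Z$ through the Peirce projection. Put $\Delta_{\underline s}=\Delta_1^{s_1-s_2}\cdots\Delta_{r-1}^{s_{r-1}-s_r}\Delta_r^{s_r}$ and $\mathcal P_{\underline s}=\mathrm{span}\{\Delta_{\underline s}\circ k:k\in\mathbb K\}$; these are precisely the irreducible $\mathbb K$-invariant subspaces of $\mathcal P$. $K_{\underline s}(\boldsymbol z,\boldsymbol w)$ is the reproducing kernel of $\mathcal P_{\underline s}$ for the Fischer-Fock inner product $\langle p,q\rangle_{\mathcal F}=\pi^{-d}\int_{\mathbb C^d}p(\boldsymbol z)\overline{q(\boldsymbol z)}e^{-|\boldsymbol z|^2}dm(\boldsymbol z)$. The space $\mathcal H^{(a)}$. For a family $(a_{\underline s})$ of positive real numbers indexed by the signatures such that $K^{(a)}(\boldsymbol z,\boldsymbol w)=\sum_{\underline s}a_{\underline s}K_{\underline s}(\boldsymbol z,\boldsymbol w)$ defines a kernel function on $\Omega\times\Omega$, $\mathcal H^{(a)}$ is the Hilbert space of holomorphic functions on $\Omega$ with reproducing kernel $K^{(a)}$, and $\boldsymbol M^{(a)}=(M_1^{(a)},\dots,M_d^{(a)})$ is the tuple of multiplications by $z_1,\dots,z_d$ on it. $K^{(b)}$, $\mathcal H^{(b)}$, $\boldsymbol M^{(b)}$ are defined in the same way from $(b_{\underline s})$.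 *)

(* Defs.v *)
From HB Require Import structures.
From mathcomp Require Import all_boot all_order all_algebra.
From mathcomp Require Import sesquilinear complex finmap.
From mathcomp Require mpoly.
From mathcomp Require Import all_classical all_reals all_analysis.
From mathcomp Require summability.

Set Implicit Arguments.
Unset Strict Implicit.
Unset Printing Implicit Defensive.

Import Order.TTheory GRing.Theory Num.Theory numFieldNormedType.Exports.

Local Open Scope classical_set_scope.
Local Open Scope complex_scope.
Local Open Scope ring_scope.

Definition normsq (R : realType) (x : R[i]) : R :=
  complex.Re x ^+ 2 + complex.Im x ^+ 2.

Definition sqnorm (R : realType) (m n : nat) (A : 'M[R[i]]_(m, n)) : R :=
  \sum_i \sum_j normsq (A i j).

Definition opnorm (R : realType) (m n : nat) (A : 'M[R[i]]_(m, n)) : R :=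
  sup [set y : R | exists x : 'cV[R[i]]_n,
         sqnorm x <= 1 /\ y = Num.sqrt (sqnorm (A *m x))].

Inductive cartan_type :=
  | TypeI of nat & nat
  | TypeII of nat
  | TypeIII of nat
  | TypeIV of nat.

Definition cartan_valid (t : cartan_type) : bool :=
  match t with
  | TypeI n m => (0 < n <= m)%N
  | TypeII n => (0 < n)%N
  | TypeIII n => (1 < n)%N
  | TypeIV d => (5 <= d)%N
  end.

Definition le_index (n : nat) := {p : 'I_n * 'I_n | (p.1 <= p.2)%N}.
Definition lt_index (n : nat) := {p : 'I_n * 'I_n | (p.1 < p.2)%N}.

Definition cdim (t : cartan_type) : nat :=
  match t with
  | TypeI n m => (n * m)%N
  | TypeII n => #|{: le_index n}|
  | TypeIII n => #|{: lt_index n}|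
  | TypeIV d => d
  end.

Definition crank (t : cartan_type) : nat :=
  match t with
  | TypeI n _ => n
  | TypeII n => n
  | TypeIII n => n./2
  | TypeIV _ => 2
  end.

Definition sqrt2 (R : realType) : R[i] := (Num.sqrt (2 : R))%:C.

(* In types II and III a point is the row of its coordinates in an orthonormal
   basis: the coordinates of a symmetric matrix A are A i i and sqrt 2 * A i j
   (i < j), those of an antisymmetric matrix are A i j (i < j). In type I the
   coordinates are the entries, through mxvec / vec_mx. *)
Definition sym_mx (R : realType) (n : nat)
    (z : 'rV[R[i]]_#|{: le_index n}|) : 'M[R[i]]_n :=
  \sum_k z 0 k *:
    (let p := val (enum_val k) in
     if p.1 == p.2 then delta_mx p.1 p.2
     else (sqrt2 R)^-1 *: (delta_mx p.1 p.2 + delta_mx p.2 p.1)).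

Definition sym_coord (R : realType) (n : nat) (A : 'M[R[i]]_n) :
    'rV[R[i]]_#|{: le_index n}| :=
  \row_k (let p := val (enum_val k) in
          if p.1 == p.2 then A p.1 p.2 else sqrt2 R * A p.1 p.2).

Definition asym_mx (R : realType) (n : nat)
    (z : 'rV[R[i]]_#|{: lt_index n}|) : 'M[R[i]]_n :=
  \sum_k z 0 k *:
    (let p := val (enum_val k) in delta_mx p.1 p.2 - delta_mx p.2 p.1).

Definition asym_coord (R : realType) (n : nat) (A : 'M[R[i]]_n) :
    'rV[R[i]]_#|{: lt_index n}| :=
  \row_k (let p := val (enum_val k) in A p.1 p.2).

Definition domain (R : realType) (t : cartan_type) : set 'rV[R[i]]_(cdim t) :=
  match t return set 'rV[R[i]]_(cdim t) with
  | TypeI n m => [set z : 'rV[R[i]]_(n * m) | opnorm (vec_mx z) < 1]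
  | TypeII n => [set z | opnorm (sym_mx z) < 1]
  | TypeIII n => [set z | opnorm (asym_mx z) < 1]
  | TypeIV d => [set z : 'rV[R[i]]_d |
      sqnorm z < 2 /\ sqnorm z < 1 + normsq (2^-1 * (z *m z^T) 0 0)]
  end.

Definition conjmx (R : realType) (m n : nat) (A : 'M[R[i]]_(m, n)) :
    'M[R[i]]_(m, n) := map_mx Num.conj A.

Definition mx_triple (R : realType) (m n : nat) (x y z : 'M[R[i]]_(m, n)) :
    'M[R[i]]_(m, n) :=
  2^-1 *: (x *m (conjmx y)^T *m z + z *m (conjmx y)^T *m x).

(* The spin factor product; the factor 2^-1 is the one for which the domain of
   type IV is the open unit ball and minimal tripotents have norm 1. *)
Definition spin_triple (R : realType) (d : nat) (x y z : 'rV[R[i]]_d) :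
    'rV[R[i]]_d :=
  2^-1 *: ((x *m (conjmx y)^T) 0 0 *: z + (z *m (conjmx y)^T) 0 0 *: x
           - (x *m z^T) 0 0 *: conjmx y).

Definition triple (R : realType) (t : cartan_type) :
    'rV[R[i]]_(cdim t) -> 'rV[R[i]]_(cdim t) -> 'rV[R[i]]_(cdim t) ->
    'rV[R[i]]_(cdim t) :=
  match t return
    'rV[R[i]]_(cdim t) -> 'rV[R[i]]_(cdim t) -> 'rV[R[i]]_(cdim t) ->
    'rV[R[i]]_(cdim t) with
  | TypeI n m => fun x y z : 'rV[R[i]]_(n * m) =>
      mxvec (mx_triple (vec_mx x) (vec_mx y) (vec_mx z))
  | TypeII n => fun x y z =>
      sym_coord (mx_triple (sym_mx x) (sym_mx y) (sym_mx z))
  | TypeIII n => fun x y z =>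
      asym_coord (mx_triple (asym_mx x) (asym_mx y) (asym_mx z))
  | TypeIV d => @spin_triple R d
  end.

Definition triple_product (R : realType) (d : nat) :=
  'rV[R[i]]_d -> 'rV[R[i]]_d -> 'rV[R[i]]_d -> 'rV[R[i]]_d.

Definition minimal_tripotent (R : realType) (d : nat) (tp : triple_product R d)
    (e : 'rV[R[i]]_d) : Prop :=
  [/\ e != 0, tp e e e = e
    & [set z | tp e e z = z] = [set z | exists c : R[i], z = c *: e]].

Definition orthogonal_tripotents (R : realType) (d : nat)
    (tp : triple_product R d) (u v : 'rV[R[i]]_d) : Prop :=
  forall z, tp u v z = 0.

Definition is_frame (R : realType) (d r : nat) (tp : triple_product R d)
    (e : 'I_r -> 'rV[R[i]]_d) : Prop :=
  (forall i, minimal_tripotent tp (e i)) /\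
  (forall i j, i != j -> orthogonal_tripotents tp (e i) (e j)).

(* The joint Peirce space Z_ij for 0 <= i <= j <= r. The tripotents are numbered
   from 0 by 'I_r, so that e_k of the usual notation is e (k - 1); the index 0
   of Z_ij corresponds to no tripotent. *)
Definition peirce (R : realType) (d r : nat) (tp : triple_product R d)
    (e : 'I_r -> 'rV[R[i]]_d) (i j : nat) : set 'rV[R[i]]_d :=
  [set z | forall k : 'I_r,
     tp (e k) (e k) z = (((i == k.+1) + (j == k.+1))%:R / 2) *: z].

(* x is the Peirce projection of z to the sum of the Z_ik, 1 <= i <= k <= j. *)
Definition peirce_proj (R : realType) (d r : nat) (tp : triple_product R d)
    (e : 'I_r -> 'rV[R[i]]_d) (j : nat) (z x : 'rV[R[i]]_d) : Prop :=
  exists zz : nat -> nat -> 'rV[R[i]]_d,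
    [/\ forall i k, (i <= k <= r)%N -> peirce tp e i k (zz i k),
        z = \sum_(0 <= k < r.+1) \sum_(0 <= i < k.+1) zz i k
      & x = \sum_(1 <= k < j.+1) \sum_(1 <= i < k.+1) zz i k].

(* Powers of x for the Jordan product x o y = {x u y}, with unit u. *)
Definition jordan_pow (R : realType) (d : nat) (tp : triple_product R d)
    (u x : 'rV[R[i]]_d) (n : nat) : 'rV[R[i]]_d :=
  iter n (fun y => tp x u y) u.

(* N is the determinant on the Jordan algebra A of rank n with unit u: if x is
   regular, i.e. its minimal polynomial p has degree n, then N x is the constant
   coefficient of p up to the sign (-1) ^ n. A polynomial N is determined on A
   by this, since the regular elements of A are dense. *)
Definition is_jordan_det (R : realType) (d : nat) (tp : triple_product R d)
    (u : 'rV[R[i]]_d) (A : set 'rV[R[i]]_d) (n : nat)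
    (N : 'rV[R[i]]_d -> R[i]) : Prop :=
  N u = 1 /\
  forall (x : 'rV[R[i]]_d) (p : {poly R[i]}),
    A x -> free [seq jordan_pow tp u x k | k <- iota 0 n] ->
    p \is monic -> size p = n.+1 ->
    \sum_(k < n.+1) p`_k *: jordan_pow tp u x k = 0 ->
    N x = (-1) ^+ n * p`_0.

Definition peval (R : realType) (d : nat) (p : mpoly.mpoly d R[i])
    (z : 'rV[R[i]]_d) : R[i] := mpoly.meval (fun i => z 0 i) p.

(* D is Delta_j, for 1 <= j <= r. *)
Definition is_jordan_minor (R : realType) (d r : nat) (tp : triple_product R d)
    (e : 'I_r -> 'rV[R[i]]_d) (j : nat) (D : mpoly.mpoly d R[i]) : Prop :=
  is_jordan_det tp (\sum_(i < r | (i < j)%N) e i)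
    [set x | exists z, peirce_proj tp e j z x] j (peval D) /\
  (forall z x, peirce_proj tp e j z x -> peval D z = peval D x).

(* C^d with its topology (given by the sup norm). *)
Definition Cspace (R : realType) (d : nat) : normedModType R[i] :=
  'rV[R[i]]_d.

Definition holomorphic_on (R : realType) (d : nat) (W : normedModType R[i])
    (O : set (Cspace R d)) (f : Cspace R d -> W) : Prop :=
  forall z, O z -> differentiable f z.

Definition compacts_in (R : realType) (d : nat) (O : set (Cspace R d)) :
    set (set (Cspace R d)) := [set A | A `<=` O /\ compact A].

(* Only the restriction of f to O is relevant, both here and for the topology
   of {family compacts_in O, _ -> _} (uniform convergence on the compact
   subsets of O). *)
Definition automorphisms (R : realType) (d : nat) (O : set (Cspace R d)) :
    set {family compacts_in O, Cspace R d -> Cspace R d} :=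
  [set f : Cspace R d -> Cspace R d |
    exists g : Cspace R d -> Cspace R d,
      [/\ holomorphic_on O f, holomorphic_on O g,
          forall z, O z -> O (f z) /\ g (f z) = z
        & forall z, O z -> O (g z) /\ f (g z) = z]].

Arguments automorphisms {R d} O _.

Definition groupG (R : realType) (d : nat) (O : set (Cspace R d)) :
    set {family compacts_in O, Cspace R d -> Cspace R d} :=
  connected_component (automorphisms O)
    (id : {family compacts_in O, Cspace R d -> Cspace R d}).

Arguments groupG {R d} O _.

(* The elements of K are linear and are represented by their matrices, acting
   on row vectors: k(z) = z *m k, so k_j(z) = \sum_i k i j * z_i. *)
Definition groupK (R : realType) (d : nat) (O : set (Cspace R d)) :
    set 'M[R[i]]_d :=
  [set k | exists phi : Cspace R d -> Cspace R d,
     [/\ groupG O phi, phi 0 = 0 & forall z, O z -> phi z = z *m k]].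

Definition signature (r : nat) := {s : r.-tuple nat | sorted geq s}.

Lemma sorted_nseq0 (r : nat) : sorted geq (nseq_tuple r 0%N).
Proof. by rewrite /=; case: r => //=; elim=> //= n ->. Qed.

Definition sig0 (r : nat) : signature r :=
  exist (fun s : r.-tuple nat => sorted geq s) (nseq_tuple r 0%N)
    (sorted_nseq0 r).

(* The exponent of Delta_r is s_r because nth returns 0 past the end. *)
Definition Delta_sig (R : realType) (d r : nat)
    (Delta : 'I_r -> mpoly.mpoly d R[i]) (s : signature r)
    (z : 'rV[R[i]]_d) : R[i] :=
  \prod_(j < r) peval (Delta j) z ^+ (nth 0%N (val s) j - nth 0%N (val s) j.+1).

Definition Pspace (R : realType) (d r : nat) (O : set 'rV[R[i]]_d)
    (Delta : 'I_r -> mpoly.mpoly d R[i]) (s : signature r) :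
    set ('rV[R[i]]_d -> R[i]) :=
  [set p | exists (n : nat) (c : 'I_n -> R[i]) (k : 'I_n -> 'M[R[i]]_d),
     (forall l, groupK O (k l)) /\
     p = fun z => \sum_l c l * Delta_sig Delta s (z *m k l)].

Definition integralC (R : realType) (f : R[i] -> R[i]) : R[i] :=
  let mu := (@lebesgue_measure R \x @lebesgue_measure R)%E in
  Complex (\int[mu]_x complex.Re (f (Complex x.1 x.2)))
          (\int[mu]_x complex.Im (f (Complex x.1 x.2))).

(* The integral over C^d with respect to Lebesgue measure, as an iterated
   integral over the coordinates. *)
Fixpoint integralCn (R : realType) (d : nat) :
    ('rV[R[i]]_d -> R[i]) -> R[i] :=
  match d return ('rV[R[i]]_d -> R[i]) -> R[i] with
  | 0%N => fun f => f 0
  | d'.+1 => fun f : 'rV[R[i]]_(1 + d') -> R[i] =>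
      integralC (fun x =>
        integralCn (fun y : 'rV[R[i]]_d' => f (row_mx x%:M y)))
  end.

Definition fischer (R : realType) (d : nat) (p q : 'rV[R[i]]_d -> R[i]) :
    R[i] :=
  ((@pi R) ^- d)%:C *
  integralCn (fun z => p z * Num.conj (q z) * (expR (- sqnorm z))%:C).

Definition Kker (R : realType) (d r : nat) (O : set 'rV[R[i]]_d)
    (Delta : 'I_r -> mpoly.mpoly d R[i]) (s : signature r)
    (z w : 'rV[R[i]]_d) : R[i] :=
  xget (fun=> 0) [set q | Pspace O Delta s q /\
    forall p, Pspace O Delta s p -> fischer p q = p w] z.

Definition kernel_terms (R : realType) (d r : nat) (O : set 'rV[R[i]]_d)
    (Delta : 'I_r -> mpoly.mpoly d R[i]) (a : signature r -> R)
    (z w : 'rV[R[i]]_d) (s : signature r) : R[i]^o :=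
  (a s)%:C * Kker O Delta s z w.

(* K^(a), as an unordered sum over the signatures. *)
Definition kernel_sum (R : realType) (d r : nat) (O : set 'rV[R[i]]_d)
    (Delta : 'I_r -> mpoly.mpoly d R[i]) (a : signature r -> R)
    (z w : 'rV[R[i]]_d) : R[i] :=
  summability.sum (kernel_terms O Delta a z w).

(* Positive definiteness is automatic: the terms are positive definite. *)
Definition defines_kernel (R : realType) (d r : nat) (O : set 'rV[R[i]]_d)
    (Delta : 'I_r -> mpoly.mpoly d R[i]) (a : signature r -> R) : Prop :=
  forall z w, O z -> O w ->
    cvg (summability.partial_sum (kernel_terms O Delta a z w)
           @ summability.totally).

Record hilbert (R : realType) := Hilbert {
  hilbert_sort :> completeNormedModType R[i];
  hdot : {dot hilbert_sort for Num.conj};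
  hdot_norm : forall x : hilbert_sort, hdot x x = `|x| ^+ 2;
  hilbert_separable : exists D : set hilbert_sort, countable D /\ dense D
}.

(* The Hilbert space of holomorphic functions on O with reproducing kernel K;
   its elements are identified with functions on O through fun_of. *)
Record rkhs (R : realType) (d : nat) (O : set 'rV[R[i]]_d)
    (K : 'rV[R[i]]_d -> 'rV[R[i]]_d -> R[i]) := RKHS {
  rkhs_sort :> hilbert R;
  fun_of : rkhs_sort -> 'rV[R[i]]_d -> R[i]^o;
  fun_of_linear : forall (c : R[i]) (f g : rkhs_sort) z, O z ->
    fun_of (c *: f + g) z = c * fun_of f z + fun_of g z;
  fun_of_inj : forall f g : rkhs_sort,
    (forall z, O z -> fun_of f z = fun_of g z) -> f = g;
  fun_of_holomorphic : forall f : rkhs_sort, holomorphic_on O (fun_of f);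
  fun_of_reproducing : forall w, O w -> exists Kw : rkhs_sort,
    (forall z, O z -> fun_of Kw z = K z w) /\
    (forall f : rkhs_sort, fun_of f w = hdot rkhs_sort f Kw)
}.

Definition bounded_op (R : realType) (H1 H2 : hilbert R)
    (T : {linear H1 -> H2}) : Prop :=
  exists M : R[i], forall x, `|T x| <= M * `|x|.

Definition unitary_op (R : realType) (H1 H2 : hilbert R)
    (U : {linear H1 -> H2}) : Prop :=
  (forall x y, hdot H2 (U x) (U y) = hdot H1 x y) /\
  (forall y, exists x, U x = y).

Definition unitarily_equivalent (R : realType) (d : nat) (H1 H2 : hilbert R)
    (T : 'I_d -> {linear H1 -> H1}) (S : 'I_d -> {linear H2 -> H2}) : Prop :=
  exists U : {linear H1 -> H2},
    unitary_op U /\ forall j h, U (T j h) = S j (U h).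

Definition is_adjoint (R : realType) (H : hilbert R) (T S : {linear H -> H}) :
    Prop := forall x y, hdot H (T x) y = hdot H x (S y).

(* ker D_{T - w I}. *)
Definition joint_ker (R : realType) (d : nat) (H : hilbert R)
    (T : 'I_d -> {linear H -> H}) (w : 'rV[R[i]]_d) : set H :=
  [set h | forall j, T j h - w 0 j *: h = 0].

Definition point_spectrum (R : realType) (d : nat) (H : hilbert R)
    (T : 'I_d -> {linear H -> H}) : set 'rV[R[i]]_d :=
  [set w | exists2 h, h != 0 & joint_ker T w h].

(* p(T) h, where T^m = T_1^(m_1) ... T_d^(m_d). *)
Definition tuple_poly (R : realType) (d : nat) (H : hilbert R)
    (T : 'I_d -> {linear H -> H}) (p : mpoly.mpoly d R[i]) (h : H) : H :=
  \sum_(m <- mpoly.msupp p) mpoly.mcoeff m p *: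
    foldr (fun (i : 'I_d) x => iter (mpoly.fun_of_multinom m i) (T i) x)
      h (enum 'I_d).

Definition cyclic_vector (R : realType) (d : nat) (H : hilbert R)
    (T : 'I_d -> {linear H -> H}) (h : H) : Prop :=
  closure [set x | exists p, x = tuple_poly T p h] = setT.

Definition K_homogeneous (R : realType) (d : nat) (O : set 'rV[R[i]]_d)
    (H : hilbert R) (T : 'I_d -> {linear H -> H}) : Prop :=
  forall k, groupK O k -> exists Gamma : {linear H -> H},
    unitary_op Gamma /\
    forall j h, T j (Gamma h) = Gamma (\sum_i k i j *: T i h).

(* Tst is the tuple of adjoints of T. *)
Definition class_AK (R : realType) (d : nat) (O : set 'rV[R[i]]_d)
    (H : hilbert R) (T : 'I_d -> {linear H -> H}) : Prop :=
  [/\ forall j, bounded_op (T j),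
      forall i j h, T i (T j h) = T j (T i h),
      K_homogeneous O T
    & exists Tst : 'I_d -> {linear H -> H},
      [/\ forall j, is_adjoint (T j) (Tst j),
          exists2 e, e != 0 &
            joint_ker Tst 0 = [set h | exists c : R[i], h = c *: e],
          forall e, e != 0 -> joint_ker Tst 0 e -> cyclic_vector T e
        & O `<=` point_spectrum Tst]].

Definition multiplication_tuple (R : realType) (d : nat)
    (O : set 'rV[R[i]]_d) (K : 'rV[R[i]]_d -> 'rV[R[i]]_d -> R[i])
    (H : rkhs O K) (M : 'I_d -> {linear H -> H}) : Prop :=
  forall j, bounded_op (M j) /\
    forall (f : H) z, O z -> fun_of (M j f) z = z 0 j * fun_of f z.

(* Main.v *)
Require Import Defs.
From HB Require Import structures.
From mathcomp Require Import all_boot all_order all_algebra.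
From mathcomp Require Import complex sesquilinear finmap spectral.
From mathcomp Require Import -(notations) mpoly.
From mathcomp Require Import all_classical all_reals all_analysis measurable_realfun.
From mathcomp Require summability.
From mathcomp Require Import ring lra.

(** Equal coefficients give equal kernels, and a space of functions is determined
    by its reproducing kernel: the combinations of kernel functions are dense and
    their norms are read off the kernel, so that two spaces with the same kernel
    carry the same functions with the same norms, and the identity intertwines
    the multiplications by the coordinates ([same_kernel_equivalent]).

    Conversely, let both models be equivalent to one tuple T. The kernel
    functions at 0 are the same constant in both spaces, because only the
    signature 0 contributes there, and their preimages lie in the joint kernel of
    the adjoint of T, which is a line. Since the equivalences turn p(T) into
    multiplication by p, the two models agree, up to one unimodular factor, on
    all polynomials; by cyclicity these are dense, so the kernels are equal
    ([equivalent_kernel_eq]).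

    It remains to recover the coefficients from the kernel ([kernel_sum_inj]).
    Scaling z separates the degrees, because a convergent unordered sum converges
    absolutely ([degree_separation]), and it is to be shown that the kernels K_s
    of one degree are linearly independent. Let L_s (p) be the coefficient of
    x_1^(s_1) ... x_r^(s_r) in p (\sum_i x_i e_i). It is 1 on Delta_s, and it
    vanishes on P_s' when s' is smaller than s in the monomial order: for every k
    in K the polynomial Delta_j (\sum_i x_i e_i k) is homogeneous of degree j and
    affine in every x_i, so that its monomials are at most x_1 ... x_j
    ([Kker_free]). Apply L_s to a relation between the kernels, with s its
    largest signature. By Riesz representation in P_s for the Fischer product,
    which is definite because monomials are orthogonal with positive norms
    ([fischerE]), the conjugate of L_s (K_s (., w)) is the value at w of a
    non-zero element of P_s, so that the coefficient of K_s is 0.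

    Only homogeneity and affinity of Delta_j along the vectors e_i k depend on
    the domain, and they are proved type by type ([cartan_minor_geometry]).
    An element k of K maps the polydisc spanned by the frame into the closed unit
    ball and its faces to the boundary. For matrices this forces the images of
    the e_i to act between orthonormal systems ([rigid_contractions]): in types I
    and II they have rank one, in type III they have rank two and come from the
    symplectic pairs (xi, conj eta); in type IV they are isotropic. On the other
    side Delta_j is identified through the coefficients of minimal polynomials at
    regular points, and by density elsewhere: it is the determinant of the
    compression to the frame in types I and II, by Cayley-Hamilton
    ([jordan_minor_det]); a square root of that determinant in type III
    ([skew_minor_sqr]); a linear or a quadratic form in type IV ([spin_minor1],
    [spin_minor2]). A determinant is affine along matrices of rank one, a
    quadratic form along isotropic vectors, and in type III the square of Delta_j
    has degree two along matrices of rank two. *)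

Set Implicit Arguments.
Unset Strict Implicit.
Unset Printing Implicit Defensive.
Import Order.TTheory GRing.Theory Num.Theory numFieldNormedType.Exports.
Local Open Scope classical_set_scope.
Local Open Scope complex_scope.
Local Open Scope ring_scope.

(** * Moments of the Gaussian weight *)

Section GaussMoments.
Variable R : realType.
Local Notation mu := (@lebesgue_measure R).

(** Half of the Gaussian exponent absorbs every power: with y = x^2 / 2,
    expR y dominates both 1 and y^(k+1) / (k+1)!. *)
Lemma exprn_gauss_bound (k : nat) : exists2 B : R, 0 < B &
  forall x, `|x| ^+ k * gauss_fun x <= B * normal_fun 0 1 x.
Proof.
exists (1 + 2 ^+ k.+1 * (k.+1)`!%:R).
  by rewrite ltr_pwDl// mulr_ge0 ?exprn_ge0 ?ler0n.
move=> x; rewrite /gauss_fun /normal_fun subr0 expr1n.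
set y : R := x ^+ 2 / 2.
have -> : - x ^+ 2 / (1 *+ 2) = - y by rewrite mulNr.
have -> : - x ^+ 2 = - y + - y by rewrite /y; field.
rewrite expRD mulrA ler_wpM2r ?expR_ge0//.
rewrite expRN -ler_pdivlMr ?invr_gt0 ?expR_gt0// invrK.
have y0 : 0 <= y by rewrite divr_ge0 ?sqr_ge0.
have ey := expR_ge1Dxn k y0.
have fk : (0 : R) < (k.+1)`!%:R by rewrite ltr0n fact_gt0.
have -> : (1 + 2 ^+ k.+1 * (k.+1)`!%:R) * expR y =
  expR y + 2 ^+ k.+1 * ((k.+1)`!%:R * expR y) by rewrite mulrDl mul1r !mulrA.
have yk0 : 0 <= y ^+ k.+1 / (k.+1)`!%:R by rewrite divr_ge0 ?exprn_ge0// ltW.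
have e1 : 1 <= expR y by apply: le_trans ey; rewrite lerDl.
have e2 : y ^+ k.+1 <= (k.+1)`!%:R * expR y.
  by rewrite mulrC -ler_pdivrMr//; apply: le_trans ey; rewrite lerDr.
have e3 : `|x| ^+ k.+1 ^+ 2 <= 2 ^+ k.+1 * ((k.+1)`!%:R * expR y).
  rewrite -exprM mulnC exprM real_normK ?num_real//.
  have -> : x ^+ 2 = 2 * y by rewrite /y; field.
  by rewrite exprMn ler_wpM2l// exprn_ge0.
have [x1|x1] := leP `|x| 1.
  apply: (@le_trans _ _ (expR y)).
    by apply: le_trans e1; apply: exprn_ile1.
  by rewrite lerDl mulr_ge0 ?exprn_ge0// mulr_ge0 ?expR_ge0// ltW.
apply: (@le_trans _ _ (2 ^+ k.+1 * ((k.+1)`!%:R * expR y))).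
  2: by rewrite lerDr expR_ge0.
apply: le_trans e3.
by rewrite -exprM ler_weXn2l ?ltW// (leq_trans (leqnSn k))// leq_pmulr.
Qed.

Lemma measurable_exprn_gauss k :
  measurable_fun setT (fun x : R => x ^+ k * gauss_fun x).
Proof.
apply: measurable_funM; last exact: measurable_gauss_fun.
exact: exprn_measurable.
Qed.

Lemma integrable_exprn_gauss (k : nat) :
  mu.-integrable setT (EFin \o (fun x => x ^+ k * gauss_fun x)).
Proof.
have [B B0 hB] := exprn_gauss_bound k.
apply: (@le_integrable _ _ _ mu setT _ _ 
  (EFin \o (fun x => B / normal_peak 1 * normal_pdf 0 1 x))) => //.
- by apply/measurable_EFinP; exact: measurable_exprn_gauss.
- move=> x _ /=; rewrite lee_fin normrM normrX (ger0_norm (gauss_fun_ge0 x)).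
  apply: le_trans (ler_norm _); apply: le_trans (hB x) _.
  rewrite normal_pdfE ?oner_neq0// mulrA divfK//.
  by rewrite gt_eqF// normal_peak_gt0// oner_neq0.
- exact: (integrableZl measurableT _ (integrable_normal_pdf 0 1)).
Qed.

Definition gauss_moment (k : nat) : R := \int[mu]_x (x ^+ k * gauss_fun x).

Lemma gauss_moment0_gt0 : 0 < gauss_moment 0.
Proof.
rewrite /gauss_moment.
under eq_Rintegral do rewrite expr0 mul1r.
by rewrite /Rintegral integralT_gauss /= sqrtr_gt0 pi_gt0.
Qed.

Let dF (k : nat) (x : R) := k%:R * (x ^+ k.-1 * gauss_fun x)
  - 2 * (x ^+ k.+1 * gauss_fun x).

Let is_derive_F k (x : R) :
  is_derive x 1 (fun x : R => x ^+ k * gauss_fun x) (dF k x).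
Proof.
have dX n : is_derive x 1 ((@idfun R : R -> R) ^+ n) (n%:R * x ^+ n.-1).
  have := @is_deriveX R R^o idfun n x 1 1 (is_derive_id _ _).
  by rewrite /GRing.scale /= mulr1.
have dg : is_derive x 1 (@gauss_fun R) (gauss_fun x * (- (2 * x))).
  have := @is_derive1_comp R expR (- idfun ^+ 2) x _ _
    (is_derive_expR (- x ^+ 2)) (is_deriveN (dX 2%N)).
  have -> : expR \o (- idfun ^+ 2) = @gauss_fun R.
    by apply/funext => y /=; rewrite /gauss_fun !fctE.
  by rewrite expr1.
have := is_deriveM (dX k) dg.
have -> : (idfun ^+ k * @gauss_fun R) = (fun x : R => x ^+ k * gauss_fun x).
  by apply/funext => y; rewrite !fctE.
move=> h; apply: (is_derive_eq h).
rewrite /dF /GRing.scale /= !fctE exprS; ring.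
Qed.

Let continuous_dF k : continuous (dF k).
Proof.
have c m : continuous (fun x : R => x ^+ m * gauss_fun x).
  by move=> x; apply: cvgM; [exact: exprn_continuous|exact: continuous_gauss_fun].
by move=> x; apply: cvgB; apply: cvgM; do ?exact: cvg_cst; exact: c.
Qed.

Let integrable_dF k : mu.-integrable setT (EFin \o dF k).
Proof.
exact: (integrableB measurableT
  (integrableZl measurableT k%:R (integrable_exprn_gauss k.-1))
  (integrableZl measurableT 2 (integrable_exprn_gauss k.+1))).
Qed.

Let int_dF_sym k (a : R) : 0 < a ->
  (\int[mu]_(x in `[(- a)%R, a]) (dF k x)%:E =
   (a ^+ k * gauss_fun a)%R%:E - ((- a) ^+ k * gauss_fun (- a))%R%:E)%E.
Proof.
move=> a0; apply: (@continuous_FTC2 _ (dF k) (fun x => x ^+ k * gauss_fun x)).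
- by rewrite gtrN.
- exact/continuous_subspaceT/continuous_dF.
- have c : continuous (fun x : R => x ^+ k * gauss_fun x).
    by move=> x; apply: cvgM; [exact: exprn_continuous|exact: continuous_gauss_fun].
  split.
  + by move=> x _; apply: ex_derive; exact: is_derive_F.
  + exact/cvg_at_right_filter/c.
  + exact/cvg_at_left_filter/c.
- by move=> x _; rewrite derive1E; apply: derive_val; exact: is_derive_F.
Qed.

Let F_cvg k : ((n.+1%:R : R) ^+ k * gauss_fun (n.+1%:R : R)) @[n --> \oo] --> (0 : R).
Proof.
have [B B0 hB] := exprn_gauss_bound k.+1.
apply: (@squeeze_cvgr _ _ _ _ (fun=> 0) (fun n => B * n.+1%:R^-1)); last 2 first.
- exact: cvg_cst.
- rewrite -[X in _ --> X](mulr0 B); apply: cvgM; first exact: cvg_cst.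
  exact: (@cvg_harmonic R).
apply: nearW => n /=; apply/andP; split.
  by rewrite mulr_ge0 ?exprn_ge0 ?gauss_fun_ge0.
rewrite ler_pdivlMr// mulrAC -exprSr.
have := hB n.+1%:R; rewrite ger0_norm// => /le_trans; apply.
rewrite ler_piMr ?(ltW B0)// /normal_fun.
rewrite -[leRHS]expR0 ler_expR mulNr oppr_le0.
by rewrite divr_ge0 ?sqr_ge0// mulrn_wge0// sqr_ge0.
Qed.

Let int_dF k : (\int[mu]_x (dF k x)%:E = 0)%E.
Proof.
pose f_ (n : nat) : R -> \bar R := ((EFin \o dF k) \_ `[- (n.+1%:R : R), (n.+1%:R : R)]).
have mdF : measurable_fun setT (EFin \o dF k).
  by have /integrableP[] := integrable_dF k.
have [|//|||| _ _ h] := @dominated_convergence _ _ _ mu setT measurableT f_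
    (EFin \o dF k) (abse \o (EFin \o dF k)).
- by move=> n; apply/(measurable_restrictT _ _).1 => //; exact: measurable_funTS.
- apply/aeW => x _; apply: cvg_near_cst.
  near=> n; rewrite /f_ patchE ifT// inE /= in_itv /= -ler_norml.
  near: n; exists (Num.truncn `|x|) => // n /= hn.
  apply: (le_trans (ltW (truncnS_gt _))).
  by rewrite ler_nat ltnS.
- exact: integrable_abse.
- by apply/aeW => x n _; rewrite /f_ patchE; case: ifP => // _;
    rewrite abse0 abse_ge0.
apply: (cvg_unique _ h) => //.
have e n : (\int[mu]_x (f_ n x) = (n.+1%:R ^+ k * gauss_fun n.+1%:R
    - (-1) ^+ k * (n.+1%:R ^+ k * gauss_fun n.+1%:R))%R%:E)%E.
  rewrite /f_ -integral_mkcond int_dF_sym// EFinB /gauss_fun sqrrN.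
  by rewrite [X in (_ - X%:E)%E](_ : _ = (-1) ^+ k * (n.+1%:R ^+ k * expR (- n.+1%:R ^+ 2)))// mulrA -exprMn mulN1r.
rewrite (_ : [sequence _]_n = (EFin \o (fun n => n.+1%:R ^+ k * gauss_fun n.+1%:R
    - (-1) ^+ k * (n.+1%:R ^+ k * gauss_fun n.+1%:R)))); last exact/funext/e.
apply: cvg_EFin; first by apply: nearW.
rewrite -[X in _ --> X](_ : 0 - (-1) ^+ k * 0 = 0); last by rewrite mulr0 subr0.
apply: cvgB; first exact: F_cvg.
by apply: cvgM; [exact: cvg_cst|exact: F_cvg].
Unshelve. all: by end_near. Qed.

(** Integration by parts: the total derivative of x ^+ k * exp (- x ^ 2)
    integrates to 0. *)
Lemma gauss_moment_rec k : 2 * gauss_moment k.+1 = k%:R * gauss_moment k.-1.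
Proof.
apply/eqP; rewrite eq_sym -subr_eq0; apply/eqP.
rewrite /gauss_moment -!RintegralZl//; [|exact: integrable_exprn_gauss..].
rewrite -RintegralB//; [|exact: (integrableZl measurableT _ (integrable_exprn_gauss _))..].
by rewrite /Rintegral int_dF.
Qed.

End GaussMoments.

Section ComplexIntegral.
Variable R : realType.
Local Notation mu := (@lebesgue_measure R).
Local Notation mu2 := (mu \x mu)%E.
Implicit Types (f g : R[i] -> R[i]) (c : R[i]).

Definition integrableC f : Prop :=
  mu2.-integrable setT (EFin \o (fun x => complex.Re (f (Complex x.1 x.2)))) /\
  mu2.-integrable setT (EFin \o (fun x => complex.Im (f (Complex x.1 x.2)))).

Lemma integrableC_lin c f g : integrableC f -> integrableC g ->
  integrableC (fun z => c * f z + g z).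
Proof.
case: c => a b [f1 f2] [g1 g2].
have z1 := integrableZl measurableT _ f1; have z2 := integrableZl measurableT _ f2.
split.
- have := integrableD measurableT (integrableB measurableT (z1 a) (z2 b)) g1.
  apply: eq_integrable => // x _ /=.
  by case: (f _) => ? ?; case: (g _) => ? ?.
- have := integrableD measurableT (integrableD measurableT (z2 a) (z1 b)) g2.
  apply: eq_integrable => // x _ /=.
  by case: (f _) => ? ?; case: (g _) => ? ?.
Qed.

Lemma integralC_lin c f g : integrableC f -> integrableC g ->
  integralC (fun z => c * f z + g z) = c * integralC f + integralC g.
Proof.
case: c => a b [f1 f2] [g1 g2]; rewrite /integralC.
have z1 := integrableZl measurableT _ f1; have z2 := integrableZl measurableT _ f2.
have -> : (\int[mu2]_x complex.Re (Complex a b * f (Complex x.1 x.2) + g (Complex x.1 x.2)))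
  = a * (\int[mu2]_x complex.Re (f (Complex x.1 x.2))) -
    b * (\int[mu2]_x complex.Im (f (Complex x.1 x.2))) +
    \int[mu2]_x complex.Re (g (Complex x.1 x.2)).
  rewrite -!RintegralZl// -RintegralB//; [|exact: z1|exact: z2].
  rewrite -RintegralD//; last exact: (integrableB measurableT (z1 a) (z2 b)).
  by apply: eq_Rintegral => x _ /=; case: (f _) => ? ?; case: (g _) => ? ?.
have -> : (\int[mu2]_x complex.Im (Complex a b * f (Complex x.1 x.2) + g (Complex x.1 x.2)))
  = a * (\int[mu2]_x complex.Im (f (Complex x.1 x.2))) +
    b * (\int[mu2]_x complex.Re (f (Complex x.1 x.2))) +
    \int[mu2]_x complex.Im (g (Complex x.1 x.2)).
  rewrite -!RintegralZl// -RintegralD//; [|exact: z2|exact: z1].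
  rewrite -RintegralD//; last exact: (integrableD measurableT (z2 a) (z1 b)).
  by apply: eq_Rintegral => x _ /=; case: (f _) => ? ?; case: (g _) => ? ?.
by apply/eqP; rewrite eq_complex /= !eqxx.
Qed.

Lemma integrableC0 : integrableC (fun=> 0).
Proof. by split; exact: integrable0. Qed.

Lemma integralC0 : integralC (fun=> 0 : R[i]) = 0 :> R[i].
Proof.
have e : \int[mu2]_x (0 : R) = 0 by rewrite Rintegral_cst// mul0r.
by rewrite /integralC /= e.
Qed.

Lemma integrableC_sum (I : Type) (s : seq I) (c : I -> R[i]) (h : I -> R[i] -> R[i]) :
  (forall k, integrableC (h k)) ->
  integrableC (fun z => \sum_(k <- s) c k * h k z) /\
  integralC (fun z => \sum_(k <- s) c k * h k z) = \sum_(k <- s) c k * integralC (h k).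
Proof.
move=> hh; elim: s => [|k s [IHi IH]].
  rewrite big_nil (_ : (fun z => _) = fun=> 0); last by apply/funext=> z; rewrite big_nil.
  by split; [exact: integrableC0|exact: integralC0].
rewrite (_ : (fun z => _) = fun z => c k * h k z + \sum_(j <- s) c j * h j z).
  by split; [exact: integrableC_lin|rewrite integralC_lin// IH big_cons].
by apply/funext=> z; rewrite big_cons.
Qed.

Lemma integral_prod_fun (u v : R -> R) :
  mu.-integrable setT (EFin \o u) -> mu.-integrable setT (EFin \o v) ->
  mu2.-integrable setT (EFin \o (fun x => u x.1 * v x.2)) /\
  \int[mu2]_x (u x.1 * v x.2) = (\int[mu]_x u x) * (\int[mu]_x v x).
Proof.
move=> iu iv.
have mu' : measurable_fun setT u by case/integrableP: iu => /measurable_EFinP.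
have mv' : measurable_fun setT v by case/integrableP: iv => /measurable_EFinP.
have mf : measurable_fun setT (EFin \o (fun x : R * R => u x.1 * v x.2)).
  apply/measurable_EFinP; apply: measurable_funM.
    exact: (measurableT_comp mu' measurable_fst).
  exact: (measurableT_comp mv' measurable_snd).
have i : mu2.-integrable setT (EFin \o (fun x => u x.1 * v x.2)).
  apply/(integrable12ltyP mu mu mf).
  rewrite (_ : (fun x => _) = fun x => ((`|u x|)%:E * \int[mu]_y (`|v y|)%:E)%E).
    rewrite (_ : (fun x => _) = fun x => ((\int[mu]_y `|v y|)%:E * (`|u x|)%:E)%E); last first.
      apply/funext => x; rewrite muleC /Rintegral fineK//.
      exact: (integrable_fin_num measurableT (integrable_abse iv)).
    have /integrableP[_ h] := iu.
    rewrite integralZl//; last exact: (integrable_abse iu).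
    rewrite lte_mul_pinfty//.
    by rewrite lee_fin; apply: Rintegral_ge0.
  apply/funext => x /=; rewrite -integralZl//; last exact: (integrable_abse iv).
  by apply: eq_integral => y _ /=; rewrite normrM.
split => //.
rewrite {1}/Rintegral -(integral12_prod_meas1 i) /fubini_F /=.
rewrite (_ : (fun x => _) = fun x => ((\int[mu]_y v y)%:E * (u x)%:E)%E); last first.
  apply/funext => x; rewrite muleC /Rintegral fineK//.
    by rewrite -integralZl.
  exact: (integrable_fin_num measurableT iv).
rewrite integralZl// /Rintegral fineM ?(integrable_fin_num measurableT)// mulrC.
by rewrite fineK ?(integrable_fin_num measurableT).
Qed.

Definition gauss2 (z : R[i]) : R[i] := (expR (- normsq z))%:C.

(** The real factors make the family stable under integration by parts in
    each of the two real variables. *)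
Definition gauss_monomial (m n a b : nat) (z : R[i]) : R[i] :=
  (complex.Re z)%:C ^+ m * (complex.Im z)%:C ^+ n * z ^+ a * (Num.conj z) ^+ b * gauss2 z.

Lemma gauss_monomial_real m n : integrableC (gauss_monomial m n 0 0) /\
  integralC (gauss_monomial m n 0 0) = (gauss_moment R m * gauss_moment R n)%:C.
Proof.
have [i e] := integral_prod_fun (integrable_exprn_gauss R m) (integrable_exprn_gauss R n).
have E x : gauss_monomial m n 0 0 (Complex x.1 x.2) =
    ((x.1 ^+ m * gauss_fun x.1) * (x.2 ^+ n * gauss_fun x.2))%:C.
  rewrite /gauss_monomial !expr0 !mulr1 /gauss2 /normsq /= opprD expRD -!rmorphXn -!rmorphM /=.
  by rewrite /gauss_fun mulrACA.
rewrite /integrableC /integralC; split.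
  split.
    by apply: eq_integrable i => // x _ /=; rewrite E.
  by apply: eq_integrable (integrable0 _ _) => // x _ /=; rewrite E.
apply/eqP; rewrite eq_complex; apply/andP; split; apply/eqP => /=.
  by rewrite -e; apply: eq_Rintegral => x _; rewrite E.
rewrite (eq_Rintegral _ (g := cst 0)) ?Rintegral_cst ?mul0r// => x _.
by rewrite E.
Qed.

Let conjE (z : R[i]) : Num.conj z = (complex.Re z)%:C - 'i%C * (complex.Im z)%:C.
Proof.
by case: z => x y; apply/eqP; rewrite eq_complex /= !mul0r !mul1r !subr0 ?addr0 ?add0r !eqxx.
Qed.

Lemma gauss_monomialSa m n a b z : gauss_monomial m n a.+1 b z =
  1 * gauss_monomial m.+1 n a b z + 'i%C * gauss_monomial m n.+1 a b z.
Proof.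
rewrite /gauss_monomial (exprS z a) [X in X * z ^+ a](complexE z) !exprS; ring.
Qed.

Lemma gauss_monomialSb m n a b z : gauss_monomial m n a b.+1 z =
  1 * gauss_monomial m.+1 n a b z + (- 'i%C) * gauss_monomial m n.+1 a b z.
Proof.
rewrite /gauss_monomial (exprS (Num.conj z) b) [X in X * Num.conj z ^+ b](conjE z).
rewrite !exprS; ring.
Qed.

Lemma gauss_monomial_integrable m n a b : integrableC (gauss_monomial m n a b).
Proof.
elim: a b m n => [|a IHa]; first elim=> [|b IHb] m n.
- by case: (gauss_monomial_real m n).
- rewrite (funext (gauss_monomialSb _ _ _ _)).
  apply: integrableC_lin => //.
  rewrite -[gauss_monomial _ _ _ _]/(fun z => gauss_monomial m n.+1 0 b z).
  rewrite (_ : (fun _ => _) = fun z => - 'i%C * gauss_monomial m n.+1 0 b z + 0).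
    by apply: integrableC_lin => //; exact: integrableC0.
  by apply/funext => z; rewrite addr0.
- move=> b m n; rewrite (funext (gauss_monomialSa _ _ _ _)).
  apply: integrableC_lin => //.
  rewrite (_ : (fun _ => _) = fun z => 'i%C * gauss_monomial m n.+1 a b z + 0).
    by apply: integrableC_lin => //; exact: integrableC0.
  by apply/funext => z; rewrite addr0.
Qed.

Local Notation J m n a b := (integralC (gauss_monomial m n a b)).

Let integralC_lin2 c d f g : integrableC f -> integrableC g ->
  integralC (fun z => c * f z + d * g z) = c * integralC f + d * integralC g.
Proof.
move=> hf hg.
have E : (fun z => d * g z) = (fun z => d * g z + 0) by apply/funext => z; rewrite addr0.
have i : integrableC (fun z => d * g z).
  by rewrite E; apply: integrableC_lin => //; exact: integrableC0.
by rewrite integralC_lin// E integralC_lin ?integralC0 ?addr0//; exact: integrableC0.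
Qed.

Let JSa m n a b : J m n a.+1 b = J m.+1 n a b + 'i%C * J m n.+1 a b.
Proof.
rewrite (funext (gauss_monomialSa _ _ _ _)) integralC_lin2 ?mul1r//;
exact: gauss_monomial_integrable.
Qed.

Let JSb m n a b : J m n a b.+1 = J m.+1 n a b - 'i%C * J m n.+1 a b.
Proof.
rewrite (funext (gauss_monomialSb _ _ _ _)) integralC_lin2 ?mul1r ?mulNr//;
exact: gauss_monomial_integrable.
Qed.

(* Integration by parts in x and in y. Writing one factor z or its conjugate
   as x + iy or x - iy lowers a or b, down to products of real moments. *)
Let J_by_parts a b m n :
  2 * J m.+1 n a b = m%:R * J m.-1 n a b + a%:R * J m n a.-1 b + b%:R * J m n a b.-1
  /\ 2 * J m n.+1 a b = n%:R * J m n.-1 a b + 'i%C * a%:R * J m n a.-1 b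
                        - 'i%C * b%:R * J m n a b.-1.
Proof.
elim: a b m n => [|a IHa]; first elim=> [|b IHb] m n.
- have re k l : J k l 0 0 = (gauss_moment R k * gauss_moment R l)%:C.
    by case: (gauss_monomial_real k l).
  rewrite !re !mul0r !mulr0 !mul0r !addr0 subr0.
  have nC k : (k%:R : R[i]) = (k%:R : R)%:C by rewrite rmorph_nat.
  split; rewrite !nC -!rmorphM; congr (_%:C).
    by rewrite !mulrA gauss_moment_rec.
  by rewrite mulrCA gauss_moment_rec mulrCA.
- have [x1 y1] := IHb m.+1 n; have [x2 y2] := IHb m n.+1.
  rewrite (JSb m.+1) (JSb m n.+1) !mul0r !mulr0 !mul0r !addr0 ?add0r in x1 y1 x2 y2 *.
  have hm : m%:R * J m.-1 n 0 b.+1 = m%:R * (J m n 0 b - 'i%C * J m.-1 n.+1 0 b).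
    by case: m {x1 y1 x2 y2} => [|m]; rewrite ?mul0r//= JSb.
  have hn : n%:R * J m n.-1 0 b.+1 = n%:R * (J m.+1 n.-1 0 b - 'i%C * J m n 0 b).
    by case: n {x1 y1 x2 y2 hm} => [|n]; rewrite ?mul0r//= JSb.
  rewrite hm hn /=.
  have hb : b%:R * J m.+1 n 0 b.-1 = b%:R * J m n 0 b + 'i%C * (b%:R * J m n.+1 0 b.-1).
    by case: b {IHb x1 y1 x2 y2 hm hn} => [|b]; rewrite ?mul0r ?mulr0 ?addr0//= JSb; ring.
  split.
  + transitivity (2 * J m.+2 n 0 b - 'i%C * (2 * J m.+1 n.+1 0 b)); first by ring.
    by rewrite x1 x2 /= hb -!natr1; ring.
  + transitivity (2 * J m.+1 n.+1 0 b - 'i%C * (2 * J m n.+2 0 b)); first by ring.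
    rewrite y1 y2 /= -!(mulrA 'i%C b%:R) hb -!natr1; ring.
- move=> b m n.
  have [x1 y1] := IHa b m.+1 n; have [x2 y2] := IHa b m n.+1.
  rewrite !JSa.
  have hm : m%:R * J m.-1 n a.+1 b = m%:R * (J m n a b + 'i%C * J m.-1 n.+1 a b).
    by case: m {x1 y1 x2 y2} => [|m]; rewrite ?mul0r//= JSa.
  have hn : n%:R * J m n.-1 a.+1 b = n%:R * (J m.+1 n.-1 a b + 'i%C * J m n a b).
    by case: n {x1 y1 x2 y2 hm} => [|n]; rewrite ?mul0r//= JSa.
  have ha : a%:R * J m.+1 n a.-1 b = a%:R * J m n a b - 'i%C * (a%:R * J m n.+1 a.-1 b).
    by case: a {IHa x1 y1 x2 y2 hm hn} => [|a]; rewrite ?mul0r ?mulr0 ?subr0//= JSa; ring.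
  rewrite -!JSa hm hn !JSa /=.
  split.
  + transitivity (2 * J m.+2 n a b + 'i%C * (2 * J m.+1 n.+1 a b)); first by ring.
    by rewrite x1 x2 /= ha -!natr1; ring.
  + transitivity (2 * J m.+1 n.+1 a b + 'i%C * (2 * J m n.+2 a b)); first by ring.
    by rewrite y1 y2 /= -!(mulrA 'i%C a%:R) ha -!natr1; ring.
Qed.

Let conj_moment a b : J 0 0 a.+1 b = b%:R * J 0 0 a b.-1.
Proof.
have [x y] := J_by_parts a b 0 0.
apply: (@mulfI _ 2); first by rewrite pnatr_eq0.
rewrite JSa mulrDr x mulrCA y !mul0r.
have ii : 'i%C * 'i%C = -1 :> R[i] by rewrite -expr2 sqr_i.
transitivity (a%:R * J 0 0 a.-1 b + b%:R * J 0 0 a b.-1 + 'i%C * 'i%C * (a%:R * J 0 0 a.-1 b)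
  - 'i%C * 'i%C * (b%:R * J 0 0 a b.-1)); first by ring.
by rewrite ii; ring.
Qed.

Let conj_moment' a b : J 0 0 a b.+1 = a%:R * J 0 0 a.-1 b.
Proof.
have [x y] := J_by_parts a b 0 0.
apply: (@mulfI _ 2); first by rewrite pnatr_eq0.
rewrite JSb mulrBr x mulrCA y !mul0r.
have ii : 'i%C * 'i%C = -1 :> R[i] by rewrite -expr2 sqr_i.
transitivity (a%:R * J 0 0 a.-1 b + b%:R * J 0 0 a b.-1 - 'i%C * 'i%C * (a%:R * J 0 0 a.-1 b)
  + 'i%C * 'i%C * (b%:R * J 0 0 a b.-1)); first by ring.
by rewrite ii; ring.
Qed.

(** Powers of z and of its conjugate are orthogonal for the Gaussian weight:
    integrating a derivative with respect to the conjugate of z lowers both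
    exponents at once. *)
Lemma complex_gauss_moment a b : integralC (gauss_monomial 0 0 a b) =
  (if a == b then a`!%:R * (gauss_moment R 0 ^+ 2)%:C else 0).
Proof.
elim: a b => [|a IH] [|b].
- by case: (gauss_monomial_real 0 0) => _ ->; rewrite mul1r expr2.
- by rewrite conj_moment' mul0r.
- by rewrite conj_moment mul0r.
- rewrite conj_moment /= IH eqSS; case: eqP => [->|_]; last by rewrite mulr0.
  by rewrite mulrA -natrM factS.
Qed.

End ComplexIntegral.

(** * The Fischer inner product on polynomials *)

Section Fischer.
Variable R : realType.
Local Notation C := R[i].

(** Sums of products of functions of one coordinate are integrated one
    coordinate at a time; the sum is carried along because integrability is
    available for each product only. *)
Lemma integralCn_sum_prod (d : nat) (I : Type) (s : seq I) (c : I -> C)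
    (h : I -> 'I_d -> C -> C) : (forall k i, integrableC (h k i)) ->
  integralCn (fun z : 'rV[C]_d => \sum_(k <- s) c k * \prod_(i < d) h k i (z 0 i)) =
  \sum_(k <- s) c k * \prod_(i < d) integralC (h k i).
Proof.
elim: d c h => [|d IH] c h hh.
  by rewrite /=; apply: eq_bigr => k _; rewrite !big_ord0.
rewrite /=.
pose g k x := \prod_(i < d) integralC (h k (lift ord0 i)).
rewrite (_ : (fun x => _) = fun x => \sum_(k <- s)
    (c k * \prod_(i < d) integralC (h k (lift ord0 i))) * h k ord0 x).
  rewrite (proj2 (integrableC_sum _ _ _))//.
  by apply: eq_bigr => k _; rewrite big_ord_recl mulrAC mulrA.
apply/funext => x.
rewrite (_ : (fun y : 'rV_d => _) = fun y : 'rV_d => \sum_(k <- s) (c k * h k ord0 x) *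
    \prod_(i < d) h k (lift ord0 i) (y 0 i)).
  rewrite (IH (fun k => c k * h k ord0 x) (fun k i => h k (lift ord0 i)))//.
  by apply: eq_bigr => k _; rewrite mulrAC.
apply/funext => y; apply: eq_bigr => k _; rewrite big_ord_recl mulrA.
congr (_ * _ * _).
  rewrite (_ : ord0 = lshift d (0 : 'I_1)); last exact: val_inj.
  by rewrite (@row_mxEl _ 1 1) mxE eqxx.
apply: eq_bigr => i _; rewrite (_ : lift ord0 i = rshift 1 i); last exact: val_inj.
by rewrite (@row_mxEr _ 1 1).
Qed.

Definition fischer_weight (d : nat) (m : mpoly.multinom d) : C :=
  ((@pi R) ^- d)%:C * \prod_(i < d) integralC (gauss_monomial 0 0 (mpoly.fun_of_multinom m i) (mpoly.fun_of_multinom m i)).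

Lemma fischer_weight_gt0 d (m : mpoly.multinom d) : 0 < fischer_weight m.
Proof.
apply: mulr_gt0; first by rewrite ltcR invr_gt0 exprn_gt0// pi_gt0.
apply: prodr_gt0 => i _; rewrite complex_gauss_moment eqxx.
apply: mulr_gt0; first by rewrite ltr0n fact_gt0.
by rewrite ltcR exprn_gt0// gauss_moment0_gt0.
Qed.

Lemma pevalE d (p : mpoly.mpoly d C) (z : 'rV[C]_d) : peval p z =
  \sum_(m <- mpoly.msupp p) mpoly.mcoeff m p * \prod_i z 0 i ^+ mpoly.fun_of_multinom m i.
Proof. exact: mpoly.mevalE. Qed.

Lemma gauss_rowE d (z : 'rV[C]_d) :
  (expR (- sqnorm z))%:C = \prod_(i < d) gauss2 (z 0 i).
Proof.
rewrite /sqnorm big_ord1 -sumrN expR_sum /gauss2 -rmorph_prod.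
by [].
Qed.

(** Monomials are orthogonal for the Fischer product, which is therefore a
    weighted sum over the coefficients. *)
Lemma fischerE d (p q : mpoly.mpoly d C) : fischer (peval p) (peval q) =
  \sum_(m <- mpoly.msupp p) mpoly.mcoeff m p * Num.conj (mpoly.mcoeff m q) * fischer_weight m.
Proof.
rewrite /fischer.
pose s := allpairs pair (mpoly.msupp p) (mpoly.msupp q).
rewrite (_ : (fun z => _) = fun z : 'rV[C]_d => \sum_(k <- s)
   (mpoly.mcoeff k.1 p * Num.conj (mpoly.mcoeff k.2 q)) * \prod_(i < d)
   gauss_monomial 0 0 (mpoly.fun_of_multinom k.1 i) (mpoly.fun_of_multinom k.2 i) (z 0 i)); last first.
  apply/funext => z; rewrite !pevalE gauss_rowE rmorph_sum big_allpairs /=.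
  rewrite !mulr_suml. apply eq_bigr => m _.
  rewrite mulr_sumr mulr_suml; apply eq_bigr => m' _.
  rewrite rmorphM rmorph_prod /= mulrACA -big_split -[LHS]mulrA -big_split /=.
  congr (_ * _); apply eq_bigr => i _.
  by rewrite /gauss_monomial !expr0 !mul1r rmorphXn.
rewrite (integralCn_sum_prod _ _ (fun k i => gauss_monomial_integrable _ _ _ _ _)).
rewrite big_allpairs /= mulr_sumr; apply eq_bigr => m _.
rewrite mulr_sumr.
have [mq|mq] := boolP (m \in mpoly.msupp q).
  rewrite (bigD1_seq m) ?mpoly.msupp_uniq//= [X in _ + X]big1 ?addr0.
    by rewrite /fischer_weight mulrCA.
  move=> m' m'm; rewrite [X in _ * X](_ : _ = 0) ?mulr0//.
  have [i ne] : exists i, mpoly.fun_of_multinom m i != mpoly.fun_of_multinom m' i.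
    apply/existsP; rewrite -negb_forall; apply: contra m'm => /forallP h.
    by rewrite eq_sym; apply/eqP/mpoly.mnmP => i; apply/eqP.
  rewrite (bigD1 i)//= complex_gauss_moment (negPf ne) mul0r mulr0//.
rewrite (mpoly.memN_msupp_eq0 mq) rmorph0 mulr0 mul0r.
rewrite big_seq big1// => m' hm'; rewrite [X in _ * X](_ : _ = 0) ?mulr0//.
have [i ne] : exists i, mpoly.fun_of_multinom m i != mpoly.fun_of_multinom m' i.
  apply/existsP; rewrite -negb_forall; apply: contra mq => /forallP h.
  suff -> : m = m' by [].
  by apply/mpoly.mnmP => i; apply/eqP.
by rewrite (bigD1 i)//= complex_gauss_moment (negPf ne) mul0r mulr0.
Qed.

Lemma fischer_eq0 d (p : mpoly.mpoly d C) : fischer (peval p) (peval p) = 0 -> p = 0.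
Proof.
rewrite fischerE => h.
have ge0 m : 0 <= mpoly.mcoeff m p * Num.conj (mpoly.mcoeff m p) * fischer_weight m.
  by rewrite mulr_ge0 ?mul_conjC_ge0// ltW// fischer_weight_gt0.
apply/mpoly.mpolyP => m; rewrite mpoly.mcoeff0.
have [hm|/mpoly.memN_msupp_eq0//] := boolP (m \in mpoly.msupp p).
move: h; rewrite (bigD1_seq m) ?mpoly.msupp_uniq//= => /eqP.
rewrite paddr_eq0//; last by apply: sumr_ge0.
by case/andP; rewrite mulf_eq0 mul_conjC_eq0 (gt_eqF (fischer_weight_gt0 m)) orbF => /eqP.
Qed.

(** A polynomial that vanishes everywhere has Fischer norm zero. *)
Lemma peval_eq0 d (p : mpoly.mpoly d C) : (forall z, peval p z = 0) -> p = 0.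
Proof.
move=> h; apply: fischer_eq0; have -> : peval p = peval 0.
  by apply/funext => z; rewrite h /peval mpoly.meval0.
by rewrite fischerE mpoly.msupp0 big_nil.
Qed.

End Fischer.

(** * Linear combinations *)

Lemma linear_of (R : pzRingType) (V W : lmodType R) (f : V -> W) :
  (forall c x y, f (c *: x + y) = c *: f x + f y) ->
  exists F : {linear V -> W}, F =1 f.
Proof.
move=> h; pose F : {linear V -> W} := HB.pack f (GRing.isLinear.Build _ _ _ _ f h).
by exists F.
Qed.

Section Combinations.
Variables (K : pzRingType) (V : lmodType K) (T : Type).

Definition combinations (P : T -> Prop) (F : T -> V) : set V :=
  [set v | exists (n : nat) (c : 'I_n -> K) (k : 'I_n -> T),
     (forall l, P (k l)) /\ v = \sum_l c l *: F (k l)].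

Lemma combinations_lin P F a u v : combinations P F u -> combinations P F v ->
  combinations P F (a *: u + v).
Proof.
move=> [n [c [k [Pk ->]]]] [n' [c' [k' [Pk' ->]]]].
exists (n + n')%N,
  (fun l => match fintype.split l with inl i => a * c i | inr i => c' i end),
  (fun l => match fintype.split l with inl i => k i | inr i => k' i end).
split; first by move=> l; case: (fintype.split l).
rewrite big_split_ord /= scaler_sumr; congr (_ + _); apply: eq_bigr => i _.
  by rewrite (unsplitK (inl i)) scalerA.
by rewrite (unsplitK (inr i)).
Qed.

Lemma combinations0 P F : combinations P F 0.
Proof.
have k0 : 'I_0 -> T by case.
by exists 0%N, (fun=> 0), k0; split; [case|rewrite big_ord0].
Qed.

Lemma combinations1 (P : T -> Prop) F x : P x -> combinations P F (F x).
Proof. by exists 1%N, (fun=> 1), (fun=> x); rewrite big_ord1 scale1r. Qed.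

End Combinations.

Lemma invn_small (R : realType) (eps : R) : 0 < eps ->
  exists n0, forall n, (n0 <= n)%N -> n.+1%:R^-1 <= eps.
Proof.
move=> e0; exists (Num.truncn eps^-1) => n hn.
rewrite -[leRHS]invrK lef_pV2 ?posrE ?invr_gt0//.
by rewrite (le_trans (ltW (truncnS_gt _)))// ler_nat ltnS.
Qed.

(** * Linear substitutions and the degrees of monomials *)

Section LinearSubstitution.
Variable R : realType.
Local Notation C := R[i].

Definition psubst (m d : nat) (A : 'M[C]_(m, d)) (p : mpoly d C) : mpoly m C :=
  comp_mpoly [tuple \sum_(i < m) A i j *: mpolyX C (mnm1 i) | j < d] p.

Lemma peval_psubst m d (A : 'M[C]_(m, d)) (p : mpoly d C) x :
  peval (psubst A p) x = peval p (x *m A).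
Proof.
rewrite /peval /psubst comp_mpoly_meval; apply: meval_eq => j.
rewrite tnth_mktuple mxE raddf_sum /=; apply eq_bigr => i _.
by rewrite mevalZ mevalXU mulrC.
Qed.

Lemma peval_inj d (p q : mpoly d C) : (forall z, peval p z = peval q z) -> p = q.
Proof.
move=> h; apply/eqP; rewrite -subr_eq0; apply/eqP/peval_eq0 => z.
by rewrite /peval mevalB; apply/eqP; rewrite subr_eq0; apply/eqP/h.
Qed.

Lemma psubstA l m d (A : 'M[C]_(l, m)) (B : 'M[C]_(m, d)) p :
  psubst A (psubst B p) = psubst (A *m B) p.
Proof. by apply: peval_inj => z; rewrite !peval_psubst mulmxA. Qed.

Lemma pevalD d (p q : mpoly d C) z : peval (p + q) z = peval p z + peval q z.
Proof. exact: mevalD. Qed.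
Lemma pevalZ d c (p : mpoly d C) z : peval (c *: p) z = c * peval p z.
Proof. exact: mevalZ. Qed.
Lemma pevalX d (p : mpoly d C) n z : peval (p ^+ n) z = peval p z ^+ n.
Proof. exact: rmorphXn. Qed.
Lemma peval_sum d (I : Type) (s : seq I) (F : I -> mpoly d C) z :
  peval (\sum_(i <- s) F i) z = \sum_(i <- s) peval (F i) z.
Proof. exact: raddf_sum. Qed.
Lemma peval_prod d (I : Type) (s : seq I) (F : I -> mpoly d C) z :
  peval (\prod_(i <- s) F i) z = \prod_(i <- s) peval (F i) z.
Proof. exact: rmorph_prod. Qed.

Lemma psubstD m d (A : 'M[C]_(m, d)) p q : psubst A (p + q) = psubst A p + psubst A q.
Proof. exact: comp_mpolyD. Qed.
Lemma psubstZ m d (A : 'M[C]_(m, d)) c p : psubst A (c *: p) = c *: psubst A p.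
Proof. exact: comp_mpolyZ. Qed.
Lemma psubst_sum m d (A : 'M[C]_(m, d)) (I : Type) (s : seq I) (F : I -> mpoly d C) :
  psubst A (\sum_(i <- s) F i) = \sum_(i <- s) psubst A (F i).
Proof. exact: raddf_sum. Qed.

(** The monomials are linearly independent as functions of z. *)
Lemma diag_scaling_msupp d (p : mpoly d C) (c : multinom d -> C) :
  (forall z : 'rV[C]_d, \sum_(m <- msupp p) mcoeff m p * c m * \prod_i z 0 i ^+ m i = 0) ->
  forall m, m \in msupp p -> c m = 0.
Proof.
move=> h m hm.
pose q : mpoly d C := \sum_(m <- msupp p) (mcoeff m p * c m) *: mpolyX C m.
have q0 : q = 0.
  apply: peval_eq0 => z; rewrite -[RHS](h z) /q peval_sum; apply eq_bigr => k _.
  by rewrite pevalZ /peval mevalX.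
have : mcoeff m q = 0 by rewrite q0 mcoeff0.
rewrite /q raddf_sum /= (bigD1_seq m) ?msupp_uniq//= big1 ?addr0.
  rewrite mcoeffZ mcoeffX eqxx mulr1 => /eqP; rewrite mulf_eq0 => /orP[|/eqP//].
  by rewrite mcoeff_eq0 hm.
by move=> k /negPf km; rewrite mcoeffZ mcoeffX km mulr0.
Qed.

(** The scaling by t = 2 is enough, as 2^k determines k. *)
Lemma homog_msupp d (p : mpoly d C) n :
  (forall (t : C) z, peval p (t *: z) = t ^+ n * peval p z) ->
  forall m, m \in msupp p -> mdeg m = n.
Proof.
move=> h m hm.
have := @diag_scaling_msupp d p (fun m => 2 ^+ mdeg m - 2 ^+ n) _ m hm.
move=> e; have {}e : (2 : C) ^+ mdeg m - 2 ^+ n = 0.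
  apply: e => z; have := h 2 z; rewrite !pevalE => /eqP; rewrite -subr_eq0 => /eqP hz.
  rewrite -[RHS]hz mulr_sumr -sumrB; apply eq_bigr => k _.
  rewrite mulrBr mulrBl; congr (_ - _); last by rewrite [LHS]mulrAC mulrC.
  rewrite -mulrA mdegE -prodrXr -big_split /=; congr (_ * _).
  by apply eq_bigr => i _; rewrite mxE exprMn.
move/eqP: e; rewrite subr_eq0 -!natrX eqr_nat => /eqP.
by move/(f_equal (logn 2)); rewrite !pfactorK.
Qed.

Definition scale_coord d (i : 'I_d) (t : C) (z : 'rV[C]_d) : 'rV[C]_d :=
  \row_j (if j == i then t * z 0 j else z 0 j).

(** The second difference of t^k at t = 0, 1, 2 vanishes for k = 0, 1
    only. *)
Lemma affine_msupp d (p : mpoly d C) (i : 'I_d) :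
  (forall z, exists a b, forall t, peval p (scale_coord i t z) = a + t * b) ->
  forall m : multinom d, m \in msupp p -> (m i <= 1)%N.
Proof.
move=> h m hm.
pose c (m : multinom d) : C := 2 ^+ m i - 2 + (0 : C) ^+ m i.
have e : forall m, m \in msupp p -> c m = 0.
  apply: diag_scaling_msupp => z; have [a [b hab]] := h z.
  have E t : peval p (scale_coord i t z) =
      \sum_(m <- msupp p) mcoeff m p * t ^+ m i * \prod_j z 0 j ^+ m j.
    rewrite pevalE; apply eq_bigr => k _; rewrite -mulrA; congr (_ * _).
    rewrite (bigD1 i)//= [X in _ = _ * X](bigD1 i)//= mulrA; congr (_ * _).
      by rewrite mxE eqxx exprMn.
    by apply eq_bigr => j /negPf ji; rewrite mxE ji.
  have : peval p (scale_coord i 2 z) - 2 * peval p (scale_coord i 1 z) +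
     peval p (scale_coord i 0 z) = 0 by rewrite !hab; ring.
  rewrite !E mulr_sumr -sumrB -big_split /= => hz; rewrite -[RHS]hz.
  by apply eq_bigr => k _; rewrite /c expr1n; ring.
have := e m hm; rewrite /c; case: (m i) => [//|[//|n]].
rewrite expr0n addr0 => /eqP; rewrite subr_eq0 -natrX eqr_nat => /eqP.
by move/(f_equal (logn 2)); rewrite pfactorK.
Qed.

End LinearSubstitution.

(** * Riesz representation in spaces of polynomials *)

(** A subspace of maximal dimension inside W exhausts W. *)
Lemma vspace_of_set (K : fieldType) (vT : vectType K) (W : set vT) :
  W 0 -> (forall a u v, W u -> W v -> W (a *: u + v)) ->
  exists U : {vspace vT}, forall v, W v <-> v \in U.
Proof.
move=> W0 Wlin.
pose P k := `[< exists U : {vspace vT}, \dim U = k /\ forall v, v \in U -> W v >].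
have exP : exists k, P k.
  exists 0%N; apply/asboolP; exists 0%VS; rewrite dimv0; split=> // v.
  by rewrite memv0 => /eqP->.
have bnd k : P k -> (k <= \dim {:vT})%N.
  by move=> /asboolP[U [<- _]]; apply: dimvS; exact: subvf.
case: (ex_maxnP exP bnd) => k /asboolP[U [dU UW]] kmax.
exists U => v; split=> [Wv|/UW//].
have P' : P (\dim (U + <[v]>)%VS).
  apply/asboolP; exists (U + <[v]>)%VS; split=> // _ /memv_addP[u uU [_ /vlineP[c ->] ->]].
  by rewrite addrC; apply: Wlin => //; exact: UW.
have := kmax _ P'; rewrite -dU => le.
have /eqP -> : U == (U + <[v]>)%VS by rewrite eqEdim addvSl.
by apply/(subvP (addvSr U <[v]>)); exact: memv_line.
Qed.

Section Riesz.
Variables (R : realType) (d n : nat).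
Local Notation C := R[i].
Local Notation N := #|{: bmultinom d n}|.
Let mono (i : 'I_N) : multinom d := bmnm (enum_val i).
Let sw (m : multinom d) : C := sqrtC (fischer_weight R m).

Let sw_gt0 m : 0 < sw m.
Proof. by rewrite sqrtC_gt0 fischer_weight_gt0. Qed.

Let co (p : mpoly d C) : 'rV[C]_N := \row_i (mcoeff (mono i) p * sw (mono i)).
Let un (v : 'rV[C]_N) : mpoly d C := \sum_i (v 0 i / sw (mono i)) *: mpolyX C (mono i).

Let mono_inj : injective mono.
Proof. by move=> i j h; apply: enum_val_inj; apply/val_inj. Qed.

Let unK v : co (un v) = v.
Proof.
apply/rowP => i; rewrite mxE /un raddf_sum /= (bigD1 i)//= big1 ?addr0.
  by rewrite mcoeffZ mcoeffX eqxx mulr1 divfK// gt_eqF.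
move=> j ji; rewrite mcoeffZ mcoeffX (_ : mono j == mono i = false) ?mulr0//.
by apply/negbTE; apply: contra ji => /eqP/mono_inj->.
Qed.

Let bounded (p : mpoly d C) := forall m, m \in msupp p -> (mdeg m < n)%N.

Let mono_surj m : (mdeg m < n)%N -> exists i, mono i = m.
Proof.
by move=> h; exists (enum_rank (BMultinom h)); rewrite /mono enum_rankK.
Qed.

Let big_mono (F : multinom d -> C) (p : mpoly d C) : bounded p ->
  (forall m, m \notin msupp p -> F m = 0) ->
  \sum_(m <- msupp p) F m = \sum_i F (mono i).
Proof.
move=> bp F0; rewrite [RHS](bigID (fun i => mono i \in msupp p))/=.
rewrite [X in _ + X]big1 ?addr0; last by move=> i; exact: F0.
transitivity (\sum_(m <- [seq mono i | i <- index_enum 'I_N & mono i \in msupp p]) F m);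
  last by rewrite big_map big_filter.
apply: perm_big; apply: uniq_perm; first exact: msupp_uniq.
  by rewrite (map_inj_uniq mono_inj) filter_uniq// index_enum_uniq.
move=> m; apply/idP/mapP => [hm|[ i ]]; last by rewrite mem_filter => /andP[h _] ->.
have [i im] := mono_surj (bp m hm).
by exists i => //; rewrite mem_filter im hm mem_index_enum.
Qed.

Let fischer_co p q : bounded p -> fischer (peval p) (peval q) = dotmx (co p) (co q).
Proof.
move=> bp; rewrite fischerE big_mono//; last first.
  by move=> m /memN_msupp_eq0->; rewrite !mul0r.
rewrite dotmxE mxE; apply eq_bigr => i _; rewrite !mxE rmorphM /=.
rewrite (geC0_conj (ltW (sw_gt0 _))) [RHS]mulrACA.
by rewrite -[X in _ = _ * X]expr2 sqrtCK.
Qed.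

Let coK p : bounded p -> un (co p) = p.
Proof.
move=> bp; apply/mpolyP => m.
have e (i : 'I_N) : co p 0 i / sw (mono i) = mcoeff (mono i) p.
  by rewrite mxE mulfK// gt_eqF.
rewrite /un raddf_sum /=.
have [hm|hm] := boolP (m \in msupp p).
  have [i im] := mono_surj (bp m hm).
  rewrite (bigD1 i)//= big1 ?addr0; first by rewrite e mcoeffZ mcoeffX im eqxx mulr1.
  move=> j ji; rewrite mcoeffZ mcoeffX (_ : mono j == m = false) ?mulr0//.
  by apply/negbTE; apply: contra ji => /eqP; rewrite -im => /mono_inj->.
rewrite (memN_msupp_eq0 hm) big1// => i _; rewrite e mcoeffZ mcoeffX.
by case: eqP => [->|]; rewrite ?mulr0// (memN_msupp_eq0 hm) mul0r.
Qed.

Let un_lin a u v : un (a *: u + v) = a *: un u + un v.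
Proof.
rewrite /un scaler_sumr -big_split /=; apply eq_bigr => i _.
by rewrite !mxE scalerA -scalerDl mulrDl mulrA.
Qed.

(** Coefficients scaled by the square roots of the weights identify the
    polynomials of bounded degree with row vectors and the Fischer product with
    the standard one; there h is the orthogonal projection to V of the vector
    that represents L. *)
Lemma fischer_riesz (V : set (mpoly d C)) (L : mpoly d C -> C) :
  (forall p, V p -> forall m, m \in msupp p -> (mdeg m < n)%N) ->
  V 0 -> (forall a p q, V p -> V q -> V (a *: p + q)) ->
  (forall a p q, L (a *: p + q) = a * L p + L q) ->
  exists2 h, V h & forall p, V p -> L p = fischer (peval p) (peval h).
Proof.
move=> Vb V0 Vlin Llin.
have L0 : L 0 = 0 by have := Llin (-1) 0 0; rewrite scaler0 addr0 mulN1r addNr.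
have Lsum (I : Type) (s : seq I) (c : I -> C) (F : I -> mpoly d C) :
    L (\sum_(i <- s) c i *: F i) = \sum_(i <- s) c i * L (F i).
  elim: s => [|i s IH]; first by rewrite !big_nil.
  by rewrite !big_cons Llin IH.
have un0 : un 0 = 0 by rewrite /un big1// => i _; rewrite mxE mul0r scale0r.
have [U hU] : exists U : {vspace 'rV[C]_N}, forall v, V (un v) <-> v \in U.
  apply: (@vspace_of_set _ _ [set v | V (un v)]) => /=; first by rewrite un0.
  by move=> a u v hu hv; rewrite un_lin; exact: Vlin.
pose g : 'rV[C]_N := \row_i (Num.conj (L (mpolyX C (mono i))) / sw (mono i)).
have Lg v : L (un v) = dotmx v g.
  rewrite /un Lsum dotmxE mxE; apply eq_bigr => i _.
  have cV m : Num.conj (sw m)^-1 = (sw m)^-1.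
    by apply: geC0_conj; rewrite invr_ge0 ltW.
  rewrite /g !mxE rmorphM /= conjCK [X in _ = _ * (_ * X)]cV.
  by rewrite mulrAC mulrA.
have [X XU [Y [gXY _ YS]]] := orthogonal_split (@dotmx C N) (vbasis U) g.
have spanU : <<vbasis U>>%VS = U by apply: span_basis; exact: vbasisP.
exists (un X); first by apply/hU; rewrite -spanU.
move=> p Vp; have bp := Vb p Vp.
have pU : co p \in U by apply/hU; rewrite coK.
rewrite -{1}(coK bp) Lg gXY linearDr fischer_co// unK [X in _ + X](_ : _ = 0) ?addr0//.
rewrite (coord_vbasis pU) linear_sumlz big1// => i _.
rewrite linearZl_LR /=; have /orthoPl h := YS.
have hz : dotmx (vbasis U)`_i Y = 0.
  rewrite hermC expr0 mul1r; apply/eqP; rewrite conjC_eq0; apply/eqP; apply: h.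
  by rewrite mem_nth// size_tuple.
transitivity (coord (vbasis U) i (co p) * 0); last by rewrite mulr0.
by congr (_ * _).
Qed.

End Riesz.

(** * Separation of degrees in unordered sums *)

Section DegreeSeparation.
#[local] Existing Instance summability.totally_filter.
Variables (R : realType) (I : choiceType).
Local Notation C := R[i].

Lemma partial_sumE (f : I -> C^o) (J : {fset I}) :
  summability.partial_sum f J = \sum_(s <- J) f s.
Proof. by rewrite /summability.partial_sum big_seq_fsetE. Qed.

Lemma cvg_partial_sum0 (f : I -> C^o) (eps : C) : 0 < eps ->
  summability.partial_sum f @ summability.totally --> (0 : C^o) ->
  exists J0 : {fset I}, forall J, (J0 `<=` J)%fset -> `|\sum_(s <- J) f s| <= eps.
Proof.
move=> eps0 /cvgrPdist_le /(_ eps eps0) [J0 _ h].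
by exists J0 => J /h; rewrite /= sub0r normrN partial_sumE.
Qed.

Let sum_fsetU (f : I -> C) (J J0 : {fset I}) :
  \sum_(s <- (J `|` J0)%fset) f s = \sum_(s <- J) f s + \sum_(s <- J0 | s \notin J) f s.
Proof.
rewrite (bigID (fun s => s \in J)) /=; congr (_ + _).
  by apply: eq_fbigl_cond => s; rewrite !inE /=; case: (s \in J); rewrite ?andbF ?andbT.
by apply: eq_fbigl_cond => s; rewrite !inE /=; case: (s \in J); rewrite ?andbF ?andbT.
Qed.

Lemma Re_sum (T : Type) (s : seq T) (P : pred T) (f : T -> C) :
  complex.Re (\sum_(x <- s | P x) f x) = \sum_(x <- s | P x) complex.Re (f x).
Proof. by apply: (big_morph (@complex.Re R)) => // -[? ?] [? ?]. Qed.

Lemma Im_sum (T : Type) (s : seq T) (P : pred T) (f : T -> C) :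
  complex.Im (\sum_(x <- s | P x) f x) = \sum_(x <- s | P x) complex.Im (f x).
Proof. by apply: (big_morph (@complex.Im R)) => // -[? ?] [? ?]. Qed.

Lemma le_Re (x y : C) : x <= y -> complex.Re x <= complex.Re y.
Proof. by rewrite lecE => /andP[]. Qed.

Lemma Re_norm_le (x : C) : `|complex.Re x| <= complex.Re `|x|.
Proof. by have := normc_ge_Re x; rewrite lecE /= => /andP[]. Qed.

Lemma Re_norm_ge0 (x : C) : 0 <= complex.Re `|x|.
Proof. exact: le_trans (Re_norm_le x). Qed.

Lemma Re_normZ (t : R) (x : C) : complex.Re `|t%:C * x| = `|t| * complex.Re `|x|.
Proof.
rewrite normrM [X in complex.Re (X * _)]normc_def /= expr0n addr0 sqrtr_sqr.
by rewrite mul0r subr0.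
Qed.

Lemma Im_norm_le (x : C) : `|complex.Im x| <= complex.Re `|x|.
Proof.
rewrite normc_def /= -[leLHS]sqrtr_sqr ler_wsqrtr//.
by rewrite lerDr sqr_ge0.
Qed.

Lemma norm_le_ReIm (x : C) : complex.Re `|x| <= `|complex.Re x| + `|complex.Im x|.
Proof.
rewrite normc_def /= -[leRHS]ger0_norm ?addr_ge0// -[leRHS]sqrtr_sqr ler_wsqrtr//.
rewrite sqrrD !real_normK ?num_real// -addrA lerD2l lerDr.
by rewrite mulrn_wge0// mulr_ge0.
Qed.

Let real_abs_bound (f : I -> R) (B : R) :
  (forall J : {fset I}, `|\sum_(s <- J) f s| <= B) ->
  forall J : {fset I}, \sum_(s <- J) `|f s| <= B + B.
Proof.
move=> h J; rewrite (bigID (fun s => 0 <= f s)) /= lerD//.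
  apply: le_trans (h [fset s in J | 0 <= f s]%fset); rewrite big_fset /=.
  by apply: le_trans (ler_norm _); apply: ler_sum => s /ger0_norm->.
apply: le_trans (h [fset s in J | ~~ (0 <= f s)]%fset); rewrite big_fset /= -normrN.
apply: le_trans (ler_norm _); rewrite -sumrN; apply: ler_sum => s.
by rewrite -ltNge => /ltr0_norm->.
Qed.

(** A convergent unordered series converges absolutely: its finite partial sums
    are bounded, hence so are those of the absolute values. *)
Lemma unordered_cvg_abs (f : I -> C^o) :
  summability.partial_sum f @ summability.totally --> (0 : C^o) ->
  exists2 B : R, 0 < B & forall J : {fset I}, \sum_(s <- J) complex.Re `|f s| <= B.
Proof.
move=> cf; have [J0 hJ0] := cvg_partial_sum0 ltr01 cf.
pose B0 : R := 1 + \sum_(s <- J0) complex.Re `|f s|.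
have Re0 s : 0 <= complex.Re `|f s| by exact: Re_norm_ge0.
have B00 : 0 < B0 by rewrite ltr_pwDl// sumr_ge0.
have bnd (J : {fset I}) : complex.Re `|\sum_(s <- J) f s| <= B0.
  have e := sum_fsetU f J J0.
  have {}e : \sum_(s <- J) f s =
      \sum_(s <- (J `|` J0)%fset) f s - \sum_(s <- J0 | s \notin J) f s by rewrite e addrK.
  rewrite e; have h1 := hJ0 (J `|` J0)%fset (fsubsetUr _ _).
  apply: le_trans (le_Re (le_trans (ler_normB _ _) (lerD h1 (ler_norm_sum _ _ _)))) _.
  rewrite raddfD /= lerD2l Re_sum [leRHS](bigID (fun s => s \notin J)) /= lerDl.
  by apply: sumr_ge0 => s _; exact: Re0.
have bR (J : {fset I}) : `|\sum_(s <- J) complex.Re (f s)| <= B0.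
  by have := le_trans (Re_norm_le (\sum_(s <- J) f s)) (bnd J); rewrite Re_sum.
have bI (J : {fset I}) : `|\sum_(s <- J) complex.Im (f s)| <= B0.
  by have := le_trans (Im_norm_le (\sum_(s <- J) f s)) (bnd J); rewrite Im_sum.
exists ((B0 + B0) + (B0 + B0)); first exact: (addr_gt0 (addr_gt0 B00 B00) (addr_gt0 B00 B00)).
move=> J; apply: le_trans (lerD (real_abs_bound bR J) (real_abs_bound bI J)).
by rewrite -big_split; apply: ler_sum => s _; exact: norm_le_ReIm.
Qed.

(** Uniqueness of power series, for an unordered family graded by deg. By
    induction the degrees below n cancel; those above n contribute at most
    t^(n+1) times a bound for the sums of absolute values, and t tends
    to 0. *)
Lemma degree_separation (f : I -> C^o) (deg : I -> nat) (A : nat -> {fset I}) :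
  (forall n s, (s \in A n) = (deg s == n)) ->
  (forall t : R, 0 < t <= 1 -> summability.partial_sum (fun s => t%:C ^+ deg s * f s : C^o)
     @ summability.totally --> (0 : C^o)) ->
  forall n, \sum_(s <- A n) f s = 0.
Proof.
move=> hA hf.
have cf : summability.partial_sum f @ summability.totally --> (0 : C^o).
  have := hf 1; rewrite ltr01 lexx => /(_ isT).
  by rewrite (_ : (fun s => _) = f)//; apply/funext => s; rewrite expr1n mul1r.
have [B B0 hB] := unordered_cvg_abs cf.
elim/ltn_ind => n IH.
pose U : {fset I} := (\bigcup_(k <- iota 0 n.+1) A k)%fset.
have key (t : R) : 0 < t <= 1 -> complex.Re `|\sum_(s <- A n) f s| <= t * B.
  move=> t01; have /andP[t0 t1] := t01.
  suff h eps : 0 < eps -> t ^+ n * complex.Re `|\sum_(s <- A n) f s| <= eps + t ^+ n * (t * B).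
    rewrite -(ler_pM2l (exprn_gt0 n t0)); apply/ler_addgt0Pr => eps e0.
    by rewrite addrC; exact: h.
  move=> eps0; have eC : 0 < eps%:C by rewrite ltcR.
  have [J0 hJ0] := cvg_partial_sum0 eC (hf t t01).
  pose J := (J0 `|` U)%fset.
  have AJ k : (k <= n)%N -> (A k `<=` J)%fset.
    move=> kn; apply/fsubsetP => s sA; rewrite inE; apply/orP; right.
    by apply/bigfcupP; exists k => //; rewrite mem_iota ltnS kn.
  have lev k : (k <= n)%N -> \sum_(s <- J | deg s == k) (t%:C ^+ deg s * f s) =
      t%:C ^+ k * \sum_(s <- A k) f s.
    move=> kn; rewrite mulr_sumr.
    transitivity (\sum_(s <- J | deg s == k) t%:C ^+ k * f s).
      by apply: eq_bigr => s /eqP->.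
    apply: eq_fbigl_cond => s; rewrite !inE -hA andbT; apply/andP/idP => [[]//|sA].
    by split=> //; have /fsubsetP/(_ s sA) := AJ k kn; rewrite inE.
  have low : \sum_(s <- J | (deg s < n)%N) (t%:C ^+ deg s * f s) = 0.
    rewrite (partition_big (fun s => inord (deg s) : 'I_n.+1) (fun k => (k < n)%N))/=; last first.
      by move=> s sn; rewrite inordK// ltnS ltnW.
    apply: big1 => k kn.
    transitivity (t%:C ^+ k * \sum_(s <- A k) f s); last by rewrite IH// mulr0.
    rewrite -lev; last exact: ltnW.
    apply: eq_bigl => s; apply/andP/eqP => [[sn /eqP<-]|e]; first by rewrite inordK// ltnS ltnW.
    by rewrite e; split=> //; rewrite inord_val.
  have := hJ0 J (fsubsetUl _ _).
  rewrite (bigID (fun s => (deg s < n)%N))/= low add0r (bigID (fun s => deg s == n))/=.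
  rewrite (eq_bigl (fun s => deg s == n)); last first.
    by move=> s; case: eqP => [->|]; rewrite ?ltnn ?andbF.
  rewrite lev// => hle.
  set hi := \sum_(s <- J | _) _ in hle.
  have hhi : complex.Re `|hi| <= t ^+ n * (t * B).
    apply: le_trans (le_Re (ler_norm_sum _ _ _)) _.
    rewrite Re_sum.
    apply: (@le_trans _ _ (\sum_(s <- J | ~~ (deg s < n)%N && (deg s != n))
        t ^+ n.+1 * complex.Re `|f s|)).
      apply: ler_sum => s /andP[h1 h2]; rewrite -rmorphXn Re_normZ.
      rewrite (ger0_norm (exprn_ge0 _ (ltW t0))) ler_wpM2r ?Re_norm_ge0//.
      by rewrite ler_wiXn2l ?(ltW t0)// ltn_neqAle eq_sym h2 leqNgt.
    rewrite -mulr_sumr mulrA -exprSr ler_wpM2l ?exprn_ge0 ?(ltW t0)//.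
    apply: le_trans (hB J); rewrite [leRHS](bigID (fun s => ~~ (deg s < n)%N && (deg s != n))).
    by rewrite lerDl; apply: sumr_ge0 => s _; exact: Re_norm_ge0.
  have -> : t ^+ n * complex.Re `|\sum_(s <- A n) f s| = complex.Re `|t%:C ^+ n * \sum_(s <- A n) f s|.
    by rewrite -rmorphXn Re_normZ (ger0_norm (exprn_ge0 _ (ltW t0))).
  set lo := t%:C ^+ n * _ in hle *.
  have -> : lo = (lo + hi) - hi by rewrite addrK.
  apply: le_trans (le_Re (le_trans (ler_normB (lo + hi) hi) (lerD hle (lexx _)))) _.
  by rewrite raddfD /= lerD2l.
suff : complex.Re `|\sum_(s <- A n) f s| <= 0.
  move=> h; apply: Normc.eq0_normc; apply/eqP; rewrite eq_le; apply/andP; split.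
    exact: h.
  exact: Re_norm_ge0.
apply/ler_addgt0Pr => eps e0; rewrite add0r.
pose t := Num.min 1 (eps / B).
have t0 : 0 < t by rewrite lt_min ltr01 divr_gt0.
apply: (le_trans (key t _)); first by rewrite t0 ge_min lexx.
by rewrite -ler_pdivlMr// ge_min lexx orbT.
Qed.

End DegreeSeparation.

(** * Leading monomials in the spaces P_s *)

Section LeadingMonomials.
Variables (R : realType) (d r : nat) (O : set 'rV[R[i]]_d).
Variables (Delta : 'I_r -> mpoly d R[i]) (e : 'I_r -> 'rV[R[i]]_d).
Local Notation C := R[i].

Hypothesis homDelta : forall j (t : C) z,
  peval (Delta j) (t *: z) = t ^+ j.+1 * peval (Delta j) z.
Hypothesis affDelta : forall k, groupK O k -> forall j l z (t : C),
  peval (Delta j) (z + t *: (e l *m k)) = peval (Delta j) z +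
    t * (peval (Delta j) (z + e l *m k) - peval (Delta j) z).
Hypothesis normDelta : forall j, peval (Delta j) (\sum_(i < r | (i < j.+1)%N) e i) = 1.
Hypothesis groupK1 : groupK O 1%:M.

Definition frame_mx : 'M[C]_(r, d) := \matrix_i e i.

Lemma mul_frame_mx (x : 'rV[C]_r) : x *m frame_mx = \sum_i x 0 i *: e i.
Proof. by rewrite mulmx_sum_row; apply: eq_bigr => i _; rewrite rowK. Qed.

Definition step_mnm (j : nat) : multinom r := Multinom [tuple ((i < j.+1)%N : nat) | i < r].

Lemma Delta_frame_msupp j k m : groupK O k ->
  m \in msupp (psubst (frame_mx *m k) (Delta j)) -> mechar j.+1 m.
Proof.
move=> Kk hm; apply/andP; split.
  apply/eqP; move: m hm; apply: homog_msupp => t z.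
  by rewrite !peval_psubst -scalemxAl homDelta.
apply/forallP => i; move: m hm; apply: affine_msupp => z.
have E t : scale_coord i t z *m (frame_mx *m k) =
    (scale_coord i 0 z *m (frame_mx *m k)) + (t * z 0 i) *: (e i *m k).
  rewrite !mulmxA !mul_frame_mx (bigD1 i)//= [in RHS](bigD1 i)//= !mxE eqxx mul0r scale0r add0r.
  rewrite addrC mulmxDl -scalemxAl; congr (_ *m _ + _).
  by apply: eq_bigr => l /negPf li; rewrite !mxE li.
exists (peval (Delta j) (scale_coord i 0 z *m (frame_mx *m k))).
exists (z 0 i * (peval (Delta j) (scale_coord i 0 z *m (frame_mx *m k) + e i *m k)
   - peval (Delta j) (scale_coord i 0 z *m (frame_mx *m k)))).
by move=> t; rewrite peval_psubst E affDelta// mulrA.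
Qed.

(** The polynomial Delta_j (\sum_i x_i e_i k) is homogeneous of degree j + 1
    and affine in every x_i: its monomials are square-free, and the largest
    square-free monomial of that degree is x_0 ... x_j. *)
Lemma mlead_Delta_frame (j : 'I_r) k : groupK O k ->
  (mlead (psubst (frame_mx *m k) (Delta j)) <= step_mnm j)%O.
Proof.
move=> Kk; have [->|nz] := eqVneq (psubst (frame_mx *m k) (Delta j)) 0.
  by rewrite mlead0 le0x.
have /(Delta_frame_msupp Kk) := mlead_supp nz.
by rewrite -(@mem_msupp_mesym r C) => /msupp_le_mlead; rewrite mlead_mesym.
Qed.

(** At x = (1, ..., 1, 0, ..., 0), with j + 1 ones, the polynomial takes the
    value of Delta_j at the unit, and x_0 ... x_j is the only square-free
    monomial of degree j + 1 that does not vanish. *)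
Lemma mcoeff_Delta_frame (j : 'I_r) :
  mcoeff (step_mnm j) (psubst frame_mx (Delta j)) = 1.
Proof.
pose x : 'rV[C]_r := \row_i (i < j.+1)%:R.
have <- : peval (psubst frame_mx (Delta j)) x = 1.
  rewrite peval_psubst mul_frame_mx -[RHS](normDelta j); congr peval.
  rewrite [RHS]big_mkcond /=; apply: eq_bigr => i _; rewrite mxE.
  by case: (_ < _)%N; rewrite ?scale1r ?scale0r.
have x1 (m : multinom r) : mechar j.+1 m -> m != step_mnm j -> \prod_i x 0 i ^+ m i = 0.
  rewrite mecharP => /existsP[h /andP[/eqP-> /eqP ch]] ne.
  have [i hi ji] : exists2 i : 'I_r, i \in h & ~~ (i < j.+1)%N.
    apply/exists_inP; apply: contraR ne; rewrite negb_exists_in => /forall_inP hh.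
    suff -> : h = [set i : 'I_r | (i < j.+1)%N]%SET.
      by apply/eqP/mnmP => i; rewrite !mnmE inE.
    apply/eqP; rewrite eqEcard; apply/andP; split.
      by apply/fintype.subsetP => i /hh; rewrite negbK inE.
    by rewrite ch -sum1dep_card -(big_ord_widen _ (fun _ => 1%N))//= sum1_card card_ord.
  by rewrite (bigD1 i)//= mxE (negPf ji) mnmE hi expr1 mul0r.
rewrite pevalE; set p := psubst _ _.
have hp m : m \in msupp p -> mechar j.+1 m.
  by rewrite /p -[frame_mx]mulmx1; exact: Delta_frame_msupp.
have xs : \prod_i x 0 i ^+ step_mnm j i = 1.
  by apply: big1 => i _; rewrite mxE mnmE; case: (_ < _)%N; rewrite ?expr1n ?expr0.
have [hm|hm] := boolP (step_mnm j \in msupp p).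
  rewrite (bigD1_seq (step_mnm j)) ?msupp_uniq//= xs mulr1 big_seq_cond big1 ?addr0//.
  by move=> m /andP[/hp hm' ne]; rewrite x1// mulr0.
rewrite (memN_msupp_eq0 hm) big_seq big1// => m mp.
rewrite x1 ?mulr0//; first exact: hp.
by apply: contraNneq hm => <-.
Qed.

Definition sig_mnm (s : signature r) : multinom r := Multinom (val s).

Definition Delta_mpoly (s : signature r) : mpoly d C :=
  \prod_(j < r) Delta j ^+ (nth 0%N (val s) j - nth 0%N (val s) j.+1).

Lemma peval_Delta_mpoly s z : peval (Delta_mpoly s) z = Delta_sig Delta s z.
Proof. by rewrite /Delta_mpoly peval_prod; apply: eq_bigr => j _; rewrite pevalX. Qed.

(** The exponents s_j - s_(j+1) telescope. *)
Lemma sig_mnmE (s : signature r) : sig_mnm s =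
  (\big[mnm_add/mnm0]_(j < r) mnm_muln (step_mnm j)
     (nth 0%N (val s) j - nth 0%N (val s) j.+1))%N.
Proof.
apply/mnmP => i; rewrite mnm_sumE.
have sz := size_tuple (val s).
have ni k : (r <= k)%N -> nth 0%N (val s) k = 0%N by move=> h; rewrite nth_default ?sz.
have dec k : (nth 0%N (val s) k.+1 <= nth 0%N (val s) k)%N.
  have [kr|rk] := ltnP k.+1 r; last by rewrite ni.
  have := svalP s; move/(sortedP 0%N); apply; by rewrite sz.
rewrite (_ : sig_mnm s i = nth 0%N (val s) i); last by rewrite -tnth_nth.
have tel n : (i <= n)%N -> (\sum_(i <= j < n) (nth 0 (val s) j - nth 0 (val s) j.+1) =
    nth 0 (val s) i - nth 0 (val s) n)%N.
  elim: n => [|n IH]; first by rewrite leqn0 => /eqP->; rewrite big_geq// subnn.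
  rewrite leq_eqVlt => /predU1P[<-|]; first by rewrite big_geq// subnn.
  rewrite ltnS => h; rewrite big_nat_recr//= IH// addnBA// subnK//.
  elim: (n) h => [|m IHm]; first by rewrite leqn0 => /eqP->.
  rewrite leq_eqVlt => /predU1P[<-//|]; rewrite ltnS => /IHm; exact: leq_trans (dec m).
transitivity (\sum_(i <= j < r) (nth 0 (val s) j - nth 0 (val s) j.+1))%N.
  by rewrite tel ?(ltnW (ltn_ord i))// (ni r (leqnn r)) subn0.
rewrite (big_nat_widenl i 0)//= big_mkord big_mkcond; apply: eq_bigr => j _ /=.
by rewrite mulmnE mnmE ltnS; case: (_ <= _)%N; rewrite ?mul1n ?mul0n.
Qed.

(* The coefficient c may vanish, so that m bounds the leading monomial of p
   without being equal to it; in this form the property is multiplicative. *)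
Let bounded_lead (p : mpoly r C) m (c : C) := (mlead p <= m)%O /\ mcoeff m p = c.

Let bounded_leadM p q m n a b : bounded_lead p m a -> bounded_lead q n b ->
  bounded_lead (p * q) (mnm_add m n) (a * b).
Proof.
move=> [p1 p2] [q1 q2]; split; last by rewrite mleadcMW// p2 q2.
by apply: (le_trans (mleadM_le _ _)); apply: lem_add.
Qed.

Let bounded_leadX p m a k : bounded_lead p m a ->
  bounded_lead (p ^+ k) (mnm_muln m k) (a ^+ k).
Proof.
move=> h; elim: k => [|k IH].
  by rewrite !expr0 mulm0n; split; rewrite ?mlead1// mcoeff1 eqxx.
by rewrite !exprS mulmS; exact: bounded_leadM.
Qed.

Lemma lead_Delta_mpoly_frame s k : groupK O k ->
  (mlead (psubst (frame_mx *m k) (Delta_mpoly s)) <= sig_mnm s)%O.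
Proof.
move=> Kk; rewrite sig_mnmE /psubst /Delta_mpoly rmorph_prod /=.
suff [] : bounded_lead (\prod_(j < r) psubst (frame_mx *m k) (Delta j ^+ (nth 0 (val s) j - nth 0 (val s) j.+1)%N))
   (\big[mnm_add/mnm0]_(j < r) mnm_muln (step_mnm j)
     (nth 0%N (val s) j - nth 0%N (val s) j.+1))%N
   (\prod_(j < r) mcoeff (step_mnm j) (psubst (frame_mx *m k) (Delta j)) ^+ (nth 0 (val s) j - nth 0 (val s) j.+1)%N) by [].
elim/big_rec3: _ => [|j a m p _ IH]; first by split; rewrite ?mlead1// mcoeff1 eqxx.
apply: bounded_leadM => //; rewrite /psubst rmorphXn /=; apply: bounded_leadX.
by split => //; exact: mlead_Delta_frame.
Qed.

Lemma mcoeff_Delta_mpoly_frame s :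
  mcoeff (sig_mnm s) (psubst frame_mx (Delta_mpoly s)) = 1.
Proof.
rewrite sig_mnmE /psubst /Delta_mpoly rmorph_prod /=.
suff [] : bounded_lead (\prod_(j < r) psubst frame_mx (Delta j ^+ (nth 0 (val s) j - nth 0 (val s) j.+1)%N))
   (\big[mnm_add/mnm0]_(j < r) mnm_muln (step_mnm j)
     (nth 0%N (val s) j - nth 0%N (val s) j.+1))%N
   (\prod_(j < r) (1 : C)) by rewrite big1_eq.
elim/big_rec3: _ => [|j a m p _ IH]; first by split; rewrite ?mlead1// mcoeff1 eqxx.
apply: bounded_leadM => //; rewrite /psubst rmorphXn /=.
rewrite -[X in bounded_lead _ _ X](expr1n _ (nth 0 (val s) j - nth 0 (val s) j.+1)%N).
apply: bounded_leadX; split; last exact: mcoeff_Delta_frame.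
by rewrite -[frame_mx]mulmx1; apply: mlead_Delta_frame.
Qed.

Lemma sig_mnm_inj : injective sig_mnm.
Proof. by move=> s t h; apply: val_inj; case: h. Qed.

Definition Pspace_mpoly (s : signature r) : set (mpoly d C) :=
  combinations (groupK O) (fun k => psubst k (Delta_mpoly s)).

Lemma Pspace_mpolyP s f : Pspace O Delta s f <-> exists2 p, Pspace_mpoly s p & f = peval p.
Proof.
split=> [[n [c [k [Kk ->]]]]|[_ [n [c [k [Kk ->]]]] ->]].
  exists (\sum_l c l *: psubst (k l) (Delta_mpoly s)); first by exists n, c, k.
  apply/funext => z; rewrite peval_sum; apply: eq_bigr => l _.
  by rewrite pevalZ peval_psubst peval_Delta_mpoly.
exists n, c, k; split=> //; apply/funext => z; rewrite peval_sum; apply: eq_bigr => l _.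
by rewrite pevalZ peval_psubst peval_Delta_mpoly.
Qed.

Lemma Pspace_mpoly_lin s a p q : Pspace_mpoly s p -> Pspace_mpoly s q ->
  Pspace_mpoly s (a *: p + q).
Proof. exact: combinations_lin. Qed.

Lemma Pspace0 s : Pspace_mpoly s 0.
Proof. exact: combinations0. Qed.

Lemma Delta_mpoly_in s : Pspace_mpoly s (Delta_mpoly s).
Proof.
have -> : Delta_mpoly s = psubst 1%:M (Delta_mpoly s).
  by apply: peval_inj => z; rewrite peval_psubst mulmx1.
exact: (combinations1 (fun k => psubst k (Delta_mpoly s))).
Qed.

Definition sig_size (s : signature r) : nat := mdeg (sig_mnm s).

Lemma Delta_mpoly_homog s (t : C) z :
  peval (Delta_mpoly s) (t *: z) = t ^+ sig_size s * peval (Delta_mpoly s) z.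
Proof.
rewrite /sig_size sig_mnmE mdeg_sum /Delta_mpoly !peval_prod -prodrXr -big_split /=.
apply: eq_bigr => j _; rewrite !pevalX homDelta exprMn -exprM; congr (_ ^+ _ * _).
rewrite mdegMn; congr (_ * _)%N.
rewrite mdegE -[LHS](card_ord j.+1) -sum1_card (big_ord_widen r (fun=> 1%N))//.
by rewrite big_mkcond; apply: eq_bigr => i _; rewrite mnmE; case: (_ < _)%N.
Qed.

Lemma Pspace_homog s p (t : C) z : Pspace_mpoly s p ->
  peval p (t *: z) = t ^+ sig_size s * peval p z.
Proof.
move=> [n [c [k [Kk ->]]]]; rewrite !peval_sum mulr_sumr; apply: eq_bigr => l _.
by rewrite !pevalZ !peval_psubst -scalemxAl Delta_mpoly_homog mulrCA.
Qed.

Lemma Pspace_mlead s p : Pspace_mpoly s p ->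
  (mlead (psubst frame_mx p) <= sig_mnm s)%O.
Proof.
move=> [n [c [k [Kk ->]]]]; rewrite psubst_sum.
apply: (le_trans (mlead_sum_le _ _ _)); apply/joinsP_seq => l _ _.
rewrite psubstZ; apply: (le_trans (mleadZ_le _ _)).
by rewrite psubstA; exact: lead_Delta_mpoly_frame.
Qed.


Hypothesis absorbing : forall z : 'rV[C]_d,
  exists2 eps : R, 0 < eps & forall t, 0 <= t <= eps -> O (t%:C *: z).

Let Pspace_bounded s p : Pspace_mpoly s p ->
  forall m, m \in msupp p -> (mdeg m < (sig_size s).+1)%N.
Proof.
move=> Pp m; rewrite ltnS => hm.
by rewrite (homog_msupp (n := sig_size s) _ hm)// => t z; exact: Pspace_homog.
Qed.

(** The reproducing element that the definition of the kernel chooses does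
    exist, by Riesz representation of the evaluation at w. *)
Lemma Kker_spec s w : exists Q, [/\ Pspace_mpoly s Q,
  forall z, Kker O Delta s z w = peval Q z
  & forall p, Pspace_mpoly s p -> fischer (peval p) (peval Q) = peval p w].
Proof.
pose L (p : mpoly d C) := peval p w.
have [|h Ph hh] := fischer_riesz (L := L) (@Pspace_bounded s) (Pspace0 s) (@Pspace_mpoly_lin s).
  by move=> a p q; rewrite /L pevalD pevalZ.
have := @xgetPex _ (fun=> 0 : C) [set q | Pspace O Delta s q /\
    forall p, Pspace O Delta s p -> fischer p q = p w].
case.
  exists (peval h); split; first by apply/Pspace_mpolyP; exists h.
  by move=> _ /Pspace_mpolyP[p Pp ->]; rewrite -hh.
move=> /Pspace_mpolyP[Q PQ eQ] hQ; exists Q; split => //.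
  by move=> z; rewrite /Kker eQ.
by move=> p Pp; rewrite -eQ hQ//; apply/Pspace_mpolyP; exists p.
Qed.

Lemma Kker_homog s (t : C) z w :
  Kker O Delta s (t *: z) w = t ^+ sig_size s * Kker O Delta s z w.
Proof. by have [Q [PQ KQ _]] := Kker_spec s w; rewrite !KQ; exact: Pspace_homog. Qed.

Lemma Kker_at0 s z : sig_size s != 0%N -> Kker O Delta s z 0 = 0.
Proof.
move=> s0; have [Q [PQ KQ hQ]] := Kker_spec s 0.
have Q0 : Q = 0.
  apply: fischer_eq0; rewrite hQ// -[X in peval Q X](scale0r (0 : 'rV[C]_d)).
  by rewrite (Pspace_homog _ _ PQ) expr0n (negPf s0) mul0r.
by rewrite KQ Q0 /peval meval0.
Qed.

Lemma sig_size_eq0 s : (sig_size s == 0%N) = (s == sig0 r).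
Proof.
rewrite /sig_size mdeg_eq0; apply/eqP/eqP => [h|->].
  apply: sig_mnm_inj; rewrite h; apply/mnmP => i; rewrite mnm0E.
  by rewrite (mnm_tnth) /= tnth_nseq.
by apply/mnmP => i; rewrite mnm0E (mnm_tnth) /= tnth_nseq.
Qed.

Lemma fischer_ge0 (p : mpoly d C) : 0 <= fischer (peval p) (peval p).
Proof.
rewrite fischerE; apply: sumr_ge0 => m _.
by rewrite mulr_ge0 ?mul_conjC_ge0// ltW// fischer_weight_gt0.
Qed.

Lemma Kker_sig0 : exists2 kappa : C, 0 < kappa & forall z, Kker O Delta (sig0 r) z 0 = kappa.
Proof.
have [Q [PQ KQ hQ]] := Kker_spec (sig0 r) 0.
have e0 : sig_size (sig0 r) = 0%N by apply/eqP; rewrite sig_size_eq0.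
have Qc z : peval Q z = peval Q 0.
  have := Pspace_homog 0 z PQ; rewrite e0 expr0 mul1r => <-.
  by rewrite scale0r.
exists (peval Q 0); last by move=> z; rewrite KQ Qc.
rewrite -hQ// lt0r fischer_ge0 andbT; apply/eqP => /fischer_eq0 Q0.
have D1 : Delta_mpoly (sig0 r) = 1.
  rewrite /Delta_mpoly big1// => j _.
  by rewrite /= !nth_nseq !if_same expr0.
have := hQ _ (Delta_mpoly_in (sig0 r)).
rewrite D1 Q0 fischerE big_seq big1; last first.
  by move=> m _; rewrite mcoeff0 rmorph0 mulr0 mul0r.
by rewrite /peval meval1 => /eqP; rewrite eq_sym oner_eq0.
Qed.

Let vanish_on_O s p : Pspace_mpoly s p -> (forall z, O z -> peval p z = 0) -> p = 0.
Proof.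
move=> Pp h; apply: peval_eq0 => z; have [eps e0 he] := absorbing z.
have := h _ (he eps _); rewrite (ltW e0) lexx => /(_ isT).
rewrite (Pspace_homog _ _ Pp) => /eqP; rewrite mulf_eq0 => /orP[|/eqP//].
rewrite expf_eq0 => /andP[_] /eqP eps0; move: e0.
by have -> : eps = 0; [exact: complexI|rewrite ltxx].
Qed.

Lemma fischer_conj (p q : mpoly d C) :
  fischer (peval p) (peval q) = Num.conj (fischer (peval q) (peval p)).
Proof.
have aux (p' q' : mpoly d C) : fischer (peval p') (peval q') =
    \sum_(m <- [seq m <- msupp p' | m \in msupp q'])
       mcoeff m p' * Num.conj (mcoeff m q') * fischer_weight R m.
  rewrite fischerE big_filter [RHS]big_mkcond; apply: eq_bigr => m _.
  case: ifP => // /negbT h.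
  by rewrite (memN_msupp_eq0 h) rmorph0 mulr0 mul0r.
rewrite [LHS]aux [X in Num.conj X]aux rmorph_sum /=.
rewrite (perm_big [seq m <- msupp q | m \in msupp p]); last first.
  apply: uniq_perm; rewrite ?filter_uniq ?msupp_uniq// => m.
  by rewrite !mem_filter andbC.
apply: eq_bigr => m _.
rewrite [RHS]rmorphM [X in _ = _ * X](geC0_conj (ltW (fischer_weight_gt0 R m))).
by congr (_ * _); rewrite rmorphM /= conjCK mulrC.
Qed.

(** The kernels K_s are linearly independent: the coefficient of x ^ s in
    p (\sum_i x_i e_i) does not vanish on P_s, but vanishes on P_s' for every
    s' that is smaller in the monomial order. *)
Lemma Kker_free (S : seq (signature r)) (c : signature r -> C) : uniq S ->
  (forall z w, O w -> \sum_(s <- S) c s * Kker O Delta s z w = 0) ->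
  forall s, s \in S -> c s = 0.
Proof.
move=> uS h s0 s0S; apply/eqP/negPn/negP => cs0.
pose S' := [seq s <- S | c s != 0].
have [s sS' smax] : exists2 s, s \in S' &
    forall s', s' \in S' -> (sig_mnm s' <= sig_mnm s)%O.
  have : s0 \in S' by rewrite mem_filter cs0.
  elim: S' s0 {s0S cs0} => // s1 S' IH s0 _.
  case: S' IH => [|s2 S'] IH; first by exists s1; rewrite ?inE// => s'; rewrite inE => /eqP->.
  have [s ss hs] := IH s2 (mem_head _ _).
  have [le|/ltW le] := leP (sig_mnm s1) (sig_mnm s).
    exists s; first by rewrite inE ss orbT.
    by move=> s'; rewrite inE => /predU1P[->//|]; exact: hs.
  exists s1; first by rewrite mem_head.
  move=> s'; rewrite inE => /predU1P[->//|/hs hs']; exact: le_trans le.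
move: (sS'); rewrite mem_filter => /andP[cs sS].
pose L p := mcoeff (sig_mnm s) (psubst frame_mx p).
have Llin a p q : L (a *: p + q) = a * L p + L q.
  by rewrite /L psubstD psubstZ mcoeffD mcoeffZ.
have [g Pg hg] := fischer_riesz (L := L) (@Pspace_bounded s) (Pspace0 s) (@Pspace_mpoly_lin s) Llin.
suff g0 : g = 0.
  have := hg _ (Delta_mpoly_in s); rewrite /L mcoeff_Delta_mpoly_frame g0 fischerE big1.
    by move/eqP; rewrite oner_eq0.
  by move=> m _; rewrite mcoeff0 rmorph0 mulr0 mul0r.
apply: (vanish_on_O Pg) => w Ow.
pose Q s := xget 0 [set Q | [/\ Pspace_mpoly s Q,
  forall z, Kker O Delta s z w = peval Q z
  & forall p, Pspace_mpoly s p -> fischer (peval p) (peval Q) = peval p w]].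
have hQ s' : [/\ Pspace_mpoly s' (Q s'),
  forall z, Kker O Delta s' z w = peval (Q s') z
  & forall p, Pspace_mpoly s' p -> fischer (peval p) (peval (Q s')) = peval p w].
  exact: xgetPex (Kker_spec s' w).
have [PQ _ rQ] := hQ s.
have sum0 : \sum_(s' <- S) c s' *: Q s' = 0.
  apply: peval_eq0 => z; rewrite -[RHS](h z w Ow) peval_sum; apply: eq_bigr => s' _.
  by rewrite pevalZ; have [_ -> _] := hQ s'.
have LQ : c s * L (Q s) = 0.
  have L0 : L 0 = 0 by rewrite /L /psubst comp_mpoly0 mcoeff0.
  have Lsum (S1 : seq (signature r)) :
      L (\sum_(s' <- S1) c s' *: Q s') = \sum_(s' <- S1) c s' * L (Q s').
    by elim: S1 => [|s1 S1 IH]; rewrite ?big_nil// !big_cons Llin IH.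
  rewrite -[RHS]L0 -sum0 Lsum (bigD1_seq s)//= big_seq_cond.
  rewrite [X in _ = _ + X]big1 ?addr0// => s' /andP[s'S s's].
  have [->|cs'] := eqVneq (c s') 0; first by rewrite mul0r.
  rewrite /L mcoeff_gt_mlead ?mulr0//.
  have [PQ' _ _] := hQ s'; apply: le_lt_trans (Pspace_mlead PQ') _.
  rewrite lt_neqAle smax ?mem_filter ?cs'// andbT.
  by apply: contra s's => /eqP/sig_mnm_inj->.
move/eqP: LQ; rewrite mulf_eq0 (negPf cs) hg//= => /eqP Lg.
by rewrite -rQ// fischer_conj Lg rmorph0.
Qed.


#[local] Existing Instance summability.totally_filter.

Lemma unordered_sum1 (T : choiceType) (f : T -> C^o) (i : T) :
  (forall j, j != i -> f j = 0) -> summability.sum f = f i.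
Proof.
move=> h; apply: cvg_lim; first exact: norm_hausdorff.
apply: cvg_near_cst; exists [fset i]%fset => // J /= iJ.
rewrite partial_sumE (big_fsetD1 i) /=; last first.
  by apply: (fsubsetP iJ); rewrite inE.
by rewrite big1_fset ?addr0// => j; rewrite !inE => /andP[ji _] _; exact: h.
Qed.

Lemma kernel_sum_at0 (a : signature r -> R) z : a (sig0 r) = 1 ->
  kernel_sum O Delta a z 0 = Kker O Delta (sig0 r) z 0.
Proof.
move=> a0; rewrite /kernel_sum (unordered_sum1 (i := sig0 r)).
  by rewrite /kernel_terms a0 mul1r.
by move=> s s0; rewrite /kernel_terms Kker_at0 ?mulr0// sig_size_eq0.
Qed.

Definition sig_level (n : nat) : {fset signature r} :=
  fset_set [set s | sig_size s = n].

Lemma in_sig_level n s : (s \in sig_level n) = (sig_size s == n).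
Proof.
rewrite in_fset_set; last first.
  apply: (@sub_finite_set _ _ (sig_mnm @^-1` [set bmnm m | m in [set: bmultinom r n.+1]])).
    move=> t /= tn; have hb : (mdeg (sig_mnm t) < n.+1)%N by rewrite ltnS -tn.
    by exists (BMultinom hb).
  apply: finite_preimage; first by move=> s1 s2 _ _; exact: sig_mnm_inj.
  exact: finite_image.
by apply/idP/eqP; rewrite inE.
Qed.

(** The kernel determines the coefficients: scaling z separates the degrees,
    and in each degree the kernels K_s are linearly independent. *)
Lemma kernel_sum_inj (a b : signature r -> R) :
  defines_kernel O Delta a -> defines_kernel O Delta b ->
  (forall z w, O z -> O w -> kernel_sum O Delta a z w = kernel_sum O Delta b z w) ->
  forall s, a s = b s.
Proof.
move=> da db eqab s.
suff : (a s - b s)%:C = 0 by move/complexI/eqP; rewrite subr_eq0 => /eqP.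
have : s \in sig_level (sig_size s) by rewrite in_sig_level.
move: s; suff free n : forall z w, O w ->
    \sum_(s <- sig_level n) (a s - b s)%:C * Kker O Delta s z w = 0.
  by move=> s hs; exact: (Kker_free (fset_uniq _) (free (sig_size s)) hs).
move=> z w Ow; have [eps eps0 heps] := absorbing z.
pose f s : C^o := (a s - b s)%:C * Kker O Delta s (eps%:C *: z) w.
have sum0 : \sum_(s <- sig_level n) f s = 0.
  apply: (degree_separation in_sig_level) => t /andP[t0 t1].
  have Oz : O ((t * eps)%:C *: z).
    by by apply: heps; rewrite mulr_ge0 ?(ltW t0) ?(ltW eps0)//= ler_piMl// ltW.
  have ca := da _ _ Oz Ow; have cb := db _ _ Oz Ow.
  pose fa := kernel_terms O Delta a ((t * eps)%:C *: z) w.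
  pose fb := kernel_terms O Delta b ((t * eps)%:C *: z) w.
  have -> : summability.partial_sum (fun s => t%:C ^+ sig_size s * f s : C^o) =
      (fun J => summability.partial_sum fa J - summability.partial_sum fb J).
    apply/funext => J; rewrite !partial_sumE -sumrB; apply: eq_bigr => s _.
    rewrite /f /fa /fb /kernel_terms -mulrBl -rmorphB [(t * eps)%:C]rmorphM -scalerA.
    by rewrite [Kker O Delta s (t%:C *: _) w]Kker_homog mulrCA.
  have <- : summability.sum fa - summability.sum fb = 0.
    by apply/eqP; rewrite subr_eq0; apply/eqP; exact: eqab.
  exact: cvgB ca cb.
have e0 : eps%:C ^+ n != 0 :> C.
  by rewrite expf_neq0//; apply/eqP => /complexI h; rewrite h ltxx in eps0.
apply: (mulfI e0); rewrite mulr0 -[RHS]sum0 mulr_sumr.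
rewrite big_seq [RHS]big_seq; apply: eq_bigr => s; rewrite in_sig_level => /eqP sn.
by rewrite /f Kker_homog sn mulrCA.
Qed.

End LeadingMonomials.

(** * Two multiplication models of one tuple *)

Section HilbertBasics.
Variable R : realType.
Local Notation C := R[i].
Implicit Types H : hilbert R.

Lemma hdotC H (x y : H) : hdot H x y = Num.conj (hdot H y x).
Proof. by rewrite hermC expr0 mul1r. Qed.

Lemma hdotDl H (x y z : H) : hdot H (x + y) z = hdot H x z + hdot H y z.
Proof. exact: linearDl. Qed.
Lemma hdotDr H (x y z : H) : hdot H x (y + z) = hdot H x y + hdot H x z.
Proof. exact: linearDr. Qed.
Lemma hdotNl H (x y : H) : hdot H (- x) y = - hdot H x y.
Proof. exact: linearNl. Qed.
Lemma hdotNr H (x y : H) : hdot H x (- y) = - hdot H x y.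
Proof. exact: linearNr. Qed.
Lemma hdotZl H c (x y : H) : hdot H (c *: x) y = c * hdot H x y.
Proof. exact: linearZl_LR. Qed.
Lemma hdotZr H c (x y : H) : hdot H x (c *: y) = Num.conj c * hdot H x y.
Proof. exact: linearZr_LR. Qed.
Lemma hdot0l H (x : H) : hdot H 0 x = 0.
Proof. exact: linear0l. Qed.
Lemma hdot0r H (x : H) : hdot H x 0 = 0.
Proof. exact: linear0r. Qed.

Lemma hdot_eq0 H (x : H) : hdot H x x = 0 -> x = 0.
Proof. by move=> h; apply/eqP; rewrite -(dnorm_eq0 (hdot H)) h. Qed.

Lemma hdot_ext H (x y : H) : (forall z, hdot H z x = hdot H z y) -> x = y.
Proof.
move=> h; apply/eqP; rewrite -subr_eq0; apply/eqP/hdot_eq0.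
by rewrite hdotDr hdotNr h subrr.
Qed.

Lemma unitary_inj H1 H2 (U : {linear H1 -> H2}) : unitary_op U -> injective U.
Proof.
move=> [iU _] x y xy; apply: hdot_ext => z.
by rewrite -!iU xy.
Qed.

Lemma unitary_inv H1 H2 (U : {linear H1 -> H2}) : unitary_op U ->
  exists V : {linear H2 -> H1}, unitary_op V /\ forall x, V (U x) = x.
Proof.
move=> uU; have [iU sU] := uU; have injU := unitary_inj uU.
have [v hv] := choice sU.
have [V hV] : exists V : {linear H2 -> H1}, V =1 v.
  by apply: linear_of => c x y; apply: injU; rewrite linearP !hv.
exists V; split; last by move=> x; rewrite hV; apply: injU; rewrite hv.
split=> [x y|x]; first by rewrite -iU !hV !hv.
by exists (U x); rewrite hV; apply: injU; rewrite hv.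
Qed.

Section Equivalence.
Variable d : nat.

Lemma unitarily_equivalent_sym H1 H2 (T : 'I_d -> {linear H1 -> H1})
    (S : 'I_d -> {linear H2 -> H2}) :
  unitarily_equivalent T S -> unitarily_equivalent S T.
Proof.
move=> [U [uU iU]]; have [V [uV VU]] := unitary_inv uU.
exists V; split=> // j h; have [_ /(_ h)[x <-]] := uU.
by rewrite -iU !VU.
Qed.

Lemma unitarily_equivalent_trans H1 H2 H3 (T : 'I_d -> {linear H1 -> H1})
    (S : 'I_d -> {linear H2 -> H2}) (Q : 'I_d -> {linear H3 -> H3}) :
  unitarily_equivalent T S -> unitarily_equivalent S Q -> unitarily_equivalent T Q.
Proof.
move=> [U [[i1 s1] U12]] [V [[i2 s2] V23]].
have [W hW] : exists W : {linear H1 -> H3}, W =1 V \o U.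
  by apply: linear_of => c x y /=; rewrite !linearP.
exists W; split; last by move=> j h; rewrite !hW /= U12 V23.
split=> [x y|z]; first by rewrite !hW /= i2 i1.
by have [y <-] := s2 z; have [x <-] := s1 y; exists x; rewrite hW.
Qed.
End Equivalence.

Lemma dense_orthogonal H (D : set H) (v : H) : closure D = setT ->
  (forall h, D h -> hdot H h v = 0) -> v = 0.
Proof.
move=> cD h; apply: contrapT => v0.
have nv : 0 < `|v| by rewrite normr_gt0; apply/eqP.
have : closure D v by rewrite cD.
move=> /(_ (ball v `|v|) (nbhsx_ballx _ _ nv))[x [Dx]].
rewrite -ball_normE /= => hx.
have hle : hdot H v v <= hdot H (v - x) (v - x).
  rewrite hdotDl !hdotDr !hdotNl !hdotNr (h x Dx).
  rewrite [hdot H v x]hdotC (h x Dx) rmorph0 oppr0 !addr0 add0r opprK lerDl.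
  exact: dnorm_ge0.
have hlt : hdot H (v - x) (v - x) < hdot H v v.
  by rewrite !hdot_norm !expr2; apply: ltr_pM.
by have := lt_le_trans hlt hle; rewrite ltxx.
Qed.

End HilbertBasics.

Section MultiplicationTuples.
Variables (R : realType) (d : nat) (O : set 'rV[R[i]]_d).
Local Notation C := R[i].
Variable K : 'rV[C]_d -> 'rV[C]_d -> C.
Variables (H : rkhs O K) (M : 'I_d -> {linear H -> H}).
Hypothesis hM : multiplication_tuple M.

Lemma fun_of_sum z (I : Type) (s : seq I) (c : I -> C) (F : I -> H) : O z ->
  fun_of (\sum_(i <- s) c i *: F i) z = \sum_(i <- s) c i * fun_of (F i) z.
Proof.
move=> Oz; elim: s => [|i s IH]; last by rewrite !big_cons fun_of_linear// IH.
rewrite !big_nil; have := @fun_of_linear _ _ _ _ H (-1) 0 0 z Oz.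
by rewrite scaler0 addr0 mulN1r addNr.
Qed.

Variables (H1 : hilbert R) (T : 'I_d -> {linear H1 -> H1}) (U : {linear H1 -> H}).
Hypothesis UT : forall j h, U (T j h) = M j (U h).

(** A unitary equivalence with multiplication operators turns p(T) into
    multiplication by p. *)
Lemma fun_of_tuple_poly p h z : O z ->
  fun_of (U (tuple_poly T p h)) z = peval p z * fun_of (U h) z.
Proof.
move=> Oz; rewrite /tuple_poly linear_sum /=.
under eq_bigr do rewrite linearZ /=.
rewrite fun_of_sum// pevalE mulr_suml; apply: eq_bigr => m _.
rewrite -mulrA; congr (_ * _).
have it j n x : fun_of (U (iter n (T j) x)) z = z 0 j ^+ n * fun_of (U x) z.
  elim: n => [|n IH]; first by rewrite mul1r.
  by rewrite iterS UT (proj2 (hM j))// IH mulrA exprS.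
rewrite -big_enum /=; elim: (enum _) => [|j s IH] /=; first by rewrite big_nil mul1r.
by rewrite it IH big_cons mulrA.
Qed.

End MultiplicationTuples.

Section EquivalentKernels.
Variables (R : realType) (d : nat) (O : set 'rV[R[i]]_d).
Local Notation C := R[i].
Variables Ka Kb : 'rV[C]_d -> 'rV[C]_d -> C.
Variables (Ha : rkhs O Ka) (Hb : rkhs O Kb).
Variables (Ma : 'I_d -> {linear Ha -> Ha}) (Mb : 'I_d -> {linear Hb -> Hb}).
Hypotheses (hMa : multiplication_tuple Ma) (hMb : multiplication_tuple Mb).

(* The kernel function at 0 spans the vacuum: it is orthogonal to the range of
   every M_j, because z_j vanishes at 0. *)
Let vacuum (K : 'rV[C]_d -> 'rV[C]_d -> C) (H : rkhs O K) (M : 'I_d -> {linear H -> H})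
    (H1 : hilbert R) (T Tst : 'I_d -> {linear H1 -> H1}) (U : {linear H1 -> H}) (kappa : C) :
  multiplication_tuple M -> O 0 -> K 0 0 = kappa ->
  unitary_op U -> (forall j h, U (T j h) = M j (U h)) ->
  (forall j, is_adjoint (T j) (Tst j)) ->
  exists E, [/\ joint_ker Tst 0 E, hdot H1 E E = kappa &
    forall z, O z -> fun_of (U E) z = K z 0].
Proof.
move=> hM O0 K0 [iU sU] UT adj.
have [k0 [k0E k0r]] := fun_of_reproducing H O0; have [E UE] := sU k0.
exists E; split; last by rewrite UE.
  move=> j; rewrite mxE scale0r subr0; apply: hdot_eq0.
  by rewrite -adj -iU UE UT -k0r (proj2 (hM j))// mxE mul0r.
by rewrite -iU UE -k0r k0E.
Qed.

(** Both models realize the same tuple T. The kernel functions at 0 are constant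
    and both span the joint kernel of the adjoint of T, so the two models agree,
    up to a unimodular factor, on the polynomials, which are dense. *)
Lemma equivalent_kernel_eq (H1 : hilbert R) (T : 'I_d -> {linear H1 -> H1}) (kappa : C) :
  class_AK O T -> unitarily_equivalent T Ma -> unitarily_equivalent T Mb ->
  O 0 -> kappa != 0 ->
  (forall z, Ka z 0 = kappa) -> (forall z, Kb z 0 = kappa) ->
  forall z w, O z -> O w -> Ka z w = Kb z w.
Proof.
move=> [_ _ _ [Tst [adj [e e0 kerE] cyc _]]] [U [uU UT]] [V [uV VT]] O0 k0 hKa hKb z w Oz Ow.
have [E1 [E1k E1n E1f]] := vacuum hMa O0 (hKa 0) uU UT adj.
have [E2 [E2k E2n E2f]] := vacuum hMb O0 (hKb 0) uV VT adj.
have E10 : E1 != 0.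
  by apply: contra_neq k0 => h; rewrite -E1n h hdot0l.
have [c [c1 Ec]] : exists c : C, c * Num.conj c = 1 /\ E2 = c *: E1.
  have [c1 h1] : exists c, E1 = c *: e by move: E1k; rewrite kerE.
  have [c2 h2] : exists c, E2 = c *: e by move: E2k; rewrite kerE.
  have c10 : c1 != 0 by apply: contra_neq E10 => h; rewrite h1 h scale0r.
  have Ec : E2 = (c2 / c1) *: E1 by rewrite h1 scalerA divfK.
  exists (c2 / c1); split=> //.
  by apply: (mulIf k0); rewrite mul1r -[RHS]E2n Ec hdotZl hdotZr E1n mulrA.
have eval x : O x -> exists A B, [/\ forall h, fun_of (U h) x = hdot H1 h A,
    forall h, fun_of (V h) x = hdot H1 h B, (forall y, O y -> fun_of (U A) y = Ka y x)
    & (forall y, O y -> fun_of (V B) y = Kb y x)].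
  move=> Ox; have [ka [kaE kar]] := fun_of_reproducing Ha Ox.
  have [kb [kbE kbr]] := fun_of_reproducing Hb Ox.
  have [iU sU] := uU; have [iV sV] := uV.
  have [A UA] := sU ka; have [B VB] := sV kb; exists A, B.
  by split=> *; rewrite ?kar ?kbr -?UA -?VB ?iU ?iV// ?UA ?VB ?kaE ?kbE.
have AB x A B : O x -> (forall h, fun_of (U h) x = hdot H1 h A) ->
    (forall h, fun_of (V h) x = hdot H1 h B) -> A = Num.conj c *: B.
  move=> Ox hA hB; apply/eqP; rewrite -subr_eq0; apply/eqP.
  apply: (dense_orthogonal (cyc E1 E10 E1k)) => _ [p ->].
  rewrite hdotDr hdotNr hdotZr conjCK -hA -hB (fun_of_tuple_poly hMa UT)//.
  rewrite (fun_of_tuple_poly hMb VT)// E1f// hKa.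
  have : fun_of (V E2) x = c * fun_of (V E1) x.
    by rewrite Ec !hB hdotZl.
  rewrite E2f// hKb => ->; rewrite mulrCA subrr//.
have [Az [Bz [hAz hBz _ _]]] := eval z Oz.
have [Aw [Bw [hAw hBw hA hB]]] := eval w Ow.
rewrite -hA// -hB// hAz hBz (AB z Az Bz)// (AB w Aw Bw)//.
by rewrite hdotZl hdotZr conjCK mulrA [_ * c]mulrC c1 mul1r.
Qed.

End EquivalentKernels.

(** * Density and isometries in Hilbert spaces *)

Section Completeness.
Variable R : realType.
Local Notation C := R[i].
Implicit Types H : hilbert R.

Lemma natC n : (n%:R : R)%:C = n%:R :> C.
Proof. by rewrite rmorph_nat. Qed.

Definition rnorm H (x : H) : R := complex.Re `|x|.

Lemma normE H (x : H) : `|x| = (rnorm x)%:C.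
Proof. by rewrite /rnorm RRe_real// ger0_real. Qed.

Lemma rnorm_ge0 H (x : H) : 0 <= rnorm x.
Proof. by rewrite -ler0c -normE normr_ge0. Qed.

Lemma hdot_rnorm H (x : H) : hdot H x x = (rnorm x ^+ 2)%:C.
Proof. by rewrite hdot_norm normE rmorphXn. Qed.

Lemma rnormD H (x y : H) : rnorm (x + y) <= rnorm x + rnorm y.
Proof. by rewrite -lecR rmorphD /= -!normE ler_normD. Qed.

Lemma rnormN H (x : H) : rnorm (- x) = rnorm x.
Proof. by rewrite /rnorm normrN. Qed.

Lemma rnormB H (x y : H) : rnorm (x - y) = rnorm (y - x).
Proof. by rewrite -rnormN opprB. Qed.

Lemma rnorm_parallelogram H (x y : H) :
  rnorm (x + y) ^+ 2 + rnorm (x - y) ^+ 2 = 2 * (rnorm x ^+ 2 + rnorm y ^+ 2).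
Proof.
apply: complexI; rewrite rmorphM /= natC !rmorphD /= -!hdot_rnorm.
by rewrite !(hdotDl, hdotDr, hdotNl, hdotNr); ring.
Qed.

Lemma rnormZ H (t : C) (x : H) : rnorm (t *: x) = complex.Re `|t| * rnorm x.
Proof.
apply: complexI; rewrite -normE normrZ normE rmorphM /=; congr (_ * _).
Qed.

Lemma hilbert_complete H (u : nat -> H) :
  (forall eps : R, 0 < eps -> exists n0, forall n m, (n0 <= n)%N -> (n0 <= m)%N ->
     rnorm (u n - u m) <= eps) ->
  exists l, forall eps : R, 0 < eps -> exists n0, forall n, (n0 <= n)%N ->
     rnorm (l - u n) <= eps.
Proof.
move=> hu.
have epsC (e : C) : 0 < e -> exists2 r : R, 0 < r & e = r%:C.
  move=> e0; have e1 : e = (complex.Re e)%:C by rewrite RRe_real// gtr0_real.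
  by exists (complex.Re e) => //; rewrite -ltcR -e1.
have cu : cvg (u @ \oo).
  apply: cauchy_cvg; apply/cauchy_ballP => e /epsC[r r0 ->].
  have [n0 hn] := hu (r / 2) (divr_gt0 r0 (ltr0Sn _ 1)).
  exists (u @` [set n | (n0 <= n)%N], u @` [set n | (n0 <= n)%N]).
    by split; exists n0 => // n n0n; exists n.
  move=> [_ _] [/= [n hn1 <-] [m hm <-]]; rewrite -ball_normE /= normE ltcR.
  by apply: le_lt_trans (hn _ _ hn1 hm) _; rewrite ltr_pdivrMr// ltr_pMr// ltr1n.
exists (lim (u @ \oo)) => eps e0.
have /cvgrPdist_le /(_ eps%:C) := cu.
rewrite ltcR => /(_ e0)[n0 _ h]; exists n0 => n hn.
by rewrite -lecR -normE; exact: h.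
Qed.

(** First variation of the distance in the direction s, with the step
    tau * <h, s> and tau small against |s|^2. *)
Lemma hdot_min_orthogonal H (h s : H) :
  (forall t : C, rnorm h <= rnorm (h - t *: s)) -> hdot H h s = 0.
Proof.
move=> hmin; apply/eqP/negPn/negP => c0; set c := hdot H h s in c0.
have [q qE] : exists q, q = rnorm s ^+ 2 by eexists.
have q0 : 0 <= q by rewrite qE sqr_ge0.
pose tau : R := (q + 1)^-1; have q1 : 0 < q + 1 by rewrite ltr_wpDl.
have := hmin (tau%:C * c).
rewrite -ler_sqr ?nnegrE ?rnorm_ge0// -lecR -!hdot_rnorm.
have cc : 0 < c * Num.conj c by rewrite mul_conjC_gt0.
have -> : hdot H (h - (tau%:C * c) *: s) (h - (tau%:C * c) *: s) =
   hdot H h h - tau%:C * (c * Num.conj c) * (2 - (tau * q)%:C).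
  rewrite !(hdotDl, hdotDr, hdotNl, hdotNr, hdotZl, hdotZr) -/c [hdot H s h]hdotC -/c.
  have ct : Num.conj tau%:C = tau%:C by rewrite geC0_conj// ler0c invr_ge0 ltW.
  rewrite !rmorphM /= (hdot_rnorm s) -qE ct; ring.
rewrite lerBrDr gerDl; apply/negP; rewrite lt_geF//.
rewrite mulr_gt0//; first by rewrite mulr_gt0// ltcR invr_gt0.
have tq : tau * q < 1 by rewrite /tau mulrC ltr_pdivrMr// mul1r ltrDl.
rewrite subr_gt0 -natC ltcR.
by apply: lt_trans tq _; rewrite ltr1n.
Qed.

(** Projection theorem: by the parallelogram identity a minimizing sequence
    for the distance to S converges, and the difference to its limit is
    orthogonal to S. *)
Lemma dense_of_orthogonal H (S : set H) : S 0 ->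
  (forall a x y, S x -> S y -> S (a *: x + y)) ->
  (forall h, (forall s, S s -> hdot H h s = 0) -> h = 0) ->
  forall f (eps : R), 0 < eps -> exists2 s, S s & rnorm (f - s) <= eps.
Proof.
move=> S0 Slin Sorth f.
pose A := [set rnorm (f - s) | s in S]; pose delta := inf A.
have hA : has_inf A.
  by split; [exists (rnorm (f - 0)); exists 0|exists 0 => _ [s _ <-]; exact: rnorm_ge0].
have dle s : S s -> delta <= rnorm (f - s).
  by move=> Ss; apply: (ge_inf (proj2 hA)); exists s.
have d0 : 0 <= delta by apply: lb_le_inf (proj1 hA) _ => _ [s _ <-]; exact: rnorm_ge0.
have adh n : exists s, S s /\ rnorm (f - s) <= delta + n.+1%:R^-1.
  have n0 : (0 : R) < n.+1%:R^-1 by rewrite invr_gt0.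
  by have [_ [s Ss <-] /ltW hs] := inf_adherent n0 hA; exists s.
have [u hu] := choice adh.
have cauchy : forall eps : R, 0 < eps -> exists n0, forall n m, (n0 <= n)%N -> (n0 <= m)%N ->
     rnorm (u n - u m) <= eps.
  move=> eps e0.
  (* The distances exceed delta by i1, i2 <= 1, and the midpoint is at distance
     at least delta: |u n - u m|^2 <= 2 (2 delta + 1) (i1 + i2). *)
  pose k := 4 * (2 * delta + 1); have k0 : 0 < k by rewrite mulr_gt0// ltr_wpDl// mulr_ge0.
  have [n0 hn0] := @invn_small R (eps ^+ 2 / k) (divr_gt0 (exprn_gt0 2 e0) k0).
  exists n0 => n m hn hm; rewrite -ler_sqr ?nnegrE ?rnorm_ge0 ?(ltW e0)//.
  have P := rnorm_parallelogram (f - u n) (f - u m).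
  have [Sn dn] := hu n; have [Sm dm] := hu m.
  have mid : 2 * delta <= rnorm ((f - u n) + (f - u m)).
    have -> : (f - u n) + (f - u m) = (2 : C) *: (f - ((2^-1 : C) *: u n + (2^-1 : C) *: u m)).
      rewrite scalerBr scalerDr !scalerA divff ?pnatr_eq0// !scale1r -[2]/(1 + 1) scalerDl !scale1r.
      by rewrite addrACA opprD.
    have S1 : S ((2^-1 : C) *: u n + (2^-1 : C) *: u m).
      by apply: (Slin) => //; rewrite -[_ *: u m]addr0; exact: Slin.
    have n2 : complex.Re `|2 : C| = 2 by rewrite normr_nat -natC.
    by rewrite rnormZ n2 ler_pM2l//; exact: dle.
  rewrite (_ : (f - u n) - (f - u m) = u m - u n) in P; last first.
    by rewrite opprB addrC addrA subrK.
  rewrite rnormB.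
  have e1 := hn0 _ hn; have e2 := hn0 _ hm.
  set i1 : R := n.+1%:R^-1 in dn e1; set i2 : R := m.+1%:R^-1 in dm e2.
  have i10 : 0 <= i1 by rewrite invr_ge0.
  have i20 : 0 <= i2 by rewrite invr_ge0.
  have i11 : i1 <= 1 by rewrite invf_le1// ler1n.
  have i21 : i2 <= 1 by rewrite invf_le1// ler1n.
  have sq1 : rnorm (f - u n) ^+ 2 <= (delta + i1) ^+ 2 by rewrite ler_sqr ?nnegrE ?rnorm_ge0// addr_ge0.
  have sq2 : rnorm (f - u m) ^+ 2 <= (delta + i2) ^+ 2 by rewrite ler_sqr ?nnegrE ?rnorm_ge0// addr_ge0.
  have sq3 : (2 * delta) ^+ 2 <= rnorm ((f - u n) + (f - u m)) ^+ 2.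
    by rewrite ler_sqr ?nnegrE ?rnorm_ge0// mulr_ge0.
  have ek : eps ^+ 2 = eps ^+ 2 / k * k by rewrite divfK// gt_eqF.
  have b1 : 2 * i1 * (2 * delta + 1) <= eps ^+ 2 / 2.
    have : i1 * k <= eps ^+ 2 by rewrite ek ler_pM2r.
    by rewrite /k; lra.
  have b2 : 2 * i2 * (2 * delta + 1) <= eps ^+ 2 / 2.
    have : i2 * k <= eps ^+ 2 by rewrite ek ler_pM2r.
    by rewrite /k; lra.
  have q1 : i1 ^+ 2 <= i1 by rewrite expr2 ler_piMl.
  have q2 : i2 ^+ 2 <= i2 by rewrite expr2 ler_piMl.
  by clear -P sq1 sq2 sq3 b1 b2 q1 q2; lra.
have [g hg] := hilbert_complete cauchy.
have near_g (eps : R) : 0 < eps -> exists n, rnorm (g - u n) <= eps /\ n.+1%:R^-1 <= eps.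
  move=> e0; have [n1 h1] := hg eps e0; have [n2 h2] := invn_small e0.
  by exists (maxn n1 n2); rewrite h1 ?leq_maxl// h2 ?leq_maxr.
have fg : f - g = 0.
  apply: Sorth => s Ss; apply: hdot_min_orthogonal => t.
  have hi : rnorm (f - g) <= delta.
    apply/ler_addgt0Pr => eps e0; have [n [gn ne]] := near_g (eps / 2) (divr_gt0 e0 (ltr0Sn _ 1)).
    have := rnormD (f - u n) (u n - g); rewrite addrA subrK [rnorm (u n - g)]rnormB.
    move=> tri; have [_ dn] := hu n; apply: (le_trans tri).
    by rewrite [eps]splitr addrA lerD// (le_trans dn)// lerD2l.
  apply: le_trans hi _.
  apply/ler_addgt0Pr => eps e0; have [n [gn ne]] := near_g eps e0.
  have [Sn _] := hu n.
  have low := dle _ (Slin t _ _ Ss Sn).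
  have := rnormD (f - g - t *: s) (g - u n).
  have -> : f - g - t *: s + (g - u n) = f - (t *: s + u n).
    by rewrite opprD [RHS]addrA [LHS]addrA; congr (_ + _); rewrite addrAC subrK.
  by move=> tri; apply: (le_trans low); apply: (le_trans tri); rewrite lerD2l.
move=> eps e0; have [n [gn _]] := near_g eps e0; have [Sn _] := hu n.
by exists (u n) => //; move/eqP: fg; rewrite subr_eq0 => /eqP->.
Qed.

Lemma hdot_cauchy_schwarz H (x y : H) : `|hdot H x y| <= (rnorm x * rnorm y)%:C.
Proof.
have [->|y0] := eqVneq y 0.
  by rewrite hdot0r normr0 ler0c mulr_ge0 ?rnorm_ge0.
have yy : 0 < hdot H y y by rewrite (dnorm_gt0 (hdot H)).
set c := hdot H x y.
have := dnorm_ge0 (hdot H) (x - (c / hdot H y y) *: y).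
rewrite !(hdotDl, hdotDr, hdotNl, hdotNr, hdotZl, hdotZr) [hdot H y x]hdotC -/c.
have cy : Num.conj (hdot H y y)^-1 = (hdot H y y)^-1.
  by rewrite geC0_conj// invr_ge0 ltW.
rewrite rmorphM /= cy => h.
have {}h : 0 <= hdot H x x - c * Num.conj c / hdot H y y.
  move: h; congr (0 <= _); field; by rewrite gt_eqF.
rewrite -(@ler_pXn2r _ 2)// ?nnegrE ?ler0c ?mulr_ge0 ?rnorm_ge0//.
have -> : (rnorm x * rnorm y)%:C ^+ 2 = hdot H x x * hdot H y y.
  by rewrite -rmorphXn /= exprMn rmorphM /= !hdot_rnorm.
rewrite normCK.
by move: h; rewrite subr_ge0 ler_pdivrMr.
Qed.

Lemma eq_small (x y : C) : (forall eps : R, 0 < eps -> `|x - y| <= eps%:C) -> x = y.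
Proof.
move=> h; apply/eqP; rewrite -subr_eq0 -normr_eq0.
have e : `|x - y| = (complex.Re `|x - y|)%:C by rewrite RRe_real// ger0_real.
rewrite e; apply/eqP; congr (_%:C); apply/eqP; rewrite eq_le -ler0c -e normr_ge0 andbT.
by apply/ler_addgt0Pr => eps e0; rewrite add0r -lecR -e; exact: h.
Qed.

(** Polarization with x + y and x + iy. *)
Lemma isometry_hdot H1 H2 (U : {linear H1 -> H2}) :
  (forall x, rnorm (U x) = rnorm x) -> forall x y, hdot H2 (U x) (U y) = hdot H1 x y.
Proof.
move=> h x y.
have n z : hdot H2 (U z) (U z) = hdot H1 z z by rewrite !hdot_rnorm h.
have e1 := n (x + y); have e2 := n (x + 'i%C *: y).
rewrite !linearD /= !(hdotDl, hdotDr) !n in e1.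
rewrite !linearD /= linearZ /= !(hdotDl, hdotDr, hdotZl, hdotZr) !n in e2.
have ci : Num.conj ('i%C : C) = - 'i%C by apply/eqP; rewrite eq_complex /= oppr0 !eqxx.
rewrite !ci in e2.
have ii : 'i%C * 'i%C = -1 :> C by rewrite -expr2 sqr_i.
apply: (@mulfI _ 2); first by rewrite pnatr_eq0.
have {}e1 : hdot H2 (U x) (U y) + hdot H2 (U y) (U x) = hdot H1 x y + hdot H1 y x.
  by apply: (addrI (hdot H1 x x + hdot H1 y y)); move: e1; congr (_ = _); ring.
have {}e2 : - 'i%C * hdot H2 (U x) (U y) + 'i%C * hdot H2 (U y) (U x) =
    - 'i%C * hdot H1 x y + 'i%C * hdot H1 y x.
  apply: (addrI (hdot H1 x x - 'i%C * 'i%C * hdot H1 y y)); move: e2; congr (_ = _); ring.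
transitivity ((hdot H2 (U x) (U y) + hdot H2 (U y) (U x)) +
   'i%C * (- 'i%C * hdot H2 (U x) (U y) + 'i%C * hdot H2 (U y) (U x))).
  rewrite mulrDr !mulrA mulrN ii; ring.
rewrite e1 e2 mulrDr !mulrA mulrN ii; ring.
Qed.

End Completeness.

(** * Spaces with the same reproducing kernel *)

Section SameKernel.
Variables (R : realType) (d : nat) (O : set 'rV[R[i]]_d).
Local Notation C := R[i].
Variables Ka Kb : 'rV[C]_d -> 'rV[C]_d -> C.
Hypothesis eqK : forall z w, O z -> O w -> Ka z w = Kb z w.

Lemma reproducing_family (K : 'rV[C]_d -> 'rV[C]_d -> C) (H : rkhs O K) :
  exists k : 'rV[C]_d -> H, forall w, O w ->
    (forall z, O z -> fun_of (k w) z = K z w) /\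
    (forall f : H, fun_of f w = hdot H f (k w)).
Proof.
have P w : exists k : H, O w -> (forall z, O z -> fun_of k z = K z w) /\
    (forall f : H, fun_of f w = hdot H f k).
  have [Ow|nO] := pselect (O w); last by exists 0.
  by have [k hk] := fun_of_reproducing H Ow; exists k.
have [k hk] := choice P; exists k => w Ow; exact: hk.
Qed.

Variables (Ha : rkhs O Ka) (Hb : rkhs O Kb).

(** Every function of Ha is a function of Hb, with the same norm: it is a limit
    of combinations of kernel functions, and those have the same norms in both
    spaces. *)
Lemma rkhs_transfer (f : Ha) : exists g : Hb,
  (forall z, O z -> fun_of g z = fun_of f z) /\ rnorm g = rnorm f.
Proof.
have [ka hka] := reproducing_family Ha; have [kb hkb] := reproducing_family Hb.
pose P (s : Ha) (s' : Hb) := combinations O (fun w => (ka w, kb w)) (s, s').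
have PE s s' : P s s' -> exists (n : nat) (c : 'I_n -> C) (w : 'I_n -> 'rV[C]_d),
    [/\ forall l, O (w l), s = \sum_l c l *: ka (w l) & s' = \sum_l c l *: kb (w l)].
  move=> [n [c [w [Ow E]]]]; exists n, c, w; split=> //.
    by have := congr1 fst E; rewrite (raddf_sum fst).
  by have := congr1 snd E; rewrite (raddf_sum snd).
have Plin a x x' y y' : P x x' -> P y y' -> P (a *: x + y) (a *: x' + y').
  exact: (@combinations_lin _ (Ha * Hb)%type).
have Pfun s s' z : P s s' -> O z -> fun_of s z = fun_of s' z.
  move=> /PE[n [c [w [Ow -> ->]]]] Oz; rewrite !fun_of_sum//; apply: eq_bigr => l _.
  have [ea _] := hka _ (Ow l); have [eb _] := hkb _ (Ow l).
  by rewrite ea// eb// eqK.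
have Pnorm s s' : P s s' -> rnorm s = rnorm s'.
  move=> Ps; have [n [c [w [Ow es es']]]] := PE _ _ Ps.
  apply/eqP; rewrite -(@eqrXn2 _ 2)// ?rnorm_ge0//; apply/eqP/complexI.
  rewrite -!hdot_rnorm {2}es {2}es' !linear_sumr /=; apply: eq_bigr => l _.
  rewrite !hdotZr; have [_ <-] := hka _ (Ow l); have [_ <-] := hkb _ (Ow l).
  by rewrite (Pfun _ _ _ Ps).
have dense (eps : R) : 0 < eps -> exists2 s, (exists s', P s s') & rnorm (f - s) <= eps.
  apply: (dense_of_orthogonal (S := [set s | exists s', P s s'])).
  - by exists 0; exact: (@combinations0 _ (Ha * Hb)%type).
  - by move=> a x y [x' Px] [y' Py]; exists (a *: x' + y'); exact: Plin.
  - move=> h hS; apply: fun_of_inj => z Oz.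
    have z0 : fun_of (0 : Ha) z = 0 by rewrite (proj2 (hka z Oz)) hdot0l.
    rewrite z0 (proj2 (hka z Oz)); apply: hS.
    by exists (kb z); exact: (@combinations1 _ (Ha * Hb)%type).
have step n : exists p : Ha * Hb, P p.1 p.2 /\ rnorm (f - p.1) <= n.+1%:R^-1.
  have n0 : (0 : R) < n.+1%:R^-1 by rewrite invr_gt0.
  by have [s [s' Ps] hs] := dense _ n0; exists (s, s').
have [u hu] := choice step.
have cauchy (eps : R) : 0 < eps -> exists n0, forall n m, (n0 <= n)%N -> (n0 <= m)%N ->
     rnorm ((u n).2 - (u m).2) <= eps.
  move=> e0; have [n0 hn0] := @invn_small R (eps / 2) (divr_gt0 e0 (ltr0Sn _ 1)).
  exists n0 => n m hn hm; have [Pn dn] := hu n; have [Pm dm] := hu m.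
  have Pnm : P ((u n).1 - (u m).1) ((u n).2 - (u m).2).
    have := Plin (-1) _ _ _ _ Pm Pn.
    by rewrite (scaleN1r (u m).1) (scaleN1r (u m).2) (addrC _ (u n).1) (addrC _ (u n).2).
  rewrite -(Pnorm _ _ Pnm).
  have := rnormD ((u n).1 - f) (f - (u m).1); rewrite addrA subrK.
  rewrite [rnorm ((u n).1 - f)]rnormB => tri.
  apply: (le_trans tri); rewrite [eps]splitr lerD//.
    exact: le_trans dn (hn0 _ hn).
  exact: le_trans dm (hn0 _ hm).
have [g hg] := hilbert_complete cauchy.
have near_fg (eps : R) : 0 < eps -> exists s s',
    [/\ P s s', rnorm (f - s) <= eps & rnorm (g - s') <= eps].
  move=> e0; have [n1 h1] := hg eps e0; have [n2 h2] := invn_small e0.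
  have [Pn dn] := hu (maxn n1 n2).
  exists (u (maxn n1 n2)).1, (u (maxn n1 n2)).2; split => //.
    by apply: (le_trans dn); apply: h2; exact: leq_maxr.
  by apply: h1; exact: leq_maxl.
exists g; split=> [z Oz|].
  apply: eq_small => eps e0.
  have [_ ra] := hka z Oz; have [_ rb] := hkb z Oz.
  pose m := rnorm (ka z) + rnorm (kb z) + 1.
  have m0 : 0 < m by rewrite ltr_wpDl// addr_ge0// rnorm_ge0.
  have [s [s' [Ps fs gs]]] := near_fg (eps / m) (divr_gt0 e0 m0).
  have -> : fun_of g z - fun_of f z = hdot Hb (g - s') (kb z) - hdot Ha (f - s) (ka z).
    rewrite !hdotDl !hdotNl -!ra -!rb (Pfun _ _ _ Ps Oz).
    by rewrite opprB addrA subrK.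
  apply: (le_trans (ler_normB _ _)).
  apply: (le_trans (lerD (hdot_cauchy_schwarz _ _) (hdot_cauchy_schwarz _ _))).
  rewrite -rmorphD lecR.
  have h1 := ler_wpM2r (rnorm_ge0 (kb z)) gs.
  have h2 := ler_wpM2r (rnorm_ge0 (ka z)) fs.
  apply: (le_trans (lerD h1 h2)); rewrite -mulrDr -ler_pdivlMl ?divr_gt0//.
  rewrite invf_div divfK ?gt_eqF// /m addrC lerDl//.
have le_eps (x y : R) : (forall eps, 0 < eps -> x <= y + eps) -> x <= y.
  by move=> h; apply/ler_addgt0Pr.
apply/eqP; rewrite eq_le; apply/andP; split; apply: le_eps => eps e0;
  have [s [s' [Ps fs gs]]] := near_fg (eps / 2) (divr_gt0 e0 (ltr0Sn _ 1));
  have ns := Pnorm _ _ Ps.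
- have t1 := rnormD (g - s') s'; rewrite subrK in t1.
  have t2 := rnormD (s - f) f; rewrite subrK [rnorm (s - f)]rnormB in t2.
  apply: (le_trans t1); rewrite -ns [leRHS]addrC [eps]splitr -addrA lerD//.
  by apply: (le_trans t2); rewrite lerD2r.
- have t1 := rnormD (f - s) s; rewrite subrK in t1.
  have t2 := rnormD (s' - g) g; rewrite subrK [rnorm (s' - g)]rnormB in t2.
  apply: (le_trans t1); rewrite ns [leRHS]addrC [eps]splitr -addrA lerD//.
  by apply: (le_trans t2); rewrite lerD2r.
Qed.

End SameKernel.

Lemma same_kernel_equivalent (R : realType) (d : nat) (O : set 'rV[R[i]]_d)
    (Ka Kb : 'rV[R[i]]_d -> 'rV[R[i]]_d -> R[i]) (Ha : rkhs O Ka) (Hb : rkhs O Kb)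
    (Ma : 'I_d -> {linear Ha -> Ha}) (Mb : 'I_d -> {linear Hb -> Hb}) :
  multiplication_tuple Ma -> multiplication_tuple Mb ->
  (forall z w, O z -> O w -> Ka z w = Kb z w) -> unitarily_equivalent Ma Mb.
Proof.
move=> hMa hMb eqK.
have [u hu] := choice (@rkhs_transfer _ _ _ _ _ eqK Ha Hb).
have [U hU] : exists U : {linear Ha -> Hb}, U =1 u.
  apply: linear_of => c x y; apply: fun_of_inj => z Oz.
  rewrite (proj1 (hu _))// !fun_of_linear//.
  by rewrite (proj1 (hu x))// (proj1 (hu y)).
exists U; split.
  split; first by apply: isometry_hdot => x; rewrite hU (proj2 (hu x)).
  move=> g; have eqK' z w : O z -> O w -> Kb z w = Ka z w by move=> *; rewrite eqK.
  have [f [fg _]] := @rkhs_transfer _ _ _ _ _ eqK' Hb Ha g.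
  exists f; apply: fun_of_inj => z Oz; rewrite hU (proj1 (hu f))// fg//.
move=> j f; apply: fun_of_inj => z Oz.
rewrite !hU (proj1 (hu _))// (proj2 (hMa j))// (proj2 (hMb j))//.
by rewrite (proj1 (hu f)).
Qed.

(** * Adjoints and contractions *)

Lemma scale_halfD (K : numFieldType) (V : lmodType K) (w : V) : 2^-1 *: (w + w) = w.
Proof.
rewrite -[X in X + X]scale1r -scalerDl scalerA -[1 + 1]/(2%:R).
by rewrite mulVf ?pnatr_eq0 ?scale1r.
Qed.

Section Adjoint.
Variable R : realType.
Local Notation C := R[i].

Definition adjmx (m n : nat) (A : 'M[C]_(m, n)) : 'M[C]_(n, m) := (Defs.conjmx A)^T.

Lemma adjmxM m n p (A : 'M[C]_(m, n)) (B : 'M[C]_(n, p)) :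
  adjmx (A *m B) = adjmx B *m adjmx A.
Proof. by rewrite /adjmx /Defs.conjmx map_mxM trmx_mul. Qed.

Lemma adjmxD m n (A B : 'M[C]_(m, n)) : adjmx (A + B) = adjmx A + adjmx B.
Proof. by rewrite /adjmx /Defs.conjmx map_mxD linearD. Qed.

Lemma adjmxN m n (A : 'M[C]_(m, n)) : adjmx (- A) = - adjmx A.
Proof. by rewrite /adjmx /Defs.conjmx map_mxN linearN. Qed.

Lemma adjmxZ m n c (A : 'M[C]_(m, n)) : adjmx (c *: A) = Num.conj c *: adjmx A.
Proof. by rewrite /adjmx /Defs.conjmx map_mxZ linearZ. Qed.

Lemma adjmxK m n (A : 'M[C]_(m, n)) : adjmx (adjmx A) = A.
Proof. by apply/matrixP => i j; rewrite !mxE conjCK. Qed.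

Lemma adjmx0 m n : adjmx (0 : 'M[C]_(m, n)) = 0.
Proof. by rewrite /adjmx /Defs.conjmx map_mx0 trmx0. Qed.

Lemma adjmx_sum m n (I : Type) (s : seq I) (P : pred I) (F : I -> 'M[C]_(m, n)) :
  adjmx (\sum_(i <- s | P i) F i) = \sum_(i <- s | P i) adjmx (F i).
Proof. exact: (big_morph _ (@adjmxD m n) (adjmx0 m n)). Qed.

Lemma adjmxE m n (A : 'M[C]_(m, n)) : adjmx A = (A ^t Num.conj)%sesqui.
Proof. by apply/matrixP => i j; rewrite !mxE. Qed.

Lemma normsqE (x : C) : (normsq x)%:C = Num.conj x * x.
Proof. by rewrite mulrC -normCK -add_Re2_Im2. Qed.

Lemma normsq_ge0 (x : C) : 0 <= normsq x.
Proof. by rewrite addr_ge0 ?sqr_ge0. Qed.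

Lemma normsqM (x y : C) : normsq (x * y) = normsq x * normsq y.
Proof. by apply: complexI; rewrite rmorphM /= !normsqE rmorphM /= mulrACA. Qed.

Lemma sqnorm_ge0 m n (A : 'M[C]_(m, n)) : 0 <= sqnorm A.
Proof. by apply: sumr_ge0 => i _; apply: sumr_ge0 => j _; exact: normsq_ge0. Qed.

Lemma sqnormE n (x : 'cV[C]_n) : (sqnorm x)%:C = (adjmx x *m x) 0 0.
Proof.
rewrite mxE /sqnorm rmorph_sum /=; apply: eq_bigr => i _.
by rewrite big_ord1 normsqE !mxE.
Qed.

Lemma sqnormB n (u v : 'cV[C]_n) : (sqnorm (u - v))%:C =
  (sqnorm u)%:C - (adjmx u *m v) 0 0 - (adjmx v *m u) 0 0 + (sqnorm v)%:C.
Proof.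
rewrite !sqnormE adjmxD adjmxN mulmxDl !mulmxDr !mulNmx !mulmxN opprK !mxE.
ring.
Qed.

Lemma sqnorm_colP n (x y : 'cV[C]_n) : sqnorm x = sqnorm y <-> adjmx x *m x = adjmx y *m y.
Proof.
split=> [h|h]; last by apply: complexI; rewrite !sqnormE h.
by apply/matrixP => i j; rewrite !ord1 -!sqnormE h.
Qed.

Lemma sqnorm_eq0 m n (A : 'M[C]_(m, n)) : sqnorm A = 0 -> A = 0.
Proof.
move=> h; apply/matrixP => i j; rewrite mxE.
have h1 : \sum_j normsq (A i j) = 0.
  have := h; rewrite /sqnorm (bigD1 i)//= => /eqP; rewrite paddr_eq0.
  - by case/andP => /eqP.
  - by apply: sumr_ge0 => k _; exact: normsq_ge0.
  - by apply: sumr_ge0 => l _; apply: sumr_ge0 => k _; exact: normsq_ge0.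
have : normsq (A i j) = 0.
  move: h1; rewrite (bigD1 j)//= => /eqP; rewrite paddr_eq0 ?normsq_ge0//.
    by case/andP => /eqP.
  by apply: sumr_ge0 => k _; exact: normsq_ge0.
move=> h2; have : (normsq (A i j))%:C = 0 by rewrite h2.
by rewrite normsqE mulrC => /eqP; rewrite mul_conjC_eq0 => /eqP.
Qed.

Lemma sqnormZ m n c (A : 'M[C]_(m, n)) : sqnorm (c *: A) = normsq c * sqnorm A.
Proof.
rewrite /sqnorm mulr_sumr; apply: eq_bigr => i _; rewrite mulr_sumr.
by apply: eq_bigr => j _; rewrite mxE normsqM.
Qed.

Lemma normsq_real (t : R) : normsq t%:C = t ^+ 2.
Proof. by rewrite /normsq /= expr0n addr0. Qed.

Lemma sqnorm0 m n : sqnorm (0 : 'M[C]_(m, n)) = 0.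
Proof. by rewrite -(scale0r 0) sqnormZ (normsq_real 0) expr0n mul0r. Qed.

Definition contraction m n (A : 'M[C]_(m, n)) := forall w : 'cV[C]_n, sqnorm (A *m w) <= sqnorm w.

(** The singular values of A, in the form of a unitary diagonalization of
    the quadratic form |A w|^2. *)
Lemma singular_values m n (A : 'M[C]_(m, n)) : exists (P : 'M[C]_n) (s : 'I_n -> R),
  [/\ forall w : 'cV[C]_n, sqnorm (P *m w) = sqnorm w, P *m adjmx P = 1%:M,
   forall i, 0 <= s i
   & forall w : 'cV[C]_n, sqnorm (A *m w) = \sum_i s i * normsq ((P *m w) i 0)].
Proof.
pose B := adjmx A *m A.
have Bh : B \is hermsymmx.
  apply/is_hermitianmxP; rewrite expr0 scale1r -adjmxE /B adjmxM adjmxK//.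
have [P [D [PP PP' Bdiag Dreal]]] : exists (P : 'M[C]_n) (D : 'rV[C]_n),
    [/\ P *m adjmx P = 1%:M, adjmx P *m P = 1%:M, B = adjmx P *m diag_mx D *m P
      & D \is a mxOver Num.real].
  have /orthomx_spectralP BE := hermitian_normalmx Bh.
  have Pu := spectral_unitarymx B.
  have PP : spectralmx B *m adjmx (spectralmx B) = 1%:M by rewrite adjmxE; apply/unitarymxP.
  exists (spectralmx B), (spectral_diag B); split=> //.
  - exact: mulmx1C.
  - by rewrite {1}BE (invmx_unitary Pu) adjmxE.
  - exact: hermitian_spectral_diag_real Bh.
exists P, (fun i => complex.Re (D 0 i)).
have D_real i : D 0 i = (complex.Re (D 0 i))%:C.
  rewrite RRe_real//; have /mxOverP := Dreal; exact.
have quad (w : 'cV[C]_n) : sqnorm (A *m w) = \sum_i complex.Re (D 0 i) * normsq ((P *m w) i 0).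
  apply: complexI; rewrite sqnormE adjmxM -mulmxA (mulmxA _ A) -/B Bdiag.
  rewrite -!mulmxA (mulmxA (adjmx w)) -adjmxM mxE rmorph_sum /=.
  apply: eq_bigr => i _; rewrite mul_diag_mx [X in _ * X]mxE mxE rmorphM /= -D_real normsqE.
  by rewrite mulrCA !mxE.
split => //.
- by move=> w; apply/sqnorm_colP; rewrite adjmxM -mulmxA (mulmxA _ P) PP' mul1mx.
- move=> i; have := quad (adjmx P *m delta_mx i 0).
  rewrite (mulmxA P) PP mul1mx (bigD1 i)//= mxE !eqxx big1 ?addr0.
    by rewrite (normsq_real 1) expr1n mulr1 => <-; exact: sqnorm_ge0.
  by move=> j /negPf ji; rewrite mxE ji /= (normsq_real 0) expr0n mulr0.
Qed.

Lemma mulmx_bounded m n (A : 'M[C]_(m, n)) : exists2 L : R, 0 <= L &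
  forall w : 'cV[C]_n, sqnorm (A *m w) <= L * sqnorm w.
Proof.
have [P [s [Pn _ s0 q]]] := singular_values A.
exists (\sum_i s i); first exact: sumr_ge0.
move=> w; rewrite q -(Pn w) /sqnorm mulr_suml.
apply: ler_sum => i _; rewrite ler_wpM2l// (bigD1 i)//= big_ord1 lerDl.
by apply: sumr_ge0 => k _; rewrite big_ord1 normsq_ge0.
Qed.

Lemma opnorm_lt1P m n (A : 'M[C]_(m, n)) : opnorm A < 1 <->
  exists2 t : R, 0 <= t < 1 & forall w : 'cV[C]_n, sqnorm (A *m w) <= t * sqnorm w.
Proof.
have [L L0 hL] := mulmx_bounded A.
set S := [set y : R | exists x : 'cV[C]_n,
         sqnorm x <= 1 /\ y = Num.sqrt (sqnorm (A *m x))].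
have supS : has_sup S.
  split; first by exists (Num.sqrt (sqnorm (A *m (0 : 'cV[C]_n)))), (0 : 'cV[C]_n); split=> //; rewrite sqnorm0 ler01.
  exists (Num.sqrt L) => _ [x [x1 ->]]; rewrite ler_wsqrtr//.
  by apply: (le_trans (hL x)); rewrite ler_piMr.
split=> [lt1|[t /andP[t0 t1] ht]].
  have op0 : 0 <= opnorm A.
    have := sqrtr_ge0 (sqnorm (A *m (0 : 'cV[C]_n))); move/le_trans; apply.
    apply: sup_upper_bound => //; exists (0 : 'cV[C]_n); split=> //.
    by rewrite sqnorm0 ler01.
  exists (opnorm A ^+ 2); first by rewrite sqr_ge0 expr_lt1.
  move=> w; have [->|w0] := eqVneq w 0; first by rewrite mulmx0 !sqnorm0 mulr0.
  have nw : 0 < sqnorm w.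
    rewrite lt0r sqnorm_ge0 andbT; apply: contra_neq w0; exact: sqnorm_eq0.
  pose c : R := (Num.sqrt (sqnorm w))^-1.
  have c2 : c ^+ 2 = (sqnorm w)^-1 by rewrite exprVn sqr_sqrtr// ltW.
  have : Num.sqrt (sqnorm (A *m (c%:C *: w))) <= opnorm A.
    apply: sup_upper_bound => //; exists (c%:C *: w).
    by rewrite sqnormZ normsq_real c2 mulVf// gt_eqF.
  rewrite -ler_sqr ?nnegrE ?sqrtr_ge0// sqr_sqrtr ?sqnorm_ge0//.
  by rewrite -scalemxAr sqnormZ normsq_real c2 ler_pdivrMl// mulrC.
apply: (@le_lt_trans _ _ (Num.sqrt t)); last first.
  by rewrite -[ltRHS]sqrtr1 ltr_sqrt.
apply: ge_sup; first by case: supS.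
move=> _ [x [x1 ->]]; rewrite ler_wsqrtr//.
by apply: (le_trans (ht x)); rewrite ler_piMr.
Qed.

Lemma opnorm_contraction m n (A : 'M[C]_(m, n)) : opnorm A < 1 -> contraction A.
Proof.
move=> /opnorm_lt1P[t /andP[t0 t1] h] w; apply: (le_trans (h w)).
by rewrite ler_piMl ?sqnorm_ge0// ltW.
Qed.

(** The norm of A is attained at the vector of its largest singular value. *)
Lemma opnorm_ge1_attained m n (A : 'M[C]_(m, n)) : ~ (opnorm A < 1) ->
  exists x : 'cV[C]_n, sqnorm x = 1 /\ 1 <= sqnorm (A *m x).
Proof.
move=> hA; have [P [s [Pn PP s0 q]]] := singular_values A.
have [i si] : exists i, 1 <= s i.
  apply: contrapT => hs; apply: hA; apply/opnorm_lt1P.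
  have lt1 i : s i < 1 by rewrite ltNge; apply/negP => h; apply: hs; exists i.
  exists (\big[Order.max/0]_i s i).
    apply/andP; split; first exact: bigmax_ge_id.
    by apply: bigmax_lt.
  move=> w; rewrite q -(Pn w) /sqnorm mulr_sumr; apply: ler_sum => i _.
  by rewrite big_ord1 ler_wpM2r ?normsq_ge0// le_bigmax.
exists (adjmx P *m delta_mx i 0); split.
  rewrite -(Pn _) mulmxA PP mul1mx /sqnorm (bigD1 i)//= [X in _ + X]big1 ?addr0.
    by rewrite big_ord1 mxE !eqxx (normsq_real 1) expr1n.
  by move=> j /negPf ji; rewrite big_ord1 mxE ji (normsq_real 0) expr0n.
rewrite q (mulmxA P) PP mul1mx (bigD1 i)//= mxE !eqxx big1 ?addr0.
  by rewrite (normsq_real 1) expr1n mulr1.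
by move=> j /negPf ji; rewrite mxE ji /= (normsq_real 0) expr0n mulr0.
Qed.

(** With x the image of y under the adjoint of A, expand |A x - y|^2 >= 0 and
    use |A x| <= |x|. *)
Lemma contraction_adjmx m n (A : 'M[C]_(m, n)) : contraction A -> contraction (adjmx A).
Proof.
move=> hA y; set x := adjmx A *m y; set u := A *m x.
have h : sqnorm u <= sqnorm x := hA x.
have yx : (adjmx y *m u) 0 0 = (sqnorm x)%:C.
  by rewrite sqnormE /u mulmxA -[in RHS]/x /x adjmxM adjmxK.
have xy : (adjmx u *m y) 0 0 = (sqnorm x)%:C.
  by rewrite sqnormE /u adjmxM -mulmxA.
have pos : (sqnorm (u - y))%:C = (sqnorm u)%:C - (sqnorm x)%:C - (sqnorm x)%:C + (sqnorm y)%:C.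
  by rewrite sqnormB xy yx.
have {}pos : sqnorm (u - y) = sqnorm u - sqnorm x - sqnorm x + sqnorm y.
  by apply: complexI; rewrite pos rmorphD /= !rmorphB.
by have := sqnorm_ge0 (u - y); rewrite pos; lra.
Qed.

(** Equality case: a contraction that preserves the norm of x is inverted on
    its value at x by the adjoint. *)
Lemma contraction_attained m n (A : 'M[C]_(m, n)) (x : 'cV[C]_n) :
  contraction A -> sqnorm x = 1 -> 1 <= sqnorm (A *m x) ->
  sqnorm (A *m x) = 1 /\ adjmx A *m (A *m x) = x.
Proof.
move=> hA x1 h1; have Ax1 : sqnorm (A *m x) = 1.
  by apply/le_anti; rewrite h1 andbT -x1 hA.
split=> //; have h := contraction_adjmx hA (A *m x).
have sq0 : sqnorm (adjmx A *m (A *m x) - x) <= 0.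
  have e2 : (adjmx x *m (adjmx A *m (A *m x))) 0 0 = 1.
    by rewrite mulmxA -adjmxM -sqnormE Ax1.
  have e3 : (adjmx (adjmx A *m (A *m x)) *m x) 0 0 = 1.
    by rewrite adjmxM adjmxK -mulmxA -sqnormE Ax1.
  rewrite Ax1 in h.
  rewrite -lecR sqnormB e2 e3 x1 /= addrNK -rmorphB /= lecR subr_le0//.
apply/eqP; rewrite -subr_eq0; apply/eqP/sqnorm_eq0/le_anti.
by rewrite sq0 sqnorm_ge0.
Qed.

End Adjoint.

(** * Linear automorphisms of a domain *)

Section GroupK.
Variables (R : realType) (d : nat) (O : set 'rV[R[i]]_d).
Local Notation C := R[i].

Lemma groupK1 : groupK O 1%:M.
Proof.
exists id; split=> //; last by move=> z _; rewrite mulmx1.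
apply: connected_component_refl; exists id; split=> //;
  by move=> z _; exact: differentiable_id.
Qed.

Hypothesis absorbing : forall z, exists2 eps : R, 0 < eps &
  forall t, 0 <= t <= eps -> O (t%:C *: z).

Lemma absorbing0 : O 0.
Proof.
have [eps e0 h] := absorbing 0.
by have := h 0; rewrite lexx ltW// scaler0; apply.
Qed.

(** The automorphism inverts k inside O only; k is injective because O
    contains a multiple of every vector. *)
Lemma groupK_domain k : groupK O k -> forall z, O z <-> O (z *m k).
Proof.
move=> [phi [hphi phi0 phiE]].
have [g [_ _ h1 h2]] : automorphisms O phi by apply: connected_component_sub hphi.
have inj (y : 'rV[C]_d) : y *m k = 0 -> y = 0.
  move=> yk; have [eps e0 h] := absorbing y.
  have Oy : O (eps%:C *: y) by apply: h; rewrite lexx ltW.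
  have [_] := h1 _ Oy; rewrite phiE// -scalemxAl yk scaler0.
  have [_] := h1 _ absorbing0; rewrite phi0 => -> /esym/eqP.
  rewrite scaler_eq0 => /orP[/eqP h0|/eqP//].
  by move: e0; rewrite -ltcR h0 ltxx.
move=> z; split=> [Oz|Ozk]; first by have [] := h1 _ Oz; rewrite phiE.
have [Og] := h2 _ Ozk; rewrite phiE// => gE.
have /inj/eqP : (g (z *m k) - z) *m k = 0 by rewrite mulmxBl gE subrr.
by rewrite subr_eq0 => /eqP <-.
Qed.

End GroupK.

Section Rigidity.
Variable R : realType.
Local Notation C := R[i].

Lemma sqnorm_parallelogram n (u v : 'cV[C]_n) :
  sqnorm (u + v) + sqnorm (u - v) = 2 * (sqnorm u + sqnorm v).
Proof.
apply: complexI; rewrite !rmorphM !rmorphD /= -[v in u + v]opprK !sqnormB.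
rewrite adjmxN mulmxN mulNmx !mxE.
have -> : sqnorm (- v) = sqnorm v.
  by apply: complexI; rewrite !sqnormE adjmxN mulmxN mulNmx opprK.
rewrite rmorph1 /=; ring.
Qed.

(** Rigidity of a copy of the sup norm among the contractions: by the
    parallelogram identity, a unit vector xi_i at which v_i attains its norm is
    killed by the other v_l, and the same holds for the adjoints and
    eta_i = v_i xi_i. The vectors xi_i, eta_i are the columns of Xi and H. *)
Lemma rigid_contractions m n r (v : 'I_r -> 'M[C]_(m, n)) :
  (forall i, contraction (v i)) ->
  (forall i l, i != l -> contraction (v i + v l) /\ contraction (v i - v l)) ->
  (forall i, ~ opnorm (v i) < 1) ->
  exists (Xi : 'M[C]_(n, r)) (H : 'M[C]_(m, r)),
    [/\ adjmx Xi *m Xi = 1%:M, adjmx H *m H = 1%:M,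
     forall l, v l *m Xi = H *m delta_mx l l
     & forall l, adjmx (v l) *m H = Xi *m delta_mx l l].
Proof.
move=> c1 c2 big.
have [xi hxi] := choice (fun i => opnorm_ge1_attained (big i)).
pose eta i := v i *m xi i.
have xi1 i : sqnorm (xi i) = 1 by have [] := hxi i.
have att i : sqnorm (eta i) = 1 /\ adjmx (v i) *m eta i = xi i.
  by have [h1 h2] := hxi i; exact: contraction_attained.
have vxi l i : l != i -> v l *m xi i = 0.
  move=> li; apply: sqnorm_eq0; apply/le_anti; rewrite sqnorm_ge0 andbT.
  have il : i != l by rewrite eq_sym.
  have [p1 p2] := c2 i l il.
  have := sqnorm_parallelogram (eta i) (v l *m xi i).
  rewrite (att i).1 /eta -mulmxDl -mulmxBl.
  by have := p1 (xi i); have := p2 (xi i); rewrite xi1; lra.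
have veta l i : l != i -> adjmx (v l) *m eta i = 0.
  move=> li; have il : i != l by rewrite eq_sym.
  have [p1 _] := c2 i l il.
  have e1 : (v i + v l) *m xi i = eta i by rewrite mulmxDl (vxi l i li) addr0.
  have : adjmx (v i + v l) *m eta i = xi i.
    have := contraction_attained p1 (xi1 i); rewrite e1 (att i).1.
    by move=> /(_ (lexx _))[].
  rewrite adjmxD mulmxDl (att i).2 => /(canRL (addKr _)) ->.
  by rewrite addNr.
have dot1 n' (x : 'cV[C]_n') : sqnorm x = 1 -> adjmx x *m x = 1%:M.
  move=> h; apply/matrixP => i j; rewrite !ord1 -sqnormE h mxE eqxx//.
have xixi k i : adjmx (xi k) *m xi i = (k == i)%:R%:M.
  have [->|ki] := eqVneq k i; first by rewrite dot1.
  rewrite -(att i).2 mulmxA -[adjmx (xi k) *m _]adjmxM vxi ?adjmx0 ?mul0mx 1?eq_sym//.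
  by rewrite mulr0n raddf0.
have etaeta k i : adjmx (eta k) *m eta i = (k == i)%:R%:M.
  have [->|ki] := eqVneq k i; first by rewrite dot1 ?(att i).1.
  rewrite {2}/eta mulmxA -[v i]adjmxK -adjmxM veta ?adjmx0 ?mul0mx 1?eq_sym//.
  by rewrite mulr0n raddf0.
pose mat p (x : 'I_r -> 'cV[C]_p) : 'M[C]_(p, r) := \matrix_(a, i) x i a 0.
have matE p q (A : 'M[C]_(q, p)) x a i : (A *m mat p x) a i = (A *m x i) a 0.
  by rewrite !mxE; apply: eq_bigr => b _; rewrite mxE.
have mat_orth p x : (forall k i, adjmx (x k) *m x i = (k == i)%:R%:M) ->
    adjmx (mat p x) *m mat p x = 1%:M.
  move=> h; apply/matrixP => k i; rewrite matE.
  have -> : (adjmx (mat p x) *m x i) k 0 = (adjmx (x k) *m x i) 0 0.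
    by rewrite !mxE; apply: eq_bigr => b _; rewrite !mxE.
  by rewrite h !mxE eqxx mulr1n.
have mat_delta p x l a i : (mat p x *m delta_mx l l) a i = (i == l)%:R * x l a 0.
  rewrite mxE (bigD1 l)//= big1 ?addr0; first by rewrite !mxE eqxx mulrC.
  by move=> k /negPf kl; rewrite !mxE kl mulr0.
exists (mat n xi), (mat m eta); split; [exact: mat_orth|exact: mat_orth| |].
- move=> l; apply/matrixP => a i; rewrite matE mat_delta.
  have [->|il] := eqVneq i l; first by rewrite mul1r.
  by rewrite vxi 1?eq_sym// mul0r mxE.
- move=> l; apply/matrixP => a i; rewrite matE mat_delta.
  have [->|il] := eqVneq i l; first by rewrite mul1r (att l).2.
  by rewrite veta 1?eq_sym// mul0r mxE.
Qed.

Lemma partial_isometry_contraction m n (A : 'M[C]_(m, n)) :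
  A *m adjmx A *m A = A -> contraction A.
Proof.
move=> AE w; pose Q := adjmx A *m A.
have QQ : Q *m Q = Q by rewrite /Q mulmxA -(mulmxA _ A) -mulmxA AE.
have Qh : adjmx Q = Q by rewrite /Q adjmxM adjmxK.
have h1 : adjmx (Q *m w) *m w = adjmx (A *m w) *m (A *m w).
  by rewrite (adjmxM Q) Qh (adjmxM A) /Q !mulmxA.
have h2 : adjmx w *m (Q *m w) = adjmx (A *m w) *m (A *m w).
  by rewrite !adjmxM /Q !mulmxA.
have h3 : adjmx (Q *m w) *m (Q *m w) = adjmx (A *m w) *m (A *m w).
  by rewrite adjmxM Qh -mulmxA (mulmxA Q) QQ h2.
have := sqnorm_ge0 (w - Q *m w); rewrite -lecR sqnormB h1 h2 !sqnormE h3.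
by rewrite -!sqnormE addrNK -rmorphB lecR subr_ge0.
Qed.

Lemma partial_isometry_opnorm m n (A : 'M[C]_(m, n)) :
  A *m adjmx A *m A = A -> A != 0 -> ~ opnorm A < 1.
Proof.
move=> AE A0 /opnorm_lt1P[t /andP[t0 t1] h].
apply/negP: A0; rewrite negbK; apply/eqP/matrixP => i j; rewrite [RHS]mxE.
have col0 (w : 'cV[C]_n) : A *m w = 0.
  apply: sqnorm_eq0; apply/le_anti; rewrite sqnorm_ge0 andbT.
  have e1 : sqnorm (A *m (adjmx A *m (A *m w))) = sqnorm (A *m w).
    by rewrite !mulmxA AE.
  have e2 : sqnorm (adjmx A *m (A *m w)) = sqnorm (A *m w).
    apply: complexI; rewrite !sqnormE [adjmx (_ *m (A *m w))]adjmxM adjmxK.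
    by rewrite -mulmxA (mulmxA A) (mulmxA (A *m _)) AE.
  have := h (adjmx A *m (A *m w)); rewrite e1 e2 => h3.
  by move: (sqnorm_ge0 (A *m w)) => h4; nra.
have := col0 (delta_mx j 0) => /(congr1 (fun B : 'cV[C]_m => B i 0)).
by rewrite -colE !mxE.
Qed.

End Rigidity.

(** * Polynomial functions, determinants and Krylov matrices *)

Section PolynomialFunctions.
Variable K : numFieldType.
Implicit Types f g : K -> K.

Definition polynomial_function f := exists q : {poly K}, forall t, f t = q.[t].

Lemma polynomial_function_cst c : polynomial_function (fun=> c).
Proof. by exists c%:P => t; rewrite hornerC. Qed.

Lemma polynomial_function_id : polynomial_function id.
Proof. by exists 'X => t; rewrite hornerX. Qed.

Lemma polynomial_functionD f g : polynomial_function f -> polynomial_function g ->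
  polynomial_function (fun t => f t + g t).
Proof. by move=> [p hp] [q hq]; exists (p + q) => t; rewrite hornerD hp hq. Qed.

Lemma polynomial_functionM f g : polynomial_function f -> polynomial_function g ->
  polynomial_function (fun t => f t * g t).
Proof. by move=> [p hp] [q hq]; exists (p * q) => t; rewrite hornerM hp hq. Qed.

Lemma polynomial_functionB f g : polynomial_function f -> polynomial_function g ->
  polynomial_function (fun t => f t - g t).
Proof. by move=> [p hp] [q hq]; exists (p - q) => t; rewrite hornerD hornerN hp hq. Qed.

Lemma polynomial_function_sum I (s : seq I) (P : pred I) (f : I -> K -> K) :
  (forall i, polynomial_function (f i)) ->
  polynomial_function (fun t => \sum_(i <- s | P i) f i t).
Proof.
move=> /choice[q hq]; exists (\sum_(i <- s | P i) q i) => t.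
by rewrite horner_sum; apply: eq_bigr => i _.
Qed.

Lemma polynomial_function_prod I (s : seq I) (P : pred I) (f : I -> K -> K) :
  (forall i, polynomial_function (f i)) ->
  polynomial_function (fun t => \prod_(i <- s | P i) f i t).
Proof.
move=> /choice[q hq]; exists (\prod_(i <- s | P i) q i) => t.
by rewrite horner_prod; apply: eq_bigr => i _.
Qed.

Lemma polynomial_functionX f k : polynomial_function f ->
  polynomial_function (fun t => f t ^+ k).
Proof. by move=> [q hq]; exists (q ^+ k) => t; rewrite horner_exp hq. Qed.

Lemma horner_inj0 (q : {poly K}) : (forall t, q.[t] = 0) -> q = 0.
Proof.
move=> h; apply/eqP/negPn/negP => q0.
suff : (size [seq (i%:R : K) | i <- iota 0 (size q)] < size q)%N.
  by rewrite size_map size_iota ltnn.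
apply: max_poly_roots => //; first by apply/allP => x _; apply/rootP.
by rewrite map_inj_uniq ?iota_uniq// => i k /eqP; rewrite eqr_nat => /eqP.
Qed.

(** The field is infinite, so that one of two polynomials vanishes if their
    product vanishes everywhere. *)
Lemma polynomial_function_density f g t0 : polynomial_function f ->
  polynomial_function g -> f t0 != 0 -> (forall t, f t != 0 -> g t = 0) ->
  forall t, g t = 0.
Proof.
move=> [p hp] [q hq] ft0 h t.
have : p * q = 0.
  apply: horner_inj0 => s; rewrite hornerM -hp -hq.
  by have [->|/h ->] := eqVneq (f s) 0; rewrite ?mul0r ?mulr0.
move/eqP; rewrite mulf_eq0 => /orP[|] /eqP pq0; last by rewrite hq pq0 horner0.
by move: ft0; rewrite hp pq0 horner0 eqxx.
Qed.

Lemma polynomial_function_det n (A : K -> 'M[K]_n) :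
  (forall i j, polynomial_function (fun t => A t i j)) ->
  polynomial_function (fun t => \det (A t)).
Proof.
move=> h; apply: polynomial_function_sum => s.
by apply: polynomial_functionM; [exact: polynomial_function_cst|exact: polynomial_function_prod].
Qed.

Lemma polynomial_function_mulmx m n p (A : K -> 'M[K]_(m, n)) (B : K -> 'M[K]_(n, p)) :
  (forall i j, polynomial_function (fun t => A t i j)) ->
  (forall i j, polynomial_function (fun t => B t i j)) ->
  forall i j, polynomial_function (fun t => (A t *m B t) i j).
Proof.
move=> hA hB i j.
have [q hq] : polynomial_function (fun t => \sum_k A t i k * B t k j).
  by apply: polynomial_function_sum => k; exact: polynomial_functionM.
by exists q => t; rewrite mxE.
Qed.

Lemma polynomial_function_expmx n (A : K -> 'M[K]_n) k :
  (forall i j, polynomial_function (fun t => A t i j)) ->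
  forall i j, polynomial_function (fun t => (A t ^+ k) i j).
Proof.
move=> hA; elim: k => [|k IH] i j.
  by have := polynomial_function_cst ((1%:M : 'M[K]_n) i j).
have := polynomial_function_mulmx hA IH i j.
by move=> [q hq]; exists q => t; rewrite exprS -hq.
Qed.

Lemma polynomial_function_segment m n (A B : 'M[K]_(m, n)) i j :
  polynomial_function (fun t => (A + t *: B) i j).
Proof.
have [q hq] : polynomial_function (fun t => A i j + t * B i j).
  apply: polynomial_functionD; first exact: polynomial_function_cst.
  apply: polynomial_functionM; first exact: polynomial_function_id.
  exact: polynomial_function_cst.
by exists q => t; rewrite -hq !mxE.
Qed.

End PolynomialFunctions.

Lemma polynomial_function_peval (R : realType) d (D : mpoly.mpoly d R[i])
    (a b : 'rV[R[i]]_d) : polynomial_function (fun t => peval D (a + t *: b)).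
Proof.
have [q hq] : polynomial_function (fun t => \sum_(s <- mpoly.msupp D)
    mpoly.mcoeff s D * \prod_i (a + t *: b) 0 i ^+ s i).
  apply: polynomial_function_sum => s; apply: polynomial_functionM.
    exact: polynomial_function_cst.
  apply: polynomial_function_prod => i; apply: polynomial_functionX.
  exact: polynomial_function_segment.
by exists q => t; rewrite -hq pevalE.
Qed.

(** Along a matrix of rank one the determinant is affine: a bordered matrix
    carries the parameter in a single row. *)
Lemma det_add_rank1 (K : comNzRingType) n (A : 'M[K]_n) (u : 'cV[K]_n) (v : 'rV[K]_n) t :
  \det (A + t *: (u *m v)) = \det A + t * (\det (A + u *m v) - \det A).
Proof.
pose B s := block_mx (1%:M : 'M[K]_1) (- (s *: v)) u A.
have detB s : \det (B s) = \det (A + s *: (u *m v)).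
  have -> : B s = block_mx 1%:M 0 u 1%:M *m block_mx 1%:M (- (s *: v)) 0 (A + s *: (u *m v)).
    rewrite mulmx_block !mul1mx !mulmx0 mulmx1 !addr0 !mul0mx addr0.
    by rewrite mulmxN -scalemxAr addrCA addNr addr0.
  by rewrite det_mulmx det_ublock det_lblock !det1 !mul1r.
have lE (i : 'I_n) : lift (lshift n (0 : 'I_1)) i = rshift 1 i by apply: val_inj.
have rowB s : row' (lshift n 0) (B s) = row' (lshift n 0) (B t).
  by apply/matrixP => i k; rewrite [LHS]mxE [RHS]mxE lE /B !col_mxEd.
have := @determinant_multilinear _ _ (B t) (B 0) (B 1) (lshift n 0) (1 - t) t.
rewrite !detB scale0r addr0 scale1r => ->.
- by ring.
- apply/rowP => k; rewrite !mxE !(unsplitK (inl _)) !mxE.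
  by case: (fintype.split _) => l'; rewrite !mxE; ring.
- exact: rowB.
- exact: rowB.
Qed.

Lemma det_add_rank2 (K : comNzRingType) n (A : 'M[K]_n) (u1 u2 : 'cV[K]_n)
    (v1 v2 : 'rV[K]_n) : exists c0 c1 c2, forall t,
  \det (A + t *: (u1 *m v1) + t *: (u2 *m v2)) = c0 + c1 * t + c2 * t ^+ 2.
Proof.
pose c0 := \det A; pose c1 := \det (A + u2 *m v2).
pose c2 := \det (A + u1 *m v1); pose c3 := \det (A + u1 *m v1 + u2 *m v2).
exists c0, (c2 - c0 + c1 - c0), (c3 - c1 - (c2 - c0)) => t.
rewrite det_add_rank1 det_add_rank1 -/c0 -/c2.
rewrite [A + t *: _ + _]addrAC det_add_rank1 -/c1 [A + u2 *m v2 + _]addrAC -/c3.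
ring.
Qed.

Section Krylov.
Variable K : numFieldType.

Definition krylov N M (X : 'M[K]_M) (w : 'cV[K]_M) : 'M[K]_(M, N) :=
  \matrix_(a, k) (X ^+ k *m w) a 0.

Lemma col_krylov N M (X : 'M[K]_M) w (k : 'I_N) : col k (krylov N X w) = X ^+ k *m w.
Proof. by apply/matrixP => a b; rewrite !ord1 !mxE; apply: eq_bigr => i _; rewrite ?mxE. Qed.

Lemma krylov_independent N M (X : 'M[K]_M) (w : 'cV[K]_M) (c : 'I_N -> K) :
  (forall v : 'cV[K]_N, krylov N X w *m v = 0 -> v = 0) ->
  \sum_k c k *: X ^+ k = 0 -> forall k, c k = 0.
Proof.
move=> hW hc k; have : krylov N X w *m \col_k c k = 0.
  apply/matrixP => a b; rewrite ord1 [RHS]mxE.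
  have : ((\sum_k c k *: X ^+ k) *m w) a 0 = 0 by rewrite hc mul0mx mxE.
  rewrite mulmx_suml summxE mxE => h; rewrite -[RHS]h; apply: eq_bigr => l _.
  by rewrite -scalemxAl [RHS]mxE !mxE mulrC.
by move/hW/matrixP/(_ k 0); rewrite !mxE.
Qed.

Lemma polynomial_function_krylov N M (X : K -> 'M[K]_M) w :
  (forall a b, polynomial_function (fun t => X t a b)) ->
  forall a (k : 'I_N), polynomial_function (fun t => krylov N (X t) w a k).
Proof.
move=> Xpoly a k.
have := @polynomial_function_mulmx _ _ _ _ (fun t => X t ^+ k) (fun=> w)
  (polynomial_function_expmx k Xpoly) (fun i j => polynomial_function_cst (w i j)) a 0.
by move=> [q hq]; exists q => t; rewrite mxE hq.
Qed.

Lemma diag_mx_exp M (a : 'rV[K]_M) k : diag_mx a ^+ k = diag_mx (\row_i a 0 i ^+ k).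
Proof.
elim: k => [|k IH].
  by apply/matrixP => i l; rewrite expr0 !mxE; case: eqVneq => [->|]; rewrite ?mulr1n ?mulr0n.
rewrite exprS -[_ * _]/(_ *m _) IH mulmx_diag; congr diag_mx.
by apply/rowP => i; rewrite !mxE exprS.
Qed.

Lemma krylov_diag N : krylov N (diag_mx (\row_(i < N) (i.+1)%:R)) (const_mx 1) =
  (Vandermonde N (\row_(i < N) (i.+1)%:R))^T.
Proof.
by apply/matrixP => a k; rewrite [LHS]mxE diag_mx_exp mul_diag_mx !mxE mulr1.
Qed.

Lemma det_krylov_diag N :
  \det (krylov N (diag_mx (\row_(i < N) (i.+1)%:R)) (const_mx 1)) != 0.
Proof.
rewrite krylov_diag det_tr det_Vandermonde; apply/prodf_neq0 => a _.
by apply/prodf_neq0 => b ab; rewrite !mxE subr_eq0 eqr_nat eqSS gtn_eqF.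
Qed.

End Krylov.

(** * Frames and Peirce projections in spaces of matrices *)

(** The blocks (i, k) and (k, i) of a Peirce decomposition form one summand of
    index i < k. *)
Lemma big_triangle_sym (V : zmodType) (f : nat -> nat -> V) a b : (a <= b)%N ->
  \sum_(a <= k < b) \sum_(a <= i < k.+1) (if i == k then f k k else f i k + f k i) =
  \sum_(a <= i < b) \sum_(a <= k < b) f i k.
Proof.
elim: b => [|b IH]; first by rewrite leqn0 => /eqP ->; rewrite !big_nil.
rewrite leq_eqVlt => /orP[/eqP <-|]; first by rewrite !big_geq.
rewrite ltnS => ab; rewrite [LHS]big_nat_recr//= IH// [in RHS]big_nat_recr//=.
under [X in _ = X + _]eq_bigr do rewrite big_nat_recr//=.
rewrite big_split/= -addrA; congr (_ + _).
rewrite [in LHS]big_nat_recr//= eqxx [in RHS]big_nat_recr//= addrA; congr (_ + _).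
rewrite -big_split/= big_nat [in RHS]big_nat; apply: eq_bigr => i /andP[_ ib].
by rewrite ltn_eqF.
Qed.

Section PeirceIdempotents.
Variables (R : pzRingType) (n r : nat) (L : 'I_r -> 'M[R]_n).
Hypothesis L_orth : forall i k, L i *m L k = (i == k)%:R *: L i.

(** A system of orthogonal idempotents, completed at the index 0 to a
    resolution of the identity; the given idempotents are shifted by one. *)
Definition resolution (i : nat) : 'M[R]_n :=
  if i == 0%N then 1%:M - \sum_k L k else \sum_(k < r | k.+1 == i) L k.

Lemma resolution_mull k i : L k *m resolution i = (i == k.+1)%:R *: resolution i.
Proof.
rewrite /resolution; case: eqVneq => [->|i0].
  rewrite scale0r mulmxBr mulmx1 mulmx_sumr (bigD1 k)//= L_orth eqxx scale1r.
  rewrite big1 ?addr0 ?subrr// => l /negPf lk; rewrite L_orth eq_sym lk scale0r//.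
have [->|ik] := eqVneq i k.+1.
  by rewrite scale1r (big_pred1 k) ?L_orth ?eqxx ?scale1r// => l; rewrite eqSS.
rewrite scale0r mulmx_sumr big1// => l /eqP li; rewrite L_orth; case: eqVneq => [kl|_].
  by rewrite -li kl eqxx in ik.
by rewrite scale0r.
Qed.

Lemma resolution_mulr k i : resolution i *m L k = (i == k.+1)%:R *: resolution i.
Proof.
rewrite /resolution; case: eqVneq => [->|i0].
  rewrite scale0r mulmxBl mul1mx mulmx_suml (bigD1 k)//= L_orth eqxx scale1r.
  rewrite big1 ?addr0 ?subrr// => l /negPf lk; rewrite L_orth lk scale0r//.
have [->|ik] := eqVneq i k.+1.
  by rewrite scale1r (big_pred1 k) ?L_orth ?eqxx ?scale1r// => l; rewrite eqSS.
rewrite scale0r mulmx_suml big1// => l /eqP li; rewrite L_orth; case: eqVneq => [kl|_].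
  by rewrite -li kl eqxx in ik.
by rewrite scale0r.
Qed.

Lemma sum_resolution j : (j <= r)%N ->
  \sum_(1 <= i < j.+1) resolution i = \sum_(k < r | (k < j)%N) L k.
Proof.
move=> jr; rewrite big_add1 /=.
rewrite (eq_bigr (fun i => \sum_(k < r | k == i :> nat) L k)); last first.
  by move=> i _; rewrite /resolution /=; apply: eq_bigl => k; rewrite eqSS.
rewrite big_mkord (exchange_big_dep xpredT)//= [RHS]big_mkcond/=; apply: eq_bigr => k _.
case: ltnP => kj; last first.
  by rewrite big1// => i /eqP ik; have := ltn_ord i; rewrite -ik ltnNge kj.
by rewrite (big_pred1 (Ordinal kj)).
Qed.

Lemma sum_resolution0 : \sum_(0 <= i < r.+1) resolution i = 1%:M.
Proof.
rewrite big_ltn// sum_resolution// {1}/resolution eqxx.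
rewrite [X in _ + X](eq_bigl xpredT) ?subrK// => k; exact: ltn_ord.
Qed.

Lemma resolution0 : resolution 0 = 1%:M - \sum_(a < r) resolution a.+1.
Proof.
by rewrite -sum_resolution0 big_ltn// big_add1 big_mkord addrK.
Qed.

End PeirceIdempotents.

(** A Jordan triple of coordinates is realized by iota as a space of matrices,
    whose open unit ball is the domain. *)
Section MatrixFrame.
Variables (R : realType) (d n m r : nat).
Local Notation C := R[i].
Variables (iota : {linear 'rV[C]_d -> 'M[C]_(n, m)}) (tp : triple_product R d).
Variables (O : set 'rV[C]_d) (e : 'I_r -> 'rV[C]_d).
Hypothesis iota_inj : injective iota.
Hypothesis iota_tp : forall x y z, iota (tp x y z) = mx_triple (iota x) (iota y) (iota z).
Hypothesis domainE : forall z, O z <-> opnorm (iota z) < 1.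
Hypothesis he : is_frame tp e.

Lemma mx_tripleE (x y z : 'M[C]_(n, m)) :
  mx_triple x y z = 2^-1 *: (x *m adjmx y *m z + z *m adjmx y *m x).
Proof. by []. Qed.

Lemma mx_triple_diag (x y : 'M[C]_(n, m)) : mx_triple x y x = x *m adjmx y *m x.
Proof. by rewrite mx_tripleE scale_halfD. Qed.

Lemma frame_neq0 i : iota (e i) != 0.
Proof.
have [[e0 _ _] _] := (he.1 i, tt); apply: contra_neq e0 => h.
by apply: iota_inj; rewrite h linear0.
Qed.

Lemma frame_tripotent i : iota (e i) *m adjmx (iota (e i)) *m iota (e i) = iota (e i).
Proof. by have [_ h _] := he.1 i; rewrite -mx_triple_diag -iota_tp h. Qed.

Lemma frame_adj_tripotent i :
  adjmx (iota (e i)) *m iota (e i) *m adjmx (iota (e i)) = adjmx (iota (e i)).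
Proof. by rewrite -{4}(frame_tripotent i) !adjmxM adjmxK mulmxA. Qed.

(** With a, b the images of e_i, e_k, the identity a b* b + b b* a = 0 gives
    y b* b + y = 0 for y = b* a after multiplication by b*, where b* b is a
    projection; hence y = 0, and then a b* = 0. *)
Lemma frame_orthogonal i k : i != k ->
  iota (e i) *m adjmx (iota (e k)) = 0 /\ adjmx (iota (e i)) *m iota (e k) = 0.
Proof.
move=> ik; have h0 : tp (e i) (e k) (e k) = 0 by exact: he.2.
have ht := frame_tripotent k; have hat := frame_adj_tripotent k.
have := congr1 iota h0; rewrite linear0 iota_tp mx_tripleE => /eqP.
rewrite scaler_eq0 invr_eq0 pnatr_eq0 /= => /eqP.
set A := iota (e i) in ht hat *; set B := iota (e k) in ht hat * => h.
pose y := adjmx B *m A; pose Q := adjmx B *m B.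
have yQ : y *m Q = 0.
  have := congr1 (fun X => adjmx B *m X *m Q) h.
  rewrite mulmx0 mul0mx mulmxDr mulmxDl.
  have -> : adjmx B *m (A *m adjmx B *m B) *m Q = y *m Q.
    by rewrite /y /Q -!mulmxA (mulmxA B _ B) ht.
  have -> : adjmx B *m (B *m adjmx B *m A) *m Q = y *m Q.
    by rewrite /y !mulmxA hat.
  by move/eqP; rewrite -[y *m Q]scale1r -scalerDl scaler_eq0 -[1 + 1]/(2%:R) pnatr_eq0 /= => /eqP; rewrite scale1r.
have y0 : y = 0.
  have := congr1 (fun X => adjmx B *m X) h.
  rewrite mulmx0 mulmxDr !mulmxA hat -(mulmxA (adjmx B *m A)).
  by rewrite -/y -/Q yQ add0r.
split; last by rewrite -(adjmxK B) -adjmxM -/y y0 adjmx0.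
rewrite -hat !mulmxA; move: h; rewrite -(mulmxA B) -/y y0 mulmx0 addr0 => ->.
by rewrite mul0mx.
Qed.

Lemma matrix_absorbing z : exists2 eps : R, 0 < eps &
  forall t, 0 <= t <= eps -> O (t%:C *: z).
Proof.
have [L L0 hL] := mulmx_bounded (iota z).
exists (L + 1)^-1; first by rewrite invr_gt0; lra.
move=> t /andP[t0 t1]; apply/domainE; rewrite linearZ /=; apply/opnorm_lt1P.
have tL : t * (L + 1) <= 1 by rewrite -ler_pdivlMr ?div1r//; lra.
exists (t * t * L); first by apply/andP; split; [by rewrite !mulr_ge0|nra].
move=> w; rewrite -scalemxAl sqnormZ normsq_real expr2 -[_ * L * _]mulrA.
by rewrite ler_wpM2l ?mulr_ge0.
Qed.

Lemma contraction_domain z (t : R) : contraction (iota z) -> 0 <= t < 1 -> O (t%:C *: z).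
Proof.
move=> hz /andP[t0 t1]; apply/domainE; rewrite linearZ /=; apply/opnorm_lt1P.
exists (t * t); first by apply/andP; split; [by rewrite !mulr_ge0|nra].
move=> w; rewrite -scalemxAl sqnormZ normsq_real expr2.
by rewrite ler_wpM2l ?mulr_ge0.
Qed.

(** The closure of the unit ball, seen along rays. *)
Lemma domain_contraction z :
  (forall t : R, 0 <= t < 1 -> O (t%:C *: z)) -> contraction (iota z).
Proof.
move=> h w; rewrite leNgt; apply/negP => lt1.
set a := sqnorm (iota z *m w) in lt1 *; set b := sqnorm w in lt1 *.
have b0 : 0 <= b by exact: sqnorm_ge0.
have a0 : 0 < a by exact: le_lt_trans lt1.
pose rho := b / a.
have bE : b = rho * a by rewrite /rho divfK// gt_eqF.
have rho0 : 0 <= rho by rewrite divr_ge0// ltW.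
have rho1 : rho < 1 by rewrite /rho ltr_pdivrMr// mul1r.
pose t := (1 + rho) / 2.
have t01 : 0 <= t < 1 by apply/andP; rewrite /t; split; lra.
have /domainE/opnorm_contraction/(_ w) := h t t01.
rewrite linearZ /= -scalemxAl sqnormZ normsq_real -/a -/b bE.
rewrite ler_pM2r// leNgt => /negP; apply.
have : 0 < (1 - rho) ^+ 2 by rewrite exprn_gt0// subr_gt0.
by rewrite /t; lra.
Qed.

Lemma frame_contraction i : contraction (iota (e i)).
Proof. exact/partial_isometry_contraction/frame_tripotent. Qed.

Lemma frame_pm_contraction i l (s : C) : s = 1 \/ s = -1 -> i != l ->
  contraction (iota (e i) + s *: iota (e l)).
Proof.
move=> hs il; apply: partial_isometry_contraction.
have [h1 h2] := frame_orthogonal il.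
have li : l != i by rewrite eq_sym.
have [h3 h4] := frame_orthogonal li.
have ss : Num.conj s = s by case: hs => ->; rewrite ?rmorphN rmorph1.
have s3 : s * (s * s) = s by case: hs => ->; ring.
have ti := frame_tripotent i; have tl := frame_tripotent l.
move: h1 h2 h3 h4 ti tl; move: (iota (e i)) (iota (e l)) => A B h1 h2 h3 h4 tA tB.
have e1 : (A + s *: B) *m adjmx (A + s *: B) = A *m adjmx A + (s * s) *: (B *m adjmx B).
  rewrite adjmxD adjmxZ ss mulmxDl !mulmxDr -!scalemxAl -!scalemxAr.
  by rewrite h1 h3 scalerA !scaler0 addr0 add0r.
rewrite e1 mulmxDl !mulmxDr -!scalemxAl -!scalemxAr tA tB.
by rewrite -!(mulmxA _ (adjmx _)) h2 h4 !mulmx0 !scaler0 addr0 add0r scalerA mulrC s3.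
Qed.

(** A linear automorphism of the domain maps the frame to partial isometries
    with orthogonal initial spaces and orthogonal ranges: the polydisc spanned
    by the frame stays in the closed unit ball, and its faces stay on the
    boundary. *)
Lemma frame_image k : groupK O k ->
  exists (Xi : 'M[C]_(m, r)) (H : 'M[C]_(n, r)),
    [/\ adjmx Xi *m Xi = 1%:M, adjmx H *m H = 1%:M,
     forall l, iota (e l *m k) *m Xi = H *m delta_mx l l
     & forall l, adjmx (iota (e l *m k)) *m H = Xi *m delta_mx l l].
Proof.
move=> hk; have Ok := groupK_domain matrix_absorbing hk.
have push z : contraction (iota z) -> contraction (iota (z *m k)).
  move=> hz; apply: domain_contraction => t ht.
  by rewrite scalemxAl -Ok; exact: contraction_domain.
apply: rigid_contractions.
- by move=> i; apply: push; exact: frame_contraction.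
- move=> i l il; rewrite -linearD -linearB -mulmxDl -mulmxBl; split; apply: push.
    by rewrite linearD -[iota (e l)]scale1r; apply: frame_pm_contraction; [left|].
  by rewrite linearB -scaleN1r; apply: frame_pm_contraction; [right|].
- move=> i /domainE/(Ok _).2/domainE; apply: partial_isometry_opnorm.
    exact: frame_tripotent.
  exact: frame_neq0.
Qed.



Local Notation L k := (iota (e k) *m adjmx (iota (e k))).
Local Notation Q k := (adjmx (iota (e k)) *m iota (e k)).

Lemma left_idempotents i k : L i *m L k = (i == k)%:R *: L i.
Proof.
case: eqVneq => [->|ik]; first by rewrite scale1r mulmxA frame_tripotent.
by rewrite mulmxA -(mulmxA _ _ (iota (e k))) (frame_orthogonal ik).2 mulmx0 mul0mx scale0r.
Qed.

Lemma right_idempotents i k : Q i *m Q k = (i == k)%:R *: Q i.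
Proof.
case: eqVneq => [->|ik]; first by rewrite scale1r mulmxA frame_adj_tripotent.
by rewrite mulmxA -(mulmxA _ (iota (e i))) (frame_orthogonal ik).1 mulmx0 mul0mx scale0r.
Qed.

Local Notation in_range A := (exists w, iota w = A).

Lemma range_lin c A B : in_range A -> in_range B -> in_range (c *: A + B).
Proof. by move=> [x <-] [y <-]; exists (c *: x + y); rewrite linearP. Qed.

Lemma range0 : in_range 0.
Proof. by exists 0; rewrite linear0. Qed.

Lemma rangeZ c A : in_range A -> in_range (c *: A).
Proof. by move=> h; rewrite -[c *: A]addr0; apply: range_lin => //; exact: range0. Qed.

Lemma rangeD A B : in_range A -> in_range B -> in_range (A + B).
Proof. by move=> hA; rewrite -[A]scale1r; exact: range_lin. Qed.

Lemma rangeB A B : in_range A -> in_range B -> in_range (A - B).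
Proof. by move=> hA hB; rewrite addrC -scaleN1r; exact: range_lin. Qed.

Lemma range_sum I (s : seq I) (P : pred I) (F : I -> 'M[C]_(n, m)) :
  (forall i, P i -> in_range (F i)) -> in_range (\sum_(i <- s | P i) F i).
Proof.
move=> h; elim/big_rec: _ => [|i B Pi hB]; first exact: range0.
by apply: rangeD => //; exact: h.
Qed.

(** The range of iota contains the blocks of its elements, symmetrized,
    because it is stable under the operators A |-> L_k A + A Q_k. *)
Lemma range_box A k : in_range A -> in_range (L k *m A + A *m Q k).
Proof.
move=> [w <-]; exists (2 *: tp (e k) (e k) w).
by rewrite linearZ iota_tp mx_tripleE /= scalerA divff ?pnatr_eq0// scale1r mulmxA.
Qed.

Let peirce_piece (A : 'M[C]_(n, m)) i k :=
  resolution (fun k => L k) i *m A *m resolution (fun k => Q k) k.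

Local Notation sym_piece A i k := (peirce_piece A i k + peirce_piece A k i).

Lemma range_sandwich A l k : in_range A -> in_range (L k *m A *m Q l + L l *m A *m Q k).
Proof.
move=> hA; have hk := range_box k hA; have := range_box l hk.
have := left_idempotents l k; have := right_idempotents k l.
have [->|lk] := eqVneq l k.
  rewrite !scale1r; move: (L k) (Q k) hk => Lk Qk hk hQ hL.
  rewrite mulmxDr mulmxDl !mulmxA hL -[A *m Qk *m Qk]mulmxA hQ => h.
  have [w wE] := rangeB h hk; exists w; rewrite wE ?scale1r.
  by rewrite [X in _ + X - _]addrC addrACA [LHS]addrAC subrr add0r.
move: (L l) (L k) (Q l) (Q k) hk => Ll Lk Ql Qk hk hQ hL.
rewrite mulmxDr mulmxDl !mulmxA hL -[A *m Qk *m Ql]mulmxA hQ.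
by rewrite !scale0r mul0mx mulmx0 add0r addr0 addrC.
Qed.

Lemma mulmx_sum_sum (I J : finType) (P : pred I) (P' : pred J)
    (X : I -> 'M[C]_n) (A : 'M[C]_(n, m)) (Y : J -> 'M[C]_m) :
  (\sum_(i | P i) X i) *m A *m (\sum_(j | P' j) Y j) =
  \sum_(i | P i) \sum_(j | P' j) X i *m A *m Y j.
Proof.
by rewrite !mulmx_suml; apply: eq_bigr => i _; rewrite mulmx_sumr.
Qed.

Lemma peirce_piece0 A X Y :
  resolution (fun k => L k) 0 *m A *m Y + X *m A *m resolution (fun k => Q k) 0 =
  (X *m A + A *m Y) -
  \sum_(a < r) (resolution (fun k => L k) a.+1 *m A *m Y +
                X *m A *m resolution (fun k => Q k) a.+1).
Proof.
rewrite (resolution0 (fun k => L k)) (resolution0 (fun k => Q k)).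
rewrite !mulmxBl mulmxBr mul1mx mulmx1 big_split /= -!mulmx_suml -mulmx_sumr.
by rewrite [LHS]addrACA -opprD; congr (_ - _); exact: addrC.
Qed.

Lemma range_peirce A : in_range A -> forall i k, in_range (sym_piece A i k).
Proof.
move=> hA.
have box i : in_range (resolution (fun k => L k) i *m A + A *m resolution (fun k => Q k) i).
  have pos a : in_range (resolution (fun k => L k) a.+1 *m A +
                         A *m resolution (fun k => Q k) a.+1).
    rewrite /resolution /= mulmx_suml mulmx_sumr -big_split; apply: range_sum => k _.
    exact: range_box.
  case: i => // ; rewrite (resolution0 (fun k => L k)) (resolution0 (fun k => Q k)).
  rewrite mulmxBl mulmxBr mul1mx mulmx1 mulmx_suml mulmx_sumr addrACA -opprD -big_split.
  apply: rangeB; first exact: rangeD.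
  by apply: range_sum => k _; exact: pos.
have pos i k : in_range (sym_piece A i.+1 k.+1).
  rewrite /peirce_piece /resolution /= !mulmx_sum_sum.
  rewrite [X in _ + X]exchange_big/= -big_split/=; apply: range_sum => a _.
  rewrite -big_split/=; apply: range_sum => b _.
  exact: range_sandwich.
have zero_pos k : in_range (sym_piece A 0 k.+1).
  rewrite /peirce_piece peirce_piece0; apply: rangeB => //.
  by apply: range_sum => a _; exact: pos.
case=> [|i] [|k]; [|exact: zero_pos| |exact: pos].
  rewrite /peirce_piece peirce_piece0; apply: rangeB => //.
  by apply: range_sum => a _; have [w wE] := zero_pos a; exists w; rewrite wE addrC.
by have [w wE] := zero_pos i; exists w; rewrite wE addrC.
Qed.

(** The projection to the Peirce spaces of indices at most j is the
    compression by the range projections of e_1 + ... + e_j. *)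
Lemma peirce_projP j z x : (j <= r)%N ->
  iota x = (\sum_(k < r | (k < j)%N) L k) *m iota z *m (\sum_(k < r | (k < j)%N) Q k) ->
  peirce_proj tp e j z x.
Proof.
move=> jr xE; pose A := iota z.
pose T i k := if i == k then peirce_piece A k k else sym_piece A i k.
have /choice[zz hzz] : forall p : nat * nat, exists w, iota w = T p.1 p.2.
  move=> [i k]; rewrite /T /=; have rA := range_peirce (ex_intro _ z erefl : in_range A).
  case: eqVneq => // _; have := rangeZ (2^-1) (rA k k).
  by rewrite scale_halfD.
exists (fun i k => zz (i, k)); split.
- move=> i k _ l; apply: iota_inj; rewrite linearZ iota_tp mx_tripleE /= !hzz /=.
  have resl i' : L l *m resolution (fun k => L k) i' =
      (i' == l.+1)%:R *: resolution (fun k => L k) i'.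
    exact: (resolution_mull left_idempotents).
  have resr i' : resolution (fun k => Q k) i' *m Q l =
      (i' == l.+1)%:R *: resolution (fun k => Q k) i'.
    exact: (resolution_mulr right_idempotents).
  have key i' k' : L l *m peirce_piece A i' k' + peirce_piece A i' k' *m Q l =
      ((i' == l.+1) + (k' == l.+1))%:R *: peirce_piece A i' k'.
    rewrite /peirce_piece -[_ *m Q l]mulmxA resr [L l *m (_ *m _)]mulmxA [L l *m (_ *m _)]mulmxA resl.
    by rewrite -!scalemxAl -scalemxAr natrD scalerDl.
  rewrite -[_ *m adjmx _ *m iota (e l)]mulmxA /T; case: eqVneq => [->|ik].
    by rewrite key scalerA mulrC.
  rewrite mulmxDl mulmxDr [X in _ *: X]addrACA.
  by rewrite !key (addnC (k == _)) -scalerDr scalerA mulrC.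
- apply: iota_inj; rewrite linear_sum.
  under eq_bigr do (rewrite linear_sum /=; under eq_bigr do rewrite hzz /=).
  rewrite /T big_triangle_sym//; rewrite /peirce_piece.
  under eq_bigr do rewrite -mulmx_sumr.
  rewrite -mulmx_suml -mulmx_suml !(sum_resolution0 (fun k => L k)).
  by rewrite (sum_resolution0 (fun k => Q k)) mul1mx mulmx1.
- apply: iota_inj; rewrite linear_sum.
  under eq_bigr do (rewrite linear_sum /=; under eq_bigr do rewrite hzz /=).
  rewrite /T big_triangle_sym//; rewrite /peirce_piece.
  under eq_bigr do rewrite -mulmx_sumr.
  rewrite -mulmx_suml -mulmx_suml (sum_resolution (fun k => L k) jr).
  by rewrite (sum_resolution (fun k => Q k) jr).
Qed.

Lemma compression_range j z : (j <= r)%N ->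
  in_range ((\sum_(k < r | (k < j)%N) L k) *m iota z *m (\sum_(k < r | (k < j)%N) Q k)).
Proof.
move=> jr; rewrite -(sum_resolution (fun k => L k) jr) -(sum_resolution (fun k => Q k) jr).
rewrite mulmx_suml mulmx_suml.
under eq_bigr do rewrite mulmx_sumr.
rewrite -(@big_triangle_sym _ (peirce_piece (iota z)))//.
apply: range_sum => k _; apply: range_sum => i _.
have rA := range_peirce (ex_intro _ z erefl : in_range (iota z)).
case: eqVneq => // _; have := rangeZ (2^-1) (rA k k).
by rewrite scale_halfD.
Qed.

(** * Jordan minors as determinants *)

Section MinorValue.
Variables (j : 'I_r) (D : mpoly.mpoly d C) (J : nat) (F : 'M[C]_(n, J)) (G : 'M[C]_(m, J)).
Hypothesis hD : is_jordan_minor tp e j.+1 D.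
Hypothesis F1 : adjmx F *m F = 1%:M.
Hypothesis G1 : adjmx G *m G = 1%:M.
Hypothesis FG : \sum_(i < r | (i < j.+1)%N) iota (e i) = F *m adjmx G.

Lemma frame_sum_left : \sum_(k < r | (k < j.+1)%N) L k = F *m adjmx F.
Proof.
transitivity ((F *m adjmx G) *m adjmx (F *m adjmx G)); last first.
  by rewrite adjmxM adjmxK mulmxA -(mulmxA F) G1 mulmx1.
rewrite -FG adjmx_sum mulmx_suml; apply: eq_bigr => i hi.
rewrite mulmx_sumr (bigD1 i)//= big1 ?addr0// => k /andP[_ ki].
by rewrite (frame_orthogonal _).1// eq_sym.
Qed.

Lemma frame_sum_right : \sum_(k < r | (k < j.+1)%N) Q k = G *m adjmx G.
Proof.
transitivity (adjmx (F *m adjmx G) *m (F *m adjmx G)); last first.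
  by rewrite adjmxM adjmxK mulmxA -(mulmxA G) F1 mulmx1.
rewrite -FG adjmx_sum mulmx_suml; apply: eq_bigr => i hi.
rewrite mulmx_sumr (bigD1 i)//= big1 ?addr0// => k /andP[_ ki].
by rewrite (frame_orthogonal _).2// eq_sym.
Qed.

(** In the coordinates given by F and G, the Jordan powers of the Peirce
    projection of z are powers of the compression of z. *)
Lemma jordan_minor_value z p X : X = adjmx F *m iota z *m G ->
  (forall c : 'I_j.+1 -> C, \sum_k c k *: X ^+ k = 0 -> forall k, c k = 0) ->
  p \is monic -> size p = j.+2 -> \sum_(k < j.+2) p`_k *: X ^+ k = 0 ->
  peval D z = (-1) ^+ j.+1 * p`_0.
Proof.
move=> XE indep pm sp pX; have [[_ detD] proj] := hD.
have jr : (j.+1 <= r)%N by exact: ltn_ord.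
have [x xE] := compression_range z jr.
have xproj := peirce_projP jr xE.
have iotax : iota x = F *m X *m adjmx G.
  by rewrite xE frame_sum_left frame_sum_right XE !mulmxA.
have xx : peirce_proj tp e j.+1 x x.
  apply: peirce_projP => //; rewrite iotax frame_sum_left frame_sum_right.
  by rewrite !mulmxA -(mulmxA F (adjmx F)) F1 mulmx1 -(mulmxA _ (adjmx G)) G1 mulmx1.
pose u := \sum_(i < r | (i < j.+1)%N) e i.
have powE k : iota (jordan_pow tp u x k) = F *m X ^+ k *m adjmx G.
  elim: k => [|k IH]; first by rewrite /= linear_sum FG expr0 mulmx1.
  rewrite /= iota_tp mx_tripleE -/(jordan_pow tp u x k) IH iotax linear_sum FG.
  have prod A B : F *m A *m adjmx G *m adjmx (F *m adjmx G) *m (F *m B *m adjmx G) =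
      F *m (A *m B) *m adjmx G.
    rewrite adjmxM adjmxK !mulmxA -(mulmxA _ _ G) G1 mulmx1.
    by rewrite -(mulmxA _ _ F) F1 mulmx1.
  have XS : X *m X ^+ k = X ^+ k.+1 by rewrite exprS.
  have SX : X ^+ k *m X = X ^+ k.+1 by rewrite exprSr.
  by rewrite !prod XS SX scale_halfD.
have sumE K (c : 'I_K -> C) : iota (\sum_k c k *: jordan_pow tp u x k) =
    F *m (\sum_k c k *: X ^+ k) *m adjmx G.
  rewrite linear_sum mulmx_sumr mulmx_suml; apply: eq_bigr => k _.
  by rewrite linearZ /= powE -scalemxAr -scalemxAl.
rewrite (proj _ _ xproj); apply: detD => //; first by exists x.
- pose s := map_tuple (jordan_pow tp u x) (iota_tuple j.+1 0).
  have : free s; last by [].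
  apply/freeP => c hc; apply: indep.
  have : F *m (\sum_k c k *: X ^+ k) *m adjmx G = 0.
    rewrite -sumE (_ : \sum_k _ = 0) ?linear0// -[RHS]hc; apply: eq_bigr => i _.
    by rewrite (nth_map 0%N) ?size_iota// nth_iota.
  move=> h; rewrite -[LHS]mul1mx -[LHS]mulmx1 -{1}F1 -G1.
  by rewrite -!mulmxA (mulmxA F) (mulmxA _ (adjmx G)) h mul0mx mulmx0.
- by apply: iota_inj; rewrite sumE pX mulmx0 mul0mx linear0.
Qed.

End MinorValue.


Lemma char_poly_annihilates K (X : 'M[C]_K.+1) :
  \sum_(k < K.+2) (char_poly X)`_k *: X ^+ k = 0.
Proof.
have := Cayley_Hamilton X; rewrite /horner_mx /horner_morph.
rewrite (horner_coef_wide _ (n := K.+2)); last first.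
  by rewrite (leq_trans (size_poly _ _))// size_char_poly.
move=> h; rewrite -[RHS]h; apply: eq_bigr => k _.
by rewrite coef_map /= -mul_scalar_mx.
Qed.

Lemma compression_polynomial K (F : 'M[C]_(n, K)) (G : 'M[C]_(m, K)) z0 z a b :
  polynomial_function (fun t => (adjmx F *m iota (z0 + t *: (z - z0)) *m G) a b).
Proof.
have [q hq] := polynomial_function_segment (adjmx F *m iota z0 *m G)
  (adjmx F *m iota (z - z0) *m G) a b.
exists q => t; rewrite -hq linearD linearZ /= mulmxDr mulmxDl.
by rewrite -scalemxAr -scalemxAl.
Qed.

Section FullRank.
Variables (j : 'I_r) (D : mpoly.mpoly d C) (F : 'M[C]_(n, j.+1)) (G : 'M[C]_(m, j.+1)).
Hypothesis hD : is_jordan_minor tp e j.+1 D.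
Hypothesis F1 : adjmx F *m F = 1%:M.
Hypothesis G1 : adjmx G *m G = 1%:M.
Hypothesis FG : \sum_(i < r | (i < j.+1)%N) iota (e i) = F *m adjmx G.
Variable z0 : 'rV[C]_d.
Hypothesis z0E : adjmx F *m iota z0 *m G = diag_mx (\row_i (i.+1)%:R).

(** The Jordan minor is the determinant of the compression: by
    Cayley-Hamilton this holds whenever the vector (1, ..., 1) is cyclic for
    the compression, and on the segment from z0 to z this happens outside a
    finite set. *)
Lemma jordan_minor_det z : peval D z = \det (adjmx F *m iota z *m G).
Proof.
pose X t := adjmx F *m iota (z0 + t *: (z - z0)) *m G.
have Xpoly a b : polynomial_function (fun t => X t a b) by exact: compression_polynomial.
pose w : 'cV[C]_j.+1 := const_mx 1.
have Wpoly := polynomial_function_krylov (N := j.+1) w Xpoly.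
have W0 : \det (krylov j.+1 (X 0) w) != 0.
  by rewrite /X scale0r addr0 z0E; exact: det_krylov_diag.
pose g t := peval D (z0 + t *: (z - z0)) - \det (X t).
have gpoly : polynomial_function g.
  apply: polynomial_functionB; first exact: polynomial_function_peval.
  exact: polynomial_function_det.
suff /(_ 1) : forall t, g t = 0.
  by rewrite /g /X scale1r (addrC z0) subrK => /eqP; rewrite subr_eq0 => /eqP.
apply: (polynomial_function_density (polynomial_function_det Wpoly) gpoly W0) => t Wt.
apply/eqP; rewrite subr_eq0; apply/eqP.
rewrite (jordan_minor_value hD F1 G1 FG (erefl (X t)) _ (char_poly_monic _)
  (size_char_poly _) (char_poly_annihilates _)).
  by rewrite char_poly_det mulrA -exprD addnn -signr_odd odd_double mul1r.
move=> c; apply: (@krylov_independent _ _ _ _ w) => v Wv.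
have Wu : krylov j.+1 (X t) w \in unitmx by rewrite unitmxE unitfE.
by rewrite -[v]mul1mx -(mulVmx Wu) -mulmxA Wv mulmx0.
Qed.

End FullRank.

End MatrixFrame.

(** * Types I and II: as many frame elements as rows *)

Section Selection.
Variables (R : realType) (r : nat) (j : 'I_r).
Local Notation C := R[i].

Definition selection : 'M[C]_(r, j.+1) := \matrix_(a, b) (a == b :> nat)%:R.

Lemma adjmx_selection : adjmx selection = selection^T.
Proof. by apply/matrixP => a b; rewrite !mxE conjC_nat. Qed.

Lemma selection_diag (x : nat -> C) :
  selection^T *m diag_mx (\row_a x a) *m selection = diag_mx (\row_b x b).
Proof.
apply/matrixP => b c; rewrite -mulmxA mul_diag_mx !mxE.
have hb : (b < r)%N := leq_trans (ltn_ord b) (ltn_ord j).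
rewrite (bigD1 (Ordinal hb))//= !mxE eqxx mul1r big1 ?addr0 => [|a ab].
  by rewrite -val_eqE /= mulr_natr.
by rewrite !mxE; case: eqP => [h|_]; rewrite ?mul0r//; case/eqP: ab; apply: val_inj.
Qed.

Lemma selection_orth : selection^T *m selection = 1%:M.
Proof.
have h := selection_diag (fun=> 1).
have E k : diag_mx (\row_(a < k) (1 : C)) = 1%:M.
  by apply/matrixP => a b; rewrite !mxE.
by move: h; rewrite !E mulmx1.
Qed.

Lemma selection_sum : \sum_(l < r | (l < j.+1)%N) delta_mx l l = selection *m selection^T.
Proof.
apply/matrixP => a b; rewrite summxE mxE.
case: (ltnP a j.+1) => aj.
  rewrite (bigD1 a)//= mxE eqxx (bigD1 (Ordinal aj))//= !mxE eqxx mul1r.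
  rewrite big1 ?addr0 => [|l /andP[_ la]]; last by rewrite mxE eq_sym (negPf la).
  rewrite big1 ?addr0 => [|l la]; first by rewrite -val_eqE eq_sym.
  by rewrite !mxE; case: eqP => [h|_]; rewrite ?mul0r//; case/eqP: la; apply: val_inj.
rewrite !big1// => [l|l lj]; rewrite !mxE; case: eqP => [h|_]; rewrite ?mul0r//.
  by have := ltn_ord l; rewrite -h ltnNge aj.
by move: lj; rewrite -h ltnNge aj.
Qed.

End Selection.

Section FullRankType.
Variables (R : realType) (d n m : nat).
Local Notation C := R[i].
Variables (iota : {linear 'rV[C]_d -> 'M[C]_(n, m)}) (tp : triple_product R d).
Variables (O : set 'rV[C]_d) (e : 'I_n -> 'rV[C]_d).
Hypothesis iota_inj : injective iota.
Hypothesis iota_tp : forall x y z, iota (tp x y z) = mx_triple (iota x) (iota y) (iota z).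
Hypothesis domainE : forall z, O z <-> opnorm (iota z) < 1.
Hypothesis he : is_frame tp e.
Variable Delta : 'I_n -> mpoly.mpoly d C.
Hypothesis hDelta : forall j : 'I_n, is_jordan_minor tp e j.+1 (Delta j).

(** As many orthonormal directions as rows: here the image of a frame element
    is determined by its action on them, hence of rank one. *)
Lemma full_rank_frame_image k : groupK O k ->
  exists (Xi : 'M[C]_(m, n)) (H : 'M[C]_n),
    [/\ adjmx Xi *m Xi = 1%:M, adjmx H *m H = 1%:M
     & forall l, iota (e l *m k) = H *m delta_mx l l *m adjmx Xi].
Proof.
move=> hk; have [Xi [H [Xi1 H1 _ h]]] := frame_image iota_inj iota_tp domainE he hk.
exists Xi, H; split=> // l.
have HH : H *m adjmx H = 1%:M by apply: mulmx1C.
rewrite -[LHS]mul1mx -HH -!mulmxA; congr (_ *m _).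
by rewrite -[iota _]adjmxK -adjmxM h adjmxM; congr (_ *m _); apply/matrixP => a b;
  rewrite !mxE conjC_nat andbC.
Qed.

Lemma full_rank_minor (j : 'I_n) : exists (F : 'M[C]_(n, j.+1)) (G : 'M[C]_(m, j.+1)),
  forall z, peval (Delta j) z = \det (adjmx F *m iota z *m G).
Proof.
have [Xi [H [Xi1 H1 eE]]] := full_rank_frame_image (groupK1 O).
have {}eE l : iota (e l) = H *m delta_mx l l *m adjmx Xi by rewrite -eE mulmx1.
pose s := selection R j.
have s1 : adjmx s *m s = 1%:M by rewrite adjmx_selection selection_orth.
have F1 : adjmx (H *m s) *m (H *m s) = 1%:M.
  by rewrite adjmxM mulmxA -(mulmxA (adjmx s)) H1 mulmx1.
have G1 : adjmx (Xi *m s) *m (Xi *m s) = 1%:M.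
  by rewrite adjmxM mulmxA -(mulmxA (adjmx s)) Xi1 mulmx1.
have FG : \sum_(i < n | (i < j.+1)%N) iota (e i) = (H *m s) *m adjmx (Xi *m s).
  rewrite adjmxM mulmxA -(mulmxA H) adjmx_selection -selection_sum.
  by rewrite mulmx_sumr mulmx_suml; apply: eq_bigr => i _; rewrite eE.
exists (H *m s), (Xi *m s) => z.
pose z0 := \sum_(i < n) (i.+1)%:R *: e i.
apply: (jordan_minor_det iota_inj iota_tp he (hDelta j) F1 G1 FG (z0 := z0)).
have -> : iota z0 = H *m diag_mx (\row_a (a.+1)%:R) *m adjmx Xi.
  rewrite linear_sum /=.
  rewrite diag_mx_sum_delta.
  rewrite mulmx_sumr mulmx_suml; apply: eq_bigr => i _.
  by rewrite linearZ /= eE mxE -scalemxAr -scalemxAl.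
rewrite adjmxM adjmx_selection !mulmxA -(mulmxA _ (adjmx H) H) H1 mulmx1.
rewrite -(mulmxA _ (adjmx Xi) Xi) Xi1 mulmx1.
exact: (selection_diag j (fun a => a.+1%:R)).
Qed.

Lemma full_rank_homogeneous (j : 'I_n) (t : C) z :
  peval (Delta j) (t *: z) = t ^+ j.+1 * peval (Delta j) z.
Proof.
have [F [G DE]] := full_rank_minor j.
by rewrite !DE linearZ /= -scalemxAr -scalemxAl detZ.
Qed.

Lemma full_rank_affine k : groupK O k -> forall (j : 'I_n) l z t,
  peval (Delta j) (z + t *: (e l *m k)) =
  peval (Delta j) z + t * (peval (Delta j) (z + e l *m k) - peval (Delta j) z).
Proof.
move=> hk j l z t; have [F [G DE]] := full_rank_minor j.
have [Xi [H [_ _ kE]]] := full_rank_frame_image hk.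
pose u := adjmx F *m H *m delta_mx l (0 : 'I_1).
pose v := delta_mx (0 : 'I_1) l *m adjmx Xi *m G.
have E s : adjmx F *m iota (z + s *: (e l *m k)) *m G =
    adjmx F *m iota z *m G + s *: (u *m v).
  rewrite linearD linearZ /= mulmxDr mulmxDl; congr (_ + _).
  rewrite -scalemxAr -scalemxAl kE /u /v; congr (_ *: _).
  by rewrite !mulmxA -(mulmxA _ (delta_mx l 0)) mul_delta_mx.
have E1 : adjmx F *m iota (z + e l *m k) *m G = adjmx F *m iota z *m G + u *m v.
  by have := E 1; rewrite !scale1r.
by rewrite !DE E E1 det_add_rank1.
Qed.

End FullRankType.

(** * Operators that are self-adjoint for a symplectic form *)

Lemma col_mulmx (R : pzSemiRingType) m n p (A : 'M[R]_(m, n)) (B : 'M[R]_(n, p)) k :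
  col k (A *m B) = A *m col k B.
Proof. by rewrite !colE mulmxA. Qed.

Lemma col_ext (T : Type) m n (A B : 'M[T]_(m, n)) :
  (forall k, col k A = col k B) -> A = B.
Proof.
by move=> h; apply/matrixP => i k; have /matrixP/(_ i 0) := h k; rewrite !mxE.
Qed.

Section SkewKrylov.
Variables (K : numFieldType) (N' : nat).
Local Notation N := N'.+1.

Definition symplectic_mx : 'M[K]_(N + N) := block_mx 0 1%:M (- 1%:M) 0.
Local Notation T := symplectic_mx.

Lemma symplectic_mx_sqr : T *m T = - 1%:M.
Proof.
rewrite mulmx_block !mul0mx !mulmx0 !mulmxN !mulNmx !mulmx1 !add0r !addr0.
by rewrite (scalar_mx_block N N (1 : K)) opp_block_mx !oppr0.
Qed.

Lemma tr_symplectic_mx : T^T = - T.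
Proof. by rewrite tr_block_mx opp_block_mx !trmx0 opprK oppr0 (linearN (@trmx K N N)) /= !trmx1. Qed.

Lemma skew_form0 M (A : 'M[K]_M) (w : 'cV_M) : A^T = - A -> w^T *m A *m w = 0.
Proof.
move=> hA; set x := w^T *m A *m w.
have xx : x^T = - x by rewrite /x !trmx_mul trmxK hA mulNmx mulmxN mulmxA.
apply/matrixP => i j; rewrite !ord1 [RHS]mxE.
have /matrixP/(_ 0 0) := xx; rewrite !mxE => /eqP.
by rewrite -subr_eq0 opprK -mulr2n mulrn_eq0 /= => /eqP.
Qed.

Variables (Y X : 'M[K]_(N + N)).
Hypothesis Y_skew : Y^T = - Y.
Hypothesis XE : X = T *m Y.

Lemma symplectic_adjoint : X^T *m T = T *m X.
Proof.
rewrite XE trmx_mul Y_skew tr_symplectic_mx mulNmx mulmxN opprK -mulmxA.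
by rewrite symplectic_mx_sqr mulmxA symplectic_mx_sqr mulmxN mulmx1 mulNmx mul1mx.
Qed.

Lemma symplectic_adjointX k : (X ^+ k)^T *m T = T *m X ^+ k.
Proof.
elim: k => [|k IH]; first by rewrite expr0 trmx1 mul1mx mulmx1.
rewrite exprS -[_ * _]/(_ *m _) trmx_mul -mulmxA symplectic_adjoint mulmxA IH.
by rewrite -mulmxA; congr (_ *m _); rewrite -[LHS]/(X ^+ k * X) -exprSr exprS.
Qed.

Lemma symplectic_skew (Z : 'M[K]_(N + N)) : Z^T *m T = T *m Z -> (T *m Z)^T = - (T *m Z).
Proof. by move=> h; rewrite trmx_mul tr_symplectic_mx mulmxN h. Qed.

Local Notation Kr w := (krylov N X w).

Lemma tr_krylov_mul w P (B : 'M[K]_(N + N, P)) k :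
  row k ((Kr w)^T *m B) = w^T *m (X ^+ k)^T *m B.
Proof. by rewrite row_mul -tr_col col_krylov trmx_mul. Qed.

Lemma krylov_entry w (z : 'rV[K]_(N + N)) l :
  (z *m Kr w) 0 l = (z *m (X ^+ l *m w)) 0 0.
Proof. by rewrite -col_krylov -col_mulmx [RHS]mxE. Qed.

(** The form of X^k w and X^l w is the value at w of the form of T X^(k+l),
    which is skew. *)
Lemma krylov_isotropic w : (Kr w)^T *m T *m Kr w = 0.
Proof.
apply/row_matrixP => k; rewrite -mulmxA tr_krylov_mul row0.
apply/rowP => l; rewrite [RHS]mxE.
have -> : (w^T *m (X ^+ k)^T *m (T *m Kr w)) 0 l =
    (w^T *m (T *m X ^+ (k + l)) *m w) 0 0.
  rewrite mulmxA krylov_entry -(mulmxA w^T) symplectic_adjointX exprD.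
  by rewrite -[X ^+ k * _]/(X ^+ k *m _) !mulmxA.
by rewrite (skew_form0 _ (symplectic_skew (symplectic_adjointX _))) mxE.
Qed.

Variables w1 w2 : 'cV[K]_(N + N).
Local Notation W1 := (Kr w1).
Local Notation W2 := (Kr w2).
Local Notation S := (row_mx W1 W2).
Hypothesis S_unit : S \in unitmx.

Local Notation B := (W2^T *m T *m W1).

Let gram : S^T *m T *m S = block_mx 0 (W1^T *m T *m W2) B 0.
Proof.
by rewrite tr_row_mx mul_col_mx mul_col_row !krylov_isotropic.
Qed.

Let gram_unit : S^T *m T *m S \in unitmx.
Proof.
rewrite !unitmx_mul unitmx_tr S_unit andbT /=.
by have := mulmx1_unit (_ : T *m - T = 1%:M); case=> //;
  rewrite mulmxN symplectic_mx_sqr opprK.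
Qed.

(** The Krylov space of w1 is a maximal isotropic subspace, hence invariant. *)
Lemma krylov_invariant : exists a : 'cV[K]_N, X ^+ N *m w1 = W1 *m a.
Proof.
pose c := invmx S *m (X ^+ N *m w1).
have yE : X ^+ N *m w1 = W1 *m usubmx c + W2 *m dsubmx c.
  by rewrite -mul_row_col vsubmxK /c mulKVmx.
have y0 : (X ^+ N *m w1)^T *m T *m W1 = 0.
  apply/rowP => l; rewrite [RHS]mxE.
  have -> : ((X ^+ N *m w1)^T *m T *m W1) 0 l = (w1^T *m (T *m X ^+ (N + l)) *m w1) 0 0.
    rewrite krylov_entry trmx_mul -(mulmxA w1^T (X ^+ N)^T) symplectic_adjointX exprD.
    by rewrite -[X ^+ N * _]/(X ^+ N *m _) !mulmxA.
  by rewrite (skew_form0 _ (symplectic_skew (symplectic_adjointX _))) mxE.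
have b0 : (dsubmx c)^T *m B = 0.
  move: y0; rewrite yE linearD /= !trmx_mul !mulmxDl -!mulmxA.
  by rewrite (mulmxA W1^T) krylov_isotropic mulmx0 add0r.
exists (usubmx c); rewrite yE.
suff -> : dsubmx c = 0 by rewrite mulmx0 addr0.
apply: trmx_inj; rewrite trmx0.
have : row_mx (0 : 'rV[K]_N) ((dsubmx c)^T) *m (S^T *m T *m S) = 0.
  by rewrite gram mul_row_block !mul0mx mulmx0 add0r addr0 b0 row_mx0.
move=> /(congr1 (fun M => M *m invmx (S^T *m T *m S))).
rewrite mul0mx mulmxK// => /eqP; rewrite row_mx_eq0 => /andP[_ /eqP //].
Qed.

(** The monic polynomial p of degree N that annihilates w1 also annihilates w2,
    since p(X) w2 is orthogonal to both Krylov spaces; in the basis S the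
    operator X consists of two copies of the companion matrix of p. *)
Lemma symplectic_min_poly : exists p : {poly K},
  [/\ p \is monic, size p = N.+1, \sum_(k < N.+1) p`_k *: X ^+ k = 0
    & p`_0 ^+ 2 = \det X].
Proof.
have [a aE] := krylov_invariant.
pose q := \poly_(k < N) a (inord k) 0.
pose p := 'X^N - q.
have qN : (size q <= N)%N by exact: size_poly.
have pc k : (k < N)%N -> p`_k = - a (inord k) 0.
  by move=> kN; rewrite coefB coefXn coef_poly kN ltn_eqF// sub0r.
have pN : p`_N = 1 by rewrite coefB coefXn coef_poly ltnn eqxx subr0.
pose P := \sum_(k < N.+1) p`_k *: X ^+ k.
have PE : P = X ^+ N - \sum_(k < N) a k 0 *: X ^+ k.
  rewrite /P big_ord_recr /= pN scale1r addrC -sumrN; congr (_ + _).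
  by apply: eq_bigr => k _; rewrite pc// scaleNr inord_val.
have PT : P^T *m T = T *m P.
  rewrite /P linear_sum mulmx_suml mulmx_sumr; apply: eq_bigr => k _.
  by rewrite linearZ /= -scalemxAl symplectic_adjointX -scalemxAr.
have PX k : P *m X ^+ k = X ^+ k *m P.
  rewrite /P mulmx_suml mulmx_sumr; apply: eq_bigr => l _.
  rewrite -scalemxAl -scalemxAr; congr (_ *: _).
  by rewrite -[LHS]/(X ^+ l * X ^+ k) -[RHS]/(X ^+ k * X ^+ l) -!exprD addnC.
have Pw1 : P *m w1 = 0.
  rewrite PE mulmxBl aE; apply/eqP; rewrite subr_eq0; apply/eqP/matrixP => b c.
  rewrite ord1 mulmx_suml summxE mxE; apply: eq_bigr => k _.
  by rewrite -scalemxAl [RHS]mxE mxE mulrC.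
have Pw2 : P *m w2 = 0.
  have : S^T *m (T *m (P *m w2)) = 0.
    rewrite tr_row_mx mul_col_mx -[RHS]col_mx0; congr col_mx.
      apply/row_matrixP => k; rewrite tr_krylov_mul row0 -(mulmxA w1^T).
      rewrite [_ *m (T *m _)]mulmxA symplectic_adjointX -mulmxA (mulmxA (X ^+ k)) -PX.
      by rewrite -(mulmxA P) (mulmxA T) -PT -mulmxA mulmxA -trmx_mul Pw1 trmx0 mul0mx.
    apply/row_matrixP => k; rewrite tr_krylov_mul row0 -(mulmxA w2^T).
    rewrite [_ *m (T *m _)]mulmxA symplectic_adjointX -mulmxA (mulmxA (X ^+ k)).
    rewrite (mulmxA T) (mulmxA w2^T); apply: skew_form0; apply: symplectic_skew.
    by rewrite trmx_mul -mulmxA symplectic_adjointX mulmxA PT -mulmxA PX.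
  move=> /(congr1 (fun M => invmx (S^T *m T) *m M)).
  rewrite mulmxA mulmx0 mulKmx//.
  by move: gram_unit; rewrite unitmx_mul => /andP[].
have P0 : P = 0.
  rewrite -[P]mulmx1 -(mulmxV S_unit) mulmxA mul_mx_row.
  suff PW w : P *m w = 0 -> P *m Kr w = 0 by rewrite !PW// row_mx0 mul0mx.
  move=> Pw; apply: col_ext => k.
  by rewrite col_mulmx col_krylov mulmxA PX -mulmxA Pw mulmx0 col_const.
exists p; split=> //.
- by rewrite monicE lead_coefDl ?lead_coefXn// size_polyXn size_polyN ltnS.
- by rewrite size_addl ?size_polyXn// size_polyN ltnS.
pose Cp : 'M[K]_N := \matrix_(i, k) if (k.+1 < N)%N then (i == k.+1 :> nat)%:R else a i 0.
have XW w : P *m w = 0 -> X *m Kr w = Kr w *m Cp.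
  move=> Pw; apply: col_ext => k; rewrite !col_mulmx col_krylov mulmxA.
  have -> : X *m X ^+ k = X ^+ k.+1 by rewrite exprS.
  case: (ltnP k.+1 N) => kN.
    have -> : col k Cp = delta_mx (Ordinal kN) 0.
      by apply/matrixP => i c; rewrite !mxE kN ord1 eqxx andbT.
    by rewrite -colE col_krylov.
  have kE : k.+1 = N by apply/eqP; rewrite eqn_leq kN ltn_ord.
  have -> : col k Cp = a by apply/matrixP => i c; rewrite !mxE ord1 ltnNge kN.
  have : P *m w = X ^+ N *m w - Kr w *m a.
    rewrite PE mulmxBl; congr (_ - _); apply/matrixP => b c.
    rewrite ord1 mulmx_suml summxE mxE; apply: eq_bigr => l _.
    by rewrite -scalemxAl [LHS]mxE [in RHS]mxE mulrC.
  by rewrite Pw kE => /esym/eqP; rewrite subr_eq0 => /eqP.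
have XS : X *m S = S *m block_mx Cp 0 0 Cp.
  by rewrite mul_mx_row mul_row_block !mulmx0 addr0 add0r !XW.
have detC : \det Cp ^+ 2 = a 0 0 ^+ 2.
  rewrite (expand_det_row _ ord0) (bigD1 ord_max)//= big1 ?addr0 => [|k kN].
    rewrite /cofactor (_ : row' _ _ = 1%:M) ?det1 ?mulr1.
      by rewrite !mxE ltnn exprMn sqrr_sign mulr1.
    by apply/matrixP => i k; rewrite !mxE lift_max lift0 ltnS ltn_ord eqSS.
  have kN' : (k.+1 < N)%N.
    by rewrite ltnS ltn_neqAle -ltnS ltn_ord andbT; apply: contra kN => /eqP h; apply/eqP/val_inj.
  by rewrite mxE kN' mul0r.
have : \det X * \det S = \det S * (\det Cp * \det Cp).
  by rewrite -det_mulmx XS det_mulmx det_ublock.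
rewrite mulrC => /mulfI -> //; last by rewrite -unitfE -unitmxE.
by rewrite -expr2 detC pc// sqrrN; congr (a _ 0 ^+ 2); apply: val_inj; rewrite /= inordK.
Qed.
End SkewKrylov.

(** * Type III: skew matrices *)

Section SkewType.
Variables (R : realType) (d n r : nat).
Local Notation C := R[i].
Variables (iota : {linear 'rV[C]_d -> 'M[C]_n}) (tp : triple_product R d).
Variables (O : set 'rV[C]_d) (e : 'I_r -> 'rV[C]_d).
Hypothesis iota_inj : injective iota.
Hypothesis iota_tp : forall x y z, iota (tp x y z) = mx_triple (iota x) (iota y) (iota z).
Hypothesis domainE : forall z, O z <-> opnorm (iota z) < 1.
Hypothesis iota_skew : forall z, (iota z)^T = - iota z.
Hypothesis rank_n : (n <= (r + r).+1)%N.
Hypothesis he : is_frame tp e.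
Variable Delta : 'I_r -> mpoly.mpoly d C.
Hypothesis hDelta : forall j : 'I_r, is_jordan_minor tp e j.+1 (Delta j).

Local Notation conj A := (Defs.conjmx A).

Lemma conjmxM p q l (A : 'M[C]_(p, q)) (B : 'M[C]_(q, l)) :
  conj (A *m B) = conj A *m conj B.
Proof. exact: map_mxM. Qed.

Lemma conjmxK p q (A : 'M[C]_(p, q)) : conj (conj A) = A.
Proof. by apply/matrixP => i j; rewrite !mxE conjCK. Qed.

Lemma conjmxN p q (A : 'M[C]_(p, q)) : conj (- A) = - conj A.
Proof. exact: map_mxN. Qed.

Lemma adjmx_tr p q (A : 'M[C]_(p, q)) : adjmx A = conj A^T.
Proof. by apply/matrixP => i j; rewrite !mxE. Qed.

Lemma adjmx_conj p q (A : 'M[C]_(p, q)) : adjmx (conj A) = A^T.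
Proof. by rewrite /adjmx conjmxK. Qed.

Lemma adjmx_row p q l (A : 'M[C]_(p, q)) (B : 'M[C]_(p, l)) :
  adjmx (row_mx A B) = col_mx (adjmx A) (adjmx B).
Proof. by rewrite /adjmx /Defs.conjmx map_row_mx tr_row_mx. Qed.

Lemma conj_delta l : conj (delta_mx l l : 'M[C]_r) = delta_mx l l.
Proof. by apply/matrixP => a b; rewrite !mxE conjC_nat. Qed.

Lemma adj_delta l : adjmx (delta_mx l l : 'M[C]_r) = delta_mx l l.
Proof. by rewrite /adjmx conj_delta trmx_delta. Qed.

Lemma conj1 p : conj (1%:M : 'M[C]_p) = 1%:M.
Proof. exact: map_mx1. Qed.

Lemma skew_small p (A : 'M[C]_p) : A^T = - A -> (p <= 1)%N -> A = 0.
Proof.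
move=> hA p1; apply/matrixP => i k.
have -> : k = i.
  by apply: ord_inj; move: (ltn_ord i) (ltn_ord k) p1; case: p {A hA} i k => [|[|]]// [[|]//= _] [[|]//].
have /matrixP/(_ i i) := hA; rewrite !mxE => /eqP.
by rewrite -subr_eq0 opprK -mulr2n mulrn_eq0 /= => /eqP.
Qed.

Lemma skew_congruence p q (V : 'M[C]_p) (a : 'M[C]_(p, q)) :
  V^T = - V -> (a^T *m V *m a)^T = - (a^T *m V *m a).
Proof. by move=> hV; rewrite !trmx_mul trmxK hV mulNmx mulmxN mulmxA. Qed.

Lemma skew_compression0 p (V P : 'M[C]_p) : V^T = - V -> (\rank P <= 1)%N ->
  P^T *m V *m P = 0.
Proof.
move=> hV rankP.
have small q (a : 'M[C]_(p, q)) (b : 'M[C]_(q, p)) : (q <= 1)%N ->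
    (a *m b)^T *m V *m (a *m b) = 0.
  move=> q1; have h : a^T *m V *m a = 0.
    by apply: skew_small => //; exact: skew_congruence.
  rewrite trmx_mul !mulmxA -(mulmxA _ a^T) -(mulmxA _ _ a).
  by rewrite h mulmx0 mul0mx.
by have := small _ (col_base P) (row_base P) rankP; rewrite mulmx_base.
Qed.

(** A skew matrix that sends xi_l to eta_l sends conj eta_l to - conj xi_l:
    the two orthonormal families together leave at most one dimension, on
    which a skew form vanishes. *)
Lemma skew_frame_image k : groupK O k ->
  exists (Xi H : 'M[C]_(n, r)),
    [/\ adjmx (row_mx Xi (conj H)) *m row_mx Xi (conj H) = 1%:M,
     adjmx (row_mx H (- conj Xi)) *m row_mx H (- conj Xi) = 1%:M
     & forall l, iota (e l *m k) = H *m delta_mx l l *m adjmx Xi -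
                               conj Xi *m delta_mx l l *m adjmx (conj H)].
Proof.
move=> hk; have [Xi [H [Xi1 H1 h1 h2]]] := frame_image iota_inj iota_tp domainE he hk.
pose V l := iota (e l *m k).
have adjV l : adjmx (V l) = - conj (V l).
  by rewrite adjmx_tr iota_skew conjmxN.
have h3 l : V l *m conj H = - conj Xi *m delta_mx l l.
  have := congr1 (fun M => conj M) (h2 l); rewrite !conjmxM conj_delta -/(V l) adjV.
  by rewrite conjmxN conjmxK mulNmx => /(canRL (@opprK _)); rewrite mulNmx.
have h4 l : adjmx (V l) *m (- conj Xi) = conj H *m delta_mx l l.
  by rewrite adjV mulNmx mulmxN opprK -conjmxM h1 conjmxM conj_delta.
have XH : Xi^T *m H = 0.
  apply: col_ext => l; rewrite col_const.
  have sk : (Xi^T *m H *m delta_mx l l)^T = - (Xi^T *m H *m delta_mx l l).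
    rewrite -mulmxA -h1 -/(V l) !trmx_mul trmxK /V iota_skew.
    by rewrite mulmxN mulNmx mulmxA.
  apply/matrixP => i c; rewrite ord1 [RHS]mxE [LHS]mxE.
  have E a b : (Xi^T *m H *m delta_mx l l) a b = (b == l)%:R * (Xi^T *m H) a l.
    rewrite mxE (bigD1 l)//= big1 ?addr0 => [|b' b'l].
      by rewrite [delta_mx _ _ _ _]mxE eqxx mulrC.
    by rewrite [delta_mx _ _ _ _]mxE (negPf b'l) mulr0.
  have /matrixP/(_ i l) := sk; rewrite mxE [RHS]mxE !E eqxx mul1r.
  have [->|il] := eqVneq i l; last by rewrite mul0r => /esym/eqP; rewrite oppr_eq0 => /eqP.
  by rewrite mul1r => /eqP; rewrite -subr_eq0 opprK -mulr2n mulrn_eq0 /= => /eqP.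
have HX : H^T *m Xi = 0 by apply: trmx_inj; rewrite trmx_mul trmxK XH trmx0.
have X1 : adjmx (row_mx Xi (conj H)) *m row_mx Xi (conj H) = 1%:M.
  rewrite adjmx_row mul_col_row Xi1.
  have -> : adjmx Xi *m conj H = 0.
    by rewrite adjmx_tr -conjmxM XH /Defs.conjmx map_mx0.
  rewrite adjmx_conj HX.
  have -> : H^T *m conj H = 1%:M.
    by rewrite -[LHS]conjmxK conjmxM conjmxK -adjmx_tr H1 conj1.
  by rewrite -scalar_mx_block.
have H2 : adjmx (row_mx H (- conj Xi)) *m row_mx H (- conj Xi) = 1%:M.
  rewrite adjmx_row mul_col_row H1 adjmxN adjmx_conj !mulNmx !mulmxN opprK XH.
  have -> : adjmx H *m conj Xi = 0.
    by rewrite adjmx_tr -conjmxM HX /Defs.conjmx map_mx0.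
  have -> : Xi^T *m conj Xi = 1%:M.
    by rewrite -[LHS]conjmxK conjmxM conjmxK -adjmx_tr Xi1 conj1.
  by rewrite !oppr0 -scalar_mx_block.
exists Xi, H; split=> // l; rewrite -/(V l).
pose X2 := row_mx Xi (conj H); pose Y2 := row_mx H (- conj Xi).
pose blk := block_mx (delta_mx l l) 0 0 (delta_mx l l) : 'M[C]_(r + r).
have VX : V l *m X2 = Y2 *m blk.
  by rewrite mul_mx_row mul_row_block !mulmx0 addr0 add0r h1 h3.
have VY : adjmx (V l) *m Y2 = X2 *m blk.
  by rewrite mul_mx_row mul_row_block !mulmx0 addr0 add0r h2 h4.
have blk_adj : adjmx blk = blk.
  by rewrite /adjmx /Defs.conjmx map_block_mx tr_block_mx !map_mx0 !trmx0 -/(adjmx _) adj_delta.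
pose P := 1%:M - X2 *m adjmx X2.
have VP : V l *m P = V l - Y2 *m blk *m adjmx X2 by rewrite mulmxBr mulmx1 mulmxA VX.
have PV : (1%:M - Y2 *m adjmx Y2) *m V l = V l - Y2 *m blk *m adjmx X2.
  rewrite mulmxBl mul1mx -[in X in _ - X](adjmxK (V l)) -(mulmxA Y2 (adjmx Y2)) -adjmxM VY.
  by rewrite adjmxM blk_adj mulmxA.
have PT : 1%:M - Y2 *m adjmx Y2 = P^T.
  rewrite /P linearB /= trmx1 trmx_mul; congr (_ - _).
  rewrite /X2 /Y2 !adjmx_row tr_row_mx tr_col_mx.
  rewrite !mul_row_col adjmxN mulmxN mulNmx opprK !adjmx_conj trmxK.
  by rewrite addrC /adjmx trmxK.
have PP : P *m P = P.
  have XP : adjmx X2 *m P = 0 by rewrite mulmxBr mulmx1 mulmxA X1 mul1mx subrr.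
  by rewrite [in LHS]mulmxBl mul1mx -mulmxA XP mulmx0 subr0.
have rankP : (\rank P <= 1)%N.
  have : P *m X2 = 0 by rewrite mulmxBl mul1mx -mulmxA X1 mulmx1 subrr.
  move=> /mulmx0_rank_max; have : \rank X2 = (r + r)%N.
    apply/eqP; rewrite eqn_leq rank_leq_col /= -[X in (X <= _)%N](mxrank1 C (r + r)) -X1.
    by rewrite mxrankM_maxr.
  by move=> -> /leq_trans/(_ rank_n); rewrite -add1n leq_add2r.
have W0 := skew_compression0 (iota_skew (e l *m k)) rankP.
have V0 : V l *m P = 0.
  by rewrite -W0 -PT PV -VP -mulmxA PP.
move: V0; rewrite VP => /eqP; rewrite subr_eq0 => /eqP ->.
rewrite /Y2 /X2 adjmx_row mul_row_block !mulmx0 addr0 add0r mul_row_col.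
by rewrite !mulNmx.
Qed.


(** The minor is a Pfaffian. The compression of a skew matrix to the frame is
    the product of the symplectic matrix and a skew matrix, so that its
    determinant is the square of the constant coefficient of the polynomial of
    half degree that annihilates it. The vectors (1, 0) and (0, 1), in blocks of
    ones and zeros, have independent Krylov spaces at the base point z0. *)
Lemma skew_minor_sqr (j : 'I_r) : exists F G : 'M[C]_(n, j.+1 + j.+1),
  forall z, peval (Delta j) z ^+ 2 = \det (adjmx F *m iota z *m G).
Proof.
have [Xi [H [X1 Y1 eE]]] := skew_frame_image (groupK1 O).
pose X2 := row_mx Xi (conj H); pose Y2 := row_mx H (- conj Xi).
rewrite -/X2 -/Y2 in X1 Y1.
pose dbl (A : 'M[C]_r) : 'M[C]_(r + r) := block_mx A 0 0 A.
have {}eE l : iota (e l) = Y2 *m dbl (delta_mx l l) *m adjmx X2.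
  rewrite -[e l]mulmx1 eE /Y2 /X2 adjmx_row mul_row_block !mulmx0 addr0 add0r.
  by rewrite mul_row_col !mulNmx.
pose s0 := selection R j.
pose s : 'M[C]_(r + r, j.+1 + j.+1) := block_mx s0 0 0 s0.
have s_adj : adjmx s = block_mx s0^T 0 0 s0^T.
  rewrite /adjmx /Defs.conjmx map_block_mx tr_block_mx !map_mx0 !trmx0.
  by rewrite -/(Defs.conjmx s0) -/(adjmx s0) adjmx_selection.
have s1 : adjmx s *m s = 1%:M.
  rewrite s_adj mulmx_block !mulmx0 !mul0mx !addr0 !add0r selection_orth.
  by rewrite -scalar_mx_block.
pose F := Y2 *m s; pose G := X2 *m s.
have F1 : adjmx F *m F = 1%:M.
  by rewrite adjmxM mulmxA -(mulmxA (adjmx s)) Y1 mulmx1.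
have G1 : adjmx G *m G = 1%:M.
  by rewrite adjmxM mulmxA -(mulmxA (adjmx s)) X1 mulmx1.
have FG : \sum_(i < r | (i < j.+1)%N) iota (e i) = F *m adjmx G.
  rewrite adjmxM mulmxA -(mulmxA Y2) s_adj mulmx_block !mulmx0 !mul0mx !addr0 !add0r.
  rewrite -selection_sum.
  have -> : block_mx (\sum_(l < r | (l < j.+1)%N) delta_mx l l) 0 0
      (\sum_(l < r | (l < j.+1)%N) delta_mx l l) =
      \sum_(l < r | (l < j.+1)%N) dbl (delta_mx l l).
    apply: (big_ind2 (fun A B => block_mx A 0 0 A = B)) => //.
      by rewrite block_mx0.
    by move=> A1 A2 B1 B2 <- <-; rewrite add_block_mx !addr0.
  by rewrite mulmx_sumr mulmx_suml; apply: eq_bigr => i _; rewrite eE.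
have FconjG : adjmx F = symplectic_mx C j *m G^T.
  have -> : F = conj G *m (symplectic_mx C j)^T.
    rewrite /F /G conjmxM tr_symplectic_mx.
    have -> : conj s = s.
      by apply: trmx_inj; rewrite -/(adjmx s) s_adj tr_block_mx !trmx0.
    rewrite -mulmxA /X2 /Y2 /Defs.conjmx map_row_mx -!/(Defs.conjmx _) conjmxK.
    rewrite opp_block_mx !oppr0 opprK /s !mulmx_block !mulmx0 !mul0mx !addr0 !add0r.
    by rewrite !mul_row_block !mulmxN !mulmx1 !mulmx0 !mulNmx !addr0 !add0r.
  rewrite adjmxM adjmx_conj; congr (_ *m _).
  rewrite adjmx_tr trmxK /Defs.conjmx /symplectic_mx map_block_mx !map_mx0 map_mxN.
  by rewrite map_mx1.
exists F, G => z.
pose z0 := \sum_(i < r) (i.+1)%:R *: e i.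
pose D0 := diag_mx (\row_(b < j.+1) (b.+1)%:R : 'rV[C]_j.+1).
have z0E : adjmx F *m iota z0 *m G = block_mx D0 0 0 D0.
  have -> : iota z0 = Y2 *m dbl (diag_mx (\row_a (a.+1)%:R)) *m adjmx X2.
    rewrite linear_sum /=.
    rewrite diag_mx_sum_delta.
    have -> : dbl (\sum_(i < r) (\row_a (a.+1)%:R : 'rV[C]_r) 0 i *: delta_mx i i) =
        \sum_(i < r) (\row_a (a.+1)%:R : 'rV[C]_r) 0 i *: dbl (delta_mx i i).
      rewrite /dbl; apply: (big_ind2 (fun A B => block_mx A 0 0 A = B)) => //.
      - by rewrite block_mx0.
      - by move=> A1 A2 B1 B2 <- <-; rewrite add_block_mx !addr0.
      - by move=> i _; rewrite scale_block_mx !scaler0.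
    rewrite mulmx_sumr mulmx_suml; apply: eq_bigr => i _.
    by rewrite linearZ /= eE mxE -scalemxAr -scalemxAl.
  rewrite adjmxM !mulmxA -(mulmxA _ (adjmx Y2) Y2) Y1 mulmx1.
  rewrite -(mulmxA _ (adjmx X2) X2) X1 mulmx1 s_adj.
  rewrite !mulmx_block !mulmx0 !mul0mx !addr0 !add0r !mul0mx.
  by rewrite (selection_diag j (fun a => a.+1%:R)).
pose X t := adjmx F *m iota (z0 + t *: (z - z0)) *m G.
have Xpoly a b : polynomial_function (fun t => X t a b) by exact: compression_polynomial.
pose w1 : 'cV[C]_(j.+1 + j.+1) := col_mx (const_mx 1) 0.
pose w2 : 'cV[C]_(j.+1 + j.+1) := col_mx 0 (const_mx 1).
have Wpoly w := polynomial_function_krylov (N := j.+1) w Xpoly.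
pose S t := row_mx (krylov j.+1 (X t) w1) (krylov j.+1 (X t) w2).
have Spoly a b : polynomial_function (fun t => S t a b).
  rewrite /S; case: (fintype.splitP b) => c bc.
    have [q hq] := Wpoly w1 a c; exists q => t.
    by rewrite -hq (_ : b = lshift _ c) ?row_mxEl//; apply: val_inj.
  have [q hq] := Wpoly w2 a c; exists q => t.
  by rewrite -hq (_ : b = rshift _ c) ?row_mxEr//; apply: val_inj.
have S0 : \det (S 0) != 0.
  have XE k : X 0 ^+ k = block_mx (D0 ^+ k) 0 0 (D0 ^+ k).
    rewrite /X scale0r addr0 z0E; elim: k => [|k IH].
      by rewrite !expr0 -scalar_mx_block.
    rewrite exprS -[_ * _]/(_ *m _) IH mulmx_block !mulmx0 !mul0mx !addr0 !add0r.
    by rewrite exprS.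
  pose V := krylov j.+1 D0 (const_mx 1).
  have -> : S 0 = block_mx V 0 0 V.
    apply: col_ext => b; case: (fintype.splitP b) => c bc.
      rewrite (_ : b = lshift _ c); last exact: val_inj.
      rewrite /S colKl block_mxEh colKl col_krylov XE mul_block_col mulmx0 addr0 mul0mx.
      rewrite mulmx0 addr0 col_col_mx col_const; congr col_mx.
      by rewrite col_krylov.
    rewrite (_ : b = rshift _ c); last exact: val_inj.
    rewrite /S colKr block_mxEh colKr col_krylov XE mul_block_col !mulmx0 !mul0mx !add0r.
    rewrite col_col_mx col_const; congr col_mx.
    by rewrite col_krylov.
  by rewrite det_ublock mulf_neq0 ?det_krylov_diag.
pose g t := peval (Delta j) (z0 + t *: (z - z0)) ^+ 2 - \det (X t).
have gpoly : polynomial_function g.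
  apply: polynomial_functionB; last exact: polynomial_function_det.
  exact/polynomial_functionX/polynomial_function_peval.
suff /(_ 1) : forall t, g t = 0.
  by rewrite /g /X scale1r (addrC z0) subrK => /eqP; rewrite subr_eq0 => /eqP.
apply: (polynomial_function_density (polynomial_function_det Spoly) gpoly S0) => t St.
apply/eqP; rewrite subr_eq0; apply/eqP.
have Y_skew : (G^T *m iota (z0 + t *: (z - z0)) *m G)^T =
    - (G^T *m iota (z0 + t *: (z - z0)) *m G).
  exact/skew_congruence/iota_skew.
have XtE : X t = symplectic_mx C j *m (G^T *m iota (z0 + t *: (z - z0)) *m G).
  by rewrite /X FconjG !mulmxA.
have Su : S t \in unitmx by rewrite unitmxE unitfE.
have [p [pm sp pX p0]] := symplectic_min_poly Y_skew XtE Su.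
rewrite (jordan_minor_value iota_inj iota_tp he (hDelta j) F1 G1 FG (erefl (X t)) _ pm sp pX).
  by rewrite exprMn sqrr_sign mul1r.
move=> c; apply: (@krylov_independent _ _ _ _ w1) => v Wv.
have : S t *m col_mx v 0 = 0 by rewrite mul_row_col mulmx0 addr0.
move=> /(congr1 (fun M => invmx (S t) *m M)); rewrite mulmx0 mulKmx// => /eqP.
by rewrite col_mx_eq0 => /andP[/eqP].
Qed.


(** Along the line through z the minor is a square root of c^2 t^(2j+2), hence
    c t^(j+1) up to a sign, which is seen at t = 1. *)
Lemma skew_homogeneous (j : 'I_r) (t : C) z :
  peval (Delta j) (t *: z) = t ^+ j.+1 * peval (Delta j) z.
Proof.
have [F [G DE]] := skew_minor_sqr j.
have [q hq] := polynomial_function_peval (Delta j) 0 z.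
have {}hq s : peval (Delta j) (s *: z) = q.[s] by rewrite -hq add0r.
set c := peval (Delta j) z.
have qq : q ^+ 2 = (c *: 'X^(j.+1)) ^+ 2.
  apply/eqP; rewrite -subr_eq0; apply/eqP/horner_inj0 => s.
  rewrite hornerD hornerN !horner_exp hornerZ hornerXn -hq DE linearZ /=.
  rewrite -scalemxAr -scalemxAl detZ exprMn /c DE -exprM muln2 -addnn mulrC.
  exact: subrr.
have q1 : q.[1] = c by rewrite -hq scale1r.
rewrite hq; move/eqP: qq; rewrite eqf_sqr => /orP[] /eqP qE.
  by rewrite qE hornerZ hornerXn mulrC.
have c0 : c = 0.
  have := q1; rewrite qE hornerN hornerZ hornerXn expr1n mulr1 => /eqP.
  by rewrite -subr_eq0 -opprD oppr_eq0 -mulr2n mulrn_eq0 /= => /eqP.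
by rewrite qE c0 scale0r oppr0 horner0 mulr0.
Qed.

(** The image of a frame element has rank two, so that the square of the
    minor is a polynomial of degree two along it. *)
Lemma skew_affine k : groupK O k -> forall (j : 'I_r) l z t,
  peval (Delta j) (z + t *: (e l *m k)) =
  peval (Delta j) z + t * (peval (Delta j) (z + e l *m k) - peval (Delta j) z).
Proof.
move=> hk j l z t; have [F [G DE]] := skew_minor_sqr j.
have [Xi [H [_ _ kE]]] := skew_frame_image hk.
pose u1 := adjmx F *m H *m delta_mx l (0 : 'I_1).
pose v1 := delta_mx (0 : 'I_1) l *m adjmx Xi *m G.
pose u2 := - (adjmx F *m conj Xi *m delta_mx l (0 : 'I_1)).
pose v2 := delta_mx (0 : 'I_1) l *m adjmx (conj H) *m G.
pose A := adjmx F *m iota z *m G.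
have E s : adjmx F *m iota (z + s *: (e l *m k)) *m G =
    A + s *: (u1 *m v1) + s *: (u2 *m v2).
  rewrite linearD linearZ /= mulmxDr mulmxDl -addrA -scalerDr; congr (_ + _).
  rewrite -scalemxAr -scalemxAl kE; congr (_ *: _).
  rewrite /u1 /v1 /u2 /v2 mulNmx !mulmxA mulmxBr mulmxBl !mulmxA.
  by rewrite -!(mulmxA _ (delta_mx l 0)) !mul_delta_mx.
have [q hq] := polynomial_function_peval (Delta j) z (e l *m k).
have [c0 [c1 [c2 detE]]] := det_add_rank2 A u1 u2 v1 v2.
have size_q : (size q <= 2)%N.
  pose p := (c0%:P + c1 *: 'X + c2 *: 'X^2) : {poly C}.
  have qp : q ^+ 2 = p.
    apply/eqP; rewrite -subr_eq0; apply/eqP/horner_inj0 => s.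
    rewrite hornerD hornerN horner_exp -hq DE E detE /p !hornerD !hornerZ hornerC.
    by rewrite hornerX hornerXn subrr.
  have sp : (size p <= 3)%N.
    rewrite /p (leq_trans (size_polyD _ _))// geq_max; apply/andP; split.
      rewrite (leq_trans (size_polyD _ _))// geq_max; apply/andP; split.
        by rewrite (leq_trans (size_polyC_leq1 _)).
      by rewrite (leq_trans (size_scale_leq _ _))// size_polyX.
    by rewrite (leq_trans (size_scale_leq _ _))// size_polyXn.
  have := size_exp q 2; rewrite qp => h.
  by move: sp h; case: (size q) => [|[|[|s]]] //=; case: (size p) => [|[|[|[|]]]].
have {}hq s : peval (Delta j) (z + s *: (e l *m k)) = q`_0 + s * q`_1.
  rewrite hq (horner_coef_wide _ size_q) big_ord_recr big_ord1 /=.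
  by rewrite expr0 mulr1 expr1 mulrC.
have h0 := hq 0; have h1 := hq 1.
rewrite scale0r addr0 in h0; rewrite scale1r in h1.
by rewrite hq h0 h1; ring.
Qed.

End SkewType.

(** * Type IV: the spin factor *)

Lemma isotropy_budget (R : realFieldType) (a b p q : R) :
  p + q <= 2 -> 1 + a <= p -> 1 + b <= q -> 0 <= a -> 0 <= b -> a <= 0 /\ b <= 0.
Proof. by move=> *; split; lra. Qed.

Section SpinFactor.
Variables (R : realType) (d : nat).
Local Notation C := R[i].
Local Notation V := 'rV[C]_d.
Implicit Types x y z : V.

Definition bform x y : C := (x *m y^T) 0 0.
Definition hform x y : C := (x *m adjmx y) 0 0.

Lemma bformC x y : bform x y = bform y x.
Proof. by rewrite /bform !mxE; apply: eq_bigr => i _; rewrite !mxE mulrC. Qed.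

Lemma bformDl x y z : bform (x + y) z = bform x z + bform y z.
Proof. by rewrite /bform mulmxDl mxE. Qed.

Lemma bformZl c x z : bform (c *: x) z = c * bform x z.
Proof. by rewrite /bform -scalemxAl mxE. Qed.

Lemma bformDr x y z : bform z (x + y) = bform z x + bform z y.
Proof. by rewrite !(bformC z) bformDl. Qed.

Lemma bformZr c x z : bform z (c *: x) = c * bform z x.
Proof. by rewrite !(bformC z) bformZl. Qed.

Lemma bform_quadratic x y t :
  bform (x + t *: y) (x + t *: y) =
  bform x x + t * (2 * bform x y) + t * (t * bform y y).
Proof. by rewrite !bformDl !bformDr !bformZl !bformZr (bformC y x); ring. Qed.

Lemma bform_delta i x : bform (delta_mx 0 i) x = x 0 i.
Proof. by rewrite /bform -rowE !mxE. Qed.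

Lemma bform_conj x y : bform (Defs.conjmx x) (Defs.conjmx y) = Num.conj (bform x y).
Proof.
rewrite /bform !mxE rmorph_sum; apply: eq_bigr => i _.
by rewrite !mxE rmorphM.
Qed.

Lemma conjmx_scale c x : Defs.conjmx (c *: x) = Num.conj c *: Defs.conjmx x.
Proof. exact: map_mxZ. Qed.

Lemma conjmx_involutive x : Defs.conjmx (Defs.conjmx x) = x.
Proof. by apply/matrixP => i j; rewrite !mxE conjCK. Qed.

Lemma hformE x y : hform x y = bform x (Defs.conjmx y).
Proof. by []. Qed.

Lemma hformDl x y z : hform (x + y) z = hform x z + hform y z.
Proof. exact: bformDl. Qed.

Lemma hformZl c x z : hform (c *: x) z = c * hform x z.
Proof. exact: bformZl. Qed.

Lemma hformNl x z : hform (- x) z = - hform x z.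
Proof. by rewrite -scaleN1r hformZl mulN1r. Qed.

Lemma hform_conj x y : Num.conj (hform x y) = hform y x.
Proof.
rewrite /hform !mxE rmorph_sum; apply: eq_bigr => i _.
by rewrite !mxE rmorphM /= conjCK mulrC.
Qed.

Lemma hformDr x y z : hform z (x + y) = hform z x + hform z y.
Proof. by rewrite -!(hform_conj _ z) hformDl rmorphD. Qed.

Lemma hformZr c x z : hform z (c *: x) = Num.conj c * hform z x.
Proof. by rewrite -!(hform_conj _ z) hformZl rmorphM. Qed.

Lemma sqnorm_row x : (sqnorm x)%:C = hform x x.
Proof.
rewrite /hform mxE /sqnorm big_ord1 rmorph_sum /=; apply: eq_bigr => i _.
by rewrite normsqE !mxE mulrC.
Qed.

Lemma spin_tripleE x y z : spin_triple x y z =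
  2^-1 *: (hform x y *: z + hform z y *: x - bform x z *: Defs.conjmx y).
Proof. by []. Qed.

Lemma sqnorm_row_parallelogram x y :
  sqnorm (x + y) + sqnorm (x - y) = 2 * (sqnorm x + sqnorm y).
Proof.
apply: complexI; rewrite rmorphM !rmorphD /= !sqnorm_row -scaleN1r.
rewrite !hformDl !hformDr !hformZl !hformZr rmorphN rmorph1; ring.
Qed.

Local Notation O := (@domain R (TypeIV d)).

Lemma spin_domainE z : O z <-> sqnorm z < 2 /\ sqnorm z < 1 + normsq (2^-1 * bform z z).
Proof. by []. Qed.

Lemma spin_absorbing z : exists2 eps : R, 0 < eps &
  forall t, 0 <= t <= eps -> O (t%:C *: z).
Proof.
exists (sqnorm z + 1)^-1; first by rewrite invr_gt0 ltr_wpDl ?sqnorm_ge0.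
have z0 := sqnorm_ge0 z.
move=> t /andP[t0 t1].
have tL : t * (sqnorm z + 1) <= 1 by rewrite -ler_pdivlMr ?div1r//; lra.
have small : sqnorm (t%:C *: z) < 1 by rewrite sqnormZ normsq_real expr2; nra.
apply/spin_domainE; split; first lra.
by have := normsq_ge0 (2^-1 * bform (t%:C *: z) (t%:C *: z)); lra.
Qed.

Lemma ord2E (l : 'I_2) : l = ord0 \/ l = ord_max.
Proof. by case: l => [[|[|//]] h]; [left|right]; apply: val_inj. Qed.

Variable e : 'I_2 -> V.
Hypothesis he : is_frame (@spin_triple R d) e.
Local Notation e1 := (e ord0).
Local Notation e2 := (e ord_max).

(** The orthogonality relation, read in the coordinate i at the i-th basis
    vector, gives <e_1, e_2> = 0; at e_2 it shows that e_1 is a multiple of the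
    conjugate of e_2, and then both are isotropic. *)
Lemma spin_frame : exists c : C,
  [/\ Num.conj c * c = 1, Defs.conjmx e1 = Num.conj c *: e2,
      Defs.conjmx e2 = Num.conj c *: e1
    & [/\ bform e1 e1 = 0, bform e2 e2 = 0, hform e1 e1 = 1 & hform e2 e2 = 1]].
Proof.
have [htrip horth] := he.
have orth := horth ord0 ord_max isT.
have [n1 t1 _] := htrip ord0; have [n2 t2 _] := htrip ord_max.
have orthE z : hform e1 e2 *: z + hform z e2 *: e1 - bform e1 z *: Defs.conjmx e2 = 0.
  have := orth z; rewrite spin_tripleE => /eqP.
  by rewrite scaler_eq0 invr_eq0 pnatr_eq0 /= => /eqP.
have h12 : hform e1 e2 = 0.
  have /rV0Pn[i _] := n1.
  have := orthE (delta_mx 0 i) => /rowP/(_ i).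
  by rewrite [hform (delta_mx _ _) _]hformE bform_delta [bform _ (delta_mx _ _)]bformC bform_delta !mxE !eqxx mulr1 mulrC addrK.
have h22 : hform e2 e2 != 0.
  apply: contra_neq n2 => h; apply: sqnorm_eq0; apply: complexI.
  by rewrite sqnorm_row h.
pose c := bform e1 e2 / hform e2 e2.
have e1E : e1 = c *: Defs.conjmx e2.
  have := orthE e2; rewrite h12 scale0r add0r => /eqP; rewrite subr_eq0 => /eqP h.
  by rewrite /c mulrC -scalerA -h scalerA mulVf ?scale1r.
have c0 : c != 0 by apply: contra_neq n1 => h; rewrite e1E h scale0r.
have b22 : bform e2 e2 = 0.
  have := h12; rewrite {1}e1E hformZl hformE bform_conj => /eqP.
  by rewrite mulf_eq0 (negPf c0) /= fmorph_eq0 => /eqP.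
have b11 : bform e1 e1 = 0.
  by rewrite e1E bformZl bformZr bform_conj b22 rmorph0 !mulr0.
have norm1 x : x != 0 -> bform x x = 0 -> spin_triple x x x = x -> hform x x = 1.
  move=> x0 bx; rewrite spin_tripleE bx scale0r subr0 -scalerDl scalerA => /eqP.
  rewrite -subr_eq0 -[X in _ - X]scale1r -scalerBl scaler_eq0 (negPf x0) orbF subr_eq0 => /eqP h.
  by rewrite -[RHS]h; field.
have h1 := norm1 _ n1 b11 t1; have h2 := norm1 _ n2 b22 t2.
have cc : Num.conj c * c = 1.
  have := h1; rewrite {1 2}e1E hformZl hformZr hformE conjmx_involutive bformC -hformE h2.
  by rewrite mulr1 mulrC.
exists c; split=> //.
- by rewrite {1}e1E conjmx_scale conjmx_involutive.
- by rewrite e1E scalerA cc scale1r.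
Qed.

(** The images of the frame under a linear automorphism are isotropic: the
    sums with signs give |v1|^2 + |v2|^2 <= 2, while |v|^2 >= 1 + |b(v,v)/2|^2
    outside the domain. *)
Lemma spin_frame_image k : groupK O k -> forall l, bform (e l *m k) (e l *m k) = 0.
Proof.
move=> hk; have Ok := groupK_domain spin_absorbing hk.
have [c [cc e1E e2E [b11 b22 h11 h22]]] := spin_frame.
have h12 : hform e1 e2 = 0 by rewrite hformE e2E bformZr b11 mulr0.
have h21 : hform e2 e1 = 0 by rewrite -hform_conj h12 rmorph0.
have b12 : bform e1 e2 = c.
  have -> : e2 = c *: Defs.conjmx e1 by rewrite e1E scalerA mulrC cc scale1r.
  by rewrite bformZr -hformE h11 mulr1.
have nc : normsq c = 1 by apply: complexI; rewrite normsqE cc.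
pose v1 := e1 *m k; pose v2 := e2 *m k.
have sum_le2 (s : C) : s = 1 \/ s = -1 -> sqnorm (v1 + s *: v2) <= 2.
  move=> hs; have ss : Num.conj s * s = 1 by case: hs => ->; rewrite ?rmorphN rmorph1 ?mulrNN mulr1.
  have ns : normsq s = 1 by apply: complexI; rewrite normsqE ss.
  have sum2 : sqnorm (e1 + s *: e2) = 2.
    apply: complexI; rewrite sqnorm_row !hformDl !hformDr !hformZl !hformZr h11 h12 h21 h22.
    by rewrite mulr0 mulr1 mulr0 add0r addr0 mulrC ss rmorphD rmorph1.
  have bsum : bform (e1 + s *: e2) (e1 + s *: e2) = 2 * (s * c).
    rewrite !bformDl !bformDr !bformZl !bformZr b11 b22 (bformC e2) b12; ring.
  rewrite leNgt; apply/negP => lt2; set a := sqnorm _ in lt2.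
  (* At this scale the image would have |z|^2 = 2, outside the domain. *)
  pose t := Num.sqrt (2 / a).
  have a0 : 0 < a by apply: lt_trans lt2.
  have t2 : t ^+ 2 = 2 / a by rewrite sqr_sqrtr// divr_ge0 ?ltW.
  have t2lt : t ^+ 2 < 1 by rewrite t2 ltr_pdivrMr// mul1r.
  have t2gt : 0 < t ^+ 2 by rewrite t2 divr_gt0.
  have : O (t%:C *: (e1 + s *: e2)).
    apply/spin_domainE; rewrite !bformZl !bformZr bsum sqnormZ normsq_real sum2.
    have -> : 2^-1 * (t%:C * (t%:C * (2 * (s * c)))) = (t ^+ 2)%:C * (s * c).
      by rewrite rmorphXn /=; field.
    by rewrite !normsqM normsq_real ns nc; split; nra.
  move/Ok; rewrite -scalemxAl mulmxDl -scalemxAl => /spin_domainE[].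
  by rewrite sqnormZ normsq_real -/v1 -/v2 -/a t2 divfK ?gt_eqF// ltxx.
have le2 : sqnorm v1 + sqnorm v2 <= 2.
  have := sqnorm_row_parallelogram v1 v2.
  have := sum_le2 1 (or_introl erefl); have := sum_le2 (-1) (or_intror erefl).
  by rewrite scale1r scaleN1r; lra.
have out l : ~ O (e l *m k).
  move=> /(Ok _).2/spin_domainE[_].
  have [-> ->] : bform (e l) (e l) = 0 /\ sqnorm (e l) = 1.
    by case: (ord2E l) => ->; split=> //; apply: complexI; rewrite sqnorm_row.
  by rewrite mulr0 (normsq_real 0) expr0n addr0 ltxx.
have O0 : O 0 by exact: absorbing0 spin_absorbing.
have ge1 x y : ~ O x -> ~ O y -> sqnorm x + sqnorm y <= 2 ->
    1 + normsq (2^-1 * bform x x) <= sqnorm x.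
  move=> Ox Oy xy; rewrite leNgt; apply/negP => h; apply: Ox; apply/spin_domainE; split=> //.
  rewrite ltNge; apply/negP => h2; apply: Oy.
  have -> : y = 0 by apply: sqnorm_eq0; apply/le_anti; rewrite sqnorm_ge0 andbT; lra.
  exact: O0.
have g1 := ge1 _ _ (out ord0) (out ord_max) le2.
have g2 : 1 + normsq (2^-1 * bform v2 v2) <= sqnorm v2.
  by apply: (ge1 _ v1 (out ord_max) (out ord0)); rewrite addrC.
have iso x : normsq (2^-1 * bform x x) <= 0 -> bform x x = 0.
  move=> h; have : normsq (2^-1 * bform x x) = 0 by apply/le_anti; rewrite h normsq_ge0.
  move=> /(congr1 (fun a : R => a%:C)); rewrite normsqE mulrC => /eqP.
  by rewrite mul_conjC_eq0 mulf_eq0 invr_eq0 pnatr_eq0 /= => /eqP.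
have n1 := normsq_ge0 (2^-1 * bform v1 v1); have n2 := normsq_ge0 (2^-1 * bform v2 v2).
have [q1 q2] := isotropy_budget le2 g1 g2 n1 n2.
by move=> l; case: (ord2E l) => ->; [exact: iso q1|exact: iso q2].
Qed.

Variable Delta : 'I_2 -> mpoly.mpoly d C.
Hypothesis hDelta : forall j : 'I_2, is_jordan_minor (@spin_triple R d) e j.+1 (Delta j).

Lemma spin_box1 z :
  spin_triple e1 e1 z = 2^-1 *: (z + hform z e1 *: e1 - hform z e2 *: e2).
Proof.
have [c [cc e1E e2E [b11 b22 h11 h22]]] := spin_frame.
rewrite spin_tripleE h11 scale1r e1E scalerA; congr (_ *: (_ - _ *: _)).
by rewrite [in RHS]hformE e2E bformZr bformC mulrC.
Qed.

Lemma spin_box2 z :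
  spin_triple e2 e2 z = 2^-1 *: (z + hform z e2 *: e2 - hform z e1 *: e1).
Proof.
have [c [cc e1E e2E [b11 b22 h11 h22]]] := spin_frame.
rewrite spin_tripleE h22 scale1r e2E scalerA; congr (_ *: (_ - _ *: _)).
by rewrite [in RHS]hformE e1E bformZr bformC mulrC.
Qed.

Lemma spin_frame_orth : [/\ hform e1 e1 = 1, hform e2 e2 = 1, hform e1 e2 = 0 & hform e2 e1 = 0].
Proof.
have [c [cc e1E e2E [b11 b22 h11 h22]]] := spin_frame.
have h12 : hform e1 e2 = 0 by rewrite hformE e2E bformZr b11 mulr0.
by split=> //; rewrite -hform_conj h12 rmorph0.
Qed.

Definition spin_peirce z (i k : nat) : V :=
  if (i == 1%N) && (k == 1%N) then hform z e1 *: e1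
  else if (i == 2%N) && (k == 2%N) then hform z e2 *: e2
  else if (i == 1%N) && (k == 2%N) then z - hform z e1 *: e1 - hform z e2 *: e2
  else 0.

Lemma spin_peirceP z i k : (i <= k <= 2)%N ->
  peirce (@spin_triple R d) e i k (spin_peirce z i k).
Proof.
have [h11 h22 h12 h21] := spin_frame_orth.
have lin0 l : spin_triple (e l) (e l) 0 = 0.
  by case: (ord2E l) => ->; rewrite ?spin_box1 ?spin_box2 /hform !mul0mx mxE !scale0r subr0 addr0 scaler0.
have Z1 : hform (hform z e1 *: e1) e1 = hform z e1 by rewrite hformZl h11 mulr1.
have Z2 : hform (hform z e1 *: e1) e2 = 0 by rewrite hformZl h12 mulr0.
have Z3 : hform (hform z e2 *: e2) e1 = 0 by rewrite hformZl h21 mulr0.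
have Z4 : hform (hform z e2 *: e2) e2 = hform z e2 by rewrite hformZl h22 mulr1.
have Z5 : hform (z - hform z e1 *: e1 - hform z e2 *: e2) e1 = 0.
  by rewrite !hformDl !hformNl Z1 Z3 subr0 subrr.
have Z6 : hform (z - hform z e1 *: e1 - hform z e2 *: e2) e2 = 0.
  by rewrite !hformDl !hformNl Z2 Z4 subr0 subrr.
move=> ik l.
have [[-> ->]|[-> ->]|[-> ->]|w0] : [\/ i = 1%N /\ k = 1%N, i = 2%N /\ k = 2%N,
    i = 1%N /\ k = 2%N | spin_peirce z i k = 0].
  by move: ik => /andP[]; case: i => [|[|[|i]]]; case: k => [|[|[|k]]] //= _ _;
    [constructor 4|constructor 4|constructor 4|constructor 1|constructor 3|constructor 2].
- case: (ord2E l) => -> /=.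
    by rewrite spin_box1 Z1 Z2 scale0r subr0 scale_halfD divff ?scale1r ?pnatr_eq0.
  by rewrite spin_box2 Z1 Z2 scale0r addr0 subrr scaler0 mul0r scale0r.
- case: (ord2E l) => -> /=.
    by rewrite spin_box1 Z3 Z4 scale0r addr0 subrr scaler0 mul0r scale0r.
  by rewrite spin_box2 Z3 Z4 scale0r subr0 scale_halfD divff ?scale1r ?pnatr_eq0.
- case: (ord2E l) => -> /=.
    by rewrite spin_box1 Z5 Z6 !scale0r subr0 addr0 div1r.
  by rewrite spin_box2 Z5 Z6 !scale0r subr0 addr0 div1r.
- by rewrite w0 lin0 scaler0.
Qed.

Lemma spin_peirce_proj1 z : peirce_proj (@spin_triple R d) e 1 z (hform z e1 *: e1).
Proof.
exists (spin_peirce z); split; [exact: spin_peirceP| |].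
  by rewrite unlock /= /spin_peirce /= !add0r !addr0 subrK addrC subrK.
by rewrite unlock /= /spin_peirce /= !addr0.
Qed.

Lemma spin_peirce_proj2 z : peirce_proj (@spin_triple R d) e 2 z z.
Proof.
exists (spin_peirce z); split; [exact: spin_peirceP| |];
  by rewrite unlock /= /spin_peirce /= ?add0r !addr0 ?add0r subrK addrC subrK.
Qed.

(** The first Peirce space of e_1 is the line of e_1, where the determinant is
    the coordinate. *)
Lemma spin_minor1 z : peval (Delta ord0) z = hform z e1.
Proof.
have [h11 h22 h12 h21] := spin_frame_orth.
have [c [cc e1E e2E [b11 _ _ _]]] := spin_frame.
have [[_ detD] proj] := hDelta ord0.
rewrite (proj _ _ (spin_peirce_proj1 z)); set a := hform z e1.
have uE : \sum_(i < 2 | (i < 1)%N) e i = e1.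
  by rewrite (big_pred1 ord0)// => i; case: (ord2E i) => ->.
have x1 : spin_triple (a *: e1) e1 e1 = a *: e1.
  rewrite spin_tripleE hformZl h11 mulr1 scale1r bformZl b11 mulr0 scale0r subr0.
  by rewrite scale_halfD.
rewrite (detD _ ('X - a%:P)).
- by rewrite expr1 coefB coefX coefC /= sub0r mulrNN mul1r.
- by exists z; exact: spin_peirce_proj1.
- by rewrite /= uE seq1_free; have [[]] := he.1 ord0.
- exact: monicXsubC.
- by rewrite size_XsubC.
- rewrite big_ord_recr big_ord1 /= uE x1 !coefB !coefX !coefC /= sub0r subr0.
  by rewrite scale1r scaleNr addNr.
Qed.

(** Every x satisfies x^2 - <x, u> x + q(x) u = 0 with u = e_1 + e_2 and q a
    multiple of the quadratic form b; on the segment from e_1 to z, all but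
    finitely many x are independent of u. *)
Lemma spin_minor2 : exists a : C, forall z, peval (Delta ord_max) z = a * bform z z.
Proof.
have [h11 h22 h12 h21] := spin_frame_orth.
have [c [cc e1E e2E [b11 b22 _ _]]] := spin_frame.
have [[_ detD] _] := hDelta ord_max.
pose u := e1 + e2.
have uE : \sum_(i < 2 | (i < 2)%N) e i = u.
  by rewrite big_mkcond big_ord_recr big_ord1 /=; congr (e _ + e _); apply: val_inj.
have uconj : Defs.conjmx u = Num.conj c *: u.
  rewrite /u scalerDr -e1E -e2E addrC; exact: map_mxD.
have huu : hform u u = 2 by rewrite !hformDl !hformDr h11 h12 h21 h22; ring.
have xb x : bform x u *: Defs.conjmx u = hform x u *: u.
  by rewrite uconj hformE uconj bformZr scalerA mulrC.
have x1 x : spin_triple x u u = x.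
  rewrite spin_tripleE huu xb addrC addrA addNr add0r scalerA.
  by rewrite mulVf ?pnatr_eq0 ?scale1r.
have x2 x : spin_triple x u x = hform x u *: x - (2^-1 * Num.conj c * bform x x) *: u.
  rewrite spin_tripleE scalerBr scale_halfD uconj !scalerA; congr (_ - _ *: _); ring.
exists (2^-1 * Num.conj c) => z.
have regular x : hform x e1 - hform x e2 != 0 ->
    peval (Delta ord_max) x = 2^-1 * Num.conj c * bform x x.
  move=> hx; pose p := 'X^2 - hform x u *: 'X + (2^-1 * Num.conj c * bform x x)%:P.
  have p0 : p`_0 = 2^-1 * Num.conj c * bform x x.
    by rewrite !coefE /= mulr0 subr0 add0r.
  have p1 : p`_1 = - hform x u by rewrite !coefE /= mulr1 sub0r addr0.
  have p2 : p`_2 = 1 by rewrite !coefE /= mulr0 subr0 addr0.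
  have sp : size p = 3%N.
    rewrite /p -addrA size_polyDl ?size_polyXn// ltnS.
    rewrite (leq_trans (size_polyD _ _))// geq_max size_polyN.
    rewrite (leq_trans (size_scale_leq _ _)) ?size_polyX//=.
    by rewrite (leq_trans (size_polyC_leq1 _)).
  rewrite (detD _ p).
  - by rewrite sqrrN expr1n mul1r p0.
  - by exists x; exact: spin_peirce_proj2.
  - rewrite /= uE x1.
    have : free [tuple u; x]; last by [].
    apply/freeP => k; rewrite big_ord_recr big_ord1 /= => h.
    have hk : k ord_max = 0.
      have : hform (k (widen_ord (leqnSn 1) ord0) *: u + k ord_max *: x) e1 -
             hform (k (widen_ord (leqnSn 1) ord0) *: u + k ord_max *: x) e2 = 0.
        by rewrite h /hform !mul0mx !mxE subrr.
      rewrite !hformDl !hformZl !hformDl h11 h12 h21 h22 => /eqP.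
      have -> : forall q s t t' : C, q * (1 + 0) + s * t - (q * (0 + 1) + s * t') = s * (t - t').
        by move=> *; ring.
      by rewrite mulf_eq0 (negPf hx) orbF => /eqP.
    move: h; rewrite hk scale0r addr0 => /eqP; rewrite scaler_eq0 => /orP[/eqP k0|/eqP u0].
      by move=> i; case: (ord2E i) => ->//; rewrite -k0; congr (k _); apply: val_inj.
    by have := huu; rewrite u0 /hform mul0mx mxE => /esym/eqP; rewrite pnatr_eq0.
  - by rewrite monicE lead_coefE sp p2.
  - by rewrite sp.
  - rewrite !big_ord_recr big_ord0 /= uE add0r x1 x2 p0 p1 p2 scale1r scaleNr.
    by rewrite addrA subrK subrr.
pose zt t := e1 + t *: (z - e1).
have fpoly : polynomial_function (fun t => hform (zt t) e1 - hform (zt t) e2).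
  have [q hq] : polynomial_function (fun t : C => (hform e1 e1 - hform e1 e2) +
      t * (hform (z - e1) e1 - hform (z - e1) e2)).
    apply: polynomial_functionD; first exact: polynomial_function_cst.
    apply: polynomial_functionM; first exact: polynomial_function_id.
    exact: polynomial_function_cst.
  by exists q => t; rewrite -hq /zt !hformDl !hformZl !hformDl; ring.
have gpoly : polynomial_function (fun t => peval (Delta ord_max) (zt t) -
    2^-1 * Num.conj c * bform (zt t) (zt t)).
  apply: polynomial_functionB; first exact: polynomial_function_peval.
  apply: polynomial_functionM; first exact: polynomial_function_cst.
  have [q hq] : polynomial_function (fun t : C => bform e1 e1 +
      t * (2 * bform e1 (z - e1)) + t * (t * bform (z - e1) (z - e1))).
    apply: polynomial_functionD; first apply: polynomial_functionD.
    - exact: polynomial_function_cst.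
    - apply: polynomial_functionM; first exact: polynomial_function_id.
      exact: polynomial_function_cst.
    - apply: polynomial_functionM; first exact: polynomial_function_id.
      apply: polynomial_functionM; first exact: polynomial_function_id.
      exact: polynomial_function_cst.
  by exists q => t; rewrite -hq /zt bform_quadratic.
have f0 : hform (zt 0) e1 - hform (zt 0) e2 != 0.
  by rewrite /zt scale0r addr0 h11 h12 subr0 oner_neq0.
have z1 : zt 1 = z by rewrite /zt scale1r addrC subrK.
rewrite -z1; apply/eqP; rewrite -subr_eq0; apply/eqP.
apply: (polynomial_function_density fpoly gpoly f0) => t ht.
by rewrite regular// subrr.
Qed.

Lemma spin_homogeneous (j : 'I_2) (t : C) z :
  peval (Delta j) (t *: z) = t ^+ j.+1 * peval (Delta j) z.
Proof.
case: (ord2E j) => ->; first by rewrite !spin_minor1 hformZl expr1.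
by have [a aE] := spin_minor2; rewrite !aE bformZl bformZr /=; ring.
Qed.

Lemma spin_affine k : groupK O k -> forall (j : 'I_2) l z t,
  peval (Delta j) (z + t *: (e l *m k)) =
  peval (Delta j) z + t * (peval (Delta j) (z + e l *m k) - peval (Delta j) z).
Proof.
move=> hk j l z t; case: (ord2E j) => ->.
  by rewrite !spin_minor1 !hformDl hformZl; ring.
have [a aE] := spin_minor2; have E1 := bform_quadratic z (e l *m k) 1.
rewrite scale1r in E1; rewrite !aE bform_quadratic E1 (spin_frame_image hk); ring.
Qed.

End SpinFactor.

(** * The minors for the four types of domains *)

(** What the argument on leading monomials asks of a domain: the minors are
    homogeneous, and affine along the images of the frame under K. *)
Definition minor_geometry (R : realType) d r (O : set 'rV[R[i]]_d)
    (e : 'I_r -> 'rV[R[i]]_d) (Delta : 'I_r -> mpoly.mpoly d R[i]) : Prop :=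
  [/\ forall z, exists2 eps : R, 0 < eps & forall t, 0 <= t <= eps -> O (t%:C *: z),
      forall (j : 'I_r) (t : R[i]) z,
        peval (Delta j) (t *: z) = t ^+ j.+1 * peval (Delta j) z
    & forall k, groupK O k -> forall (j l : 'I_r) z t,
        peval (Delta j) (z + t *: (e l *m k)) =
        peval (Delta j) z + t * (peval (Delta j) (z + e l *m k) - peval (Delta j) z)].

Section MatrixModels.
Variables (R : realType) (n : nat).
Local Notation C := R[i].

Lemma sym_mx_linear (c : C) x y : sym_mx (c *: x + y) = c *: sym_mx x + sym_mx y :> 'M[C]_n.
Proof.
rewrite /sym_mx scaler_sumr -big_split; apply: eq_bigr => k _.
by rewrite !mxE scalerDl scalerA.
Qed.

Lemma asym_mx_linear (c : C) x y :
  asym_mx (c *: x + y) = c *: asym_mx x + asym_mx y :> 'M[C]_n.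
Proof.
rewrite /asym_mx scaler_sumr -big_split; apply: eq_bigr => k _.
by rewrite !mxE scalerDl scalerA.
Qed.

Lemma tr_sym_mx z : (sym_mx z)^T = sym_mx z :> 'M[C]_n.
Proof.
rewrite /sym_mx linear_sum; apply: eq_bigr => k _; rewrite linearZ /=; congr (_ *: _).
case: eqP => [->|_]; first by rewrite trmx_delta.
by rewrite linearZ linearD /= !trmx_delta addrC.
Qed.

Lemma tr_asym_mx z : (asym_mx z)^T = - asym_mx z :> 'M[C]_n.
Proof.
rewrite /asym_mx linear_sum -sumrN; apply: eq_bigr => k _.
by rewrite linearZ linearB /= !trmx_delta -scalerN opprB.
Qed.

Lemma sqrt2_neq0 : sqrt2 R != 0.
Proof. by rewrite /sqrt2 -(rmorph0 (real_complex R)) (inj_eq (@complexI R)) gt_eqF ?sqrtr_gt0. Qed.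

Lemma sym_mx_entry z k (p := val (enum_val k)) :
  (sym_mx z : 'M[C]_n) p.1 p.2 = z 0 k * (if p.1 == p.2 then 1 else (sqrt2 R)^-1).
Proof.
rewrite /sym_mx summxE (bigD1 k)//= -/p big1 ?addr0 => [|l lk].
  rewrite mxE; case: eqVneq => [pp|pp]; rewrite !mxE !eqxx//=.
  by rewrite [p.2 == _]eq_sym (negPf pp) addr0 mulr1.
rewrite mxE; set q := val (enum_val l).
have pq : (p.1 == q.1) && (p.2 == q.2) = false.
  apply: contra_neqF lk => /andP[/eqP h1 /eqP h2]; apply/esym/enum_val_inj/val_inj.
  by rewrite -/p -/q [p]surjective_pairing [q]surjective_pairing h1 h2.
case: eqVneq => [qq|qq]; rewrite !mxE pq ?mulr0// add0r.
case: andP => [[/eqP h1 /eqP h2]|_]; last by rewrite !mulr0.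
have h3 : (p.1 <= p.2)%N by exact: (valP (enum_val k)).
have h4 : (q.1 <= q.2)%N by exact: (valP (enum_val l)).
by case/eqP: qq; apply/val_inj/eqP; rewrite eqn_leq h4 -h1 -h2 h3.
Qed.

Lemma sym_coordK (A : 'M[C]_n) : A^T = A -> sym_mx (sym_coord A) = A.
Proof.
move=> hA; have le_case (a b : 'I_n) : (a <= b)%N -> (sym_mx (sym_coord A)) a b = A a b.
  move=> ab; have := sym_mx_entry (sym_coord A) (enum_rank (exist _ (a, b) ab : le_index n)).
  rewrite !mxE enum_rankK /= => ->.
  by case: eqP => _; rewrite ?mulr1// mulrAC divff ?mul1r ?sqrt2_neq0.
apply/matrixP => a b; case: (leqP a b) => [|/ltnW] ab; first exact: le_case.
have trE (B : 'M[C]_n) : B^T = B -> B a b = B b a by move=> hB; rewrite -{1}hB mxE.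
by rewrite !trE// ?tr_sym_mx// le_case.
Qed.

Lemma sym_mxK (z : 'rV[C]_#|{: le_index n}|) : sym_coord (sym_mx z) = z.
Proof.
apply/rowP => k; rewrite mxE /=; have /= := sym_mx_entry z k; case: eqP => _ ->.
  by rewrite mulr1.
by rewrite mulrCA divff ?mulr1 ?sqrt2_neq0.
Qed.

Lemma asym_mx_entry z k (p := val (enum_val k)) : (asym_mx z : 'M[C]_n) p.1 p.2 = z 0 k.
Proof.
have pp : (p.1 < p.2)%N by exact: (valP (enum_val k)).
rewrite /asym_mx summxE (bigD1 k)//= -/p big1 ?addr0 => [|l lk].
  rewrite !mxE !eqxx /= -val_eqE /= ltn_eqF// subr0 mulr1//.
rewrite mxE; set q := val (enum_val l).
have qq : (q.1 < q.2)%N by exact: (valP (enum_val l)).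
have pq : (p.1 == q.1) && (p.2 == q.2) = false.
  apply: contra_neqF lk => /andP[/eqP h1 /eqP h2]; apply/esym/enum_val_inj/val_inj.
  by rewrite -/p -/q [p]surjective_pairing [q]surjective_pairing h1 h2.
rewrite !mxE pq add0r; case: andP => [[/eqP h1 /eqP h2]|_]; last by rewrite oppr0 mulr0.
by move: qq; rewrite -h1 -h2 ltnNge ltnW.
Qed.

Lemma asym_coordK (A : 'M[C]_n) : A^T = - A -> asym_mx (asym_coord A) = A.
Proof.
move=> hA; have lt_case (a b : 'I_n) : (a < b)%N -> (asym_mx (asym_coord A)) a b = A a b.
  move=> ab; have := asym_mx_entry (asym_coord A) (enum_rank (exist _ (a, b) ab : lt_index n)).
  by rewrite !mxE enum_rankK /= => ->.
have skew0 (B : 'M[C]_n) a : B^T = - B -> B a a = 0.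
  move=> /matrixP/(_ a a); rewrite !mxE => /eqP.
  by rewrite -subr_eq0 opprK -mulr2n mulrn_eq0 /= => /eqP.
apply/matrixP => a b; case: (ltngtP a b) => ab; first exact: lt_case.
  have /matrixP/(_ b a) := tr_asym_mx (asym_coord A); have /matrixP/(_ b a) := hA.
  by rewrite !mxE (lt_case b a ab) => -> ->.
have -> : a = b by exact: val_inj.
by rewrite !skew0// tr_asym_mx.
Qed.

Lemma asym_mxK (z : 'rV[C]_#|{: lt_index n}|) : asym_coord (asym_mx z) = z.
Proof. by apply/rowP => k; rewrite mxE; exact: asym_mx_entry. Qed.

Lemma tr_mx_triple (x y z : 'M[C]_n) : (mx_triple x y z)^T = mx_triple x^T y^T z^T.
Proof.
rewrite /mx_triple linearZ linearD /= !trmx_mul !trmxK addrC.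
by rewrite /Defs.conjmx map_trmx trmxK !mulmxA.
Qed.

Lemma mx_tripleN (x y z : 'M[C]_n) : mx_triple (- x) (- y) (- z) = - mx_triple x y z.
Proof.
rewrite /mx_triple -scalerN /Defs.conjmx map_mxN [(- _)^T]linearN /=; congr (_ *: _).
by rewrite opprD !mulmxN !mulNmx !opprK.
Qed.

End MatrixModels.

Lemma cartan_minor_geometry (R : realType) (t : cartan_type)
    (e : 'I_(crank t) -> 'rV[R[i]]_(cdim t))
    (Delta : 'I_(crank t) -> mpoly.mpoly (cdim t) R[i]) :
  is_frame (@triple R t) e ->
  (forall j : 'I_(crank t), is_jordan_minor (@triple R t) e j.+1 (Delta j)) ->
  minor_geometry (@domain R t) e Delta.
Proof.
case: t e Delta => [n m|n|n|d] /= e Delta he hDelta.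
- have [iota iotaE] : exists F : {linear 'rV[R[i]]_(n * m) -> 'M[R[i]]_(n, m)},
      forall z, F z = vec_mx z by exists (@vec_mx R[i] n m).
  have iota_inj : injective iota by move=> x y; rewrite !iotaE => /(can_inj vec_mxK).
  have iota_tp x y z : iota (mxvec (mx_triple (vec_mx x) (vec_mx y) (vec_mx z))) =
      mx_triple (iota x) (iota y) (iota z) by rewrite !iotaE mxvecK.
  have domainE z : @domain R (TypeI n m) z <-> opnorm (iota z) < 1 by rewrite iotaE.
  split.
  + exact: (matrix_absorbing domainE).
  + exact: (full_rank_homogeneous iota_inj iota_tp domainE he hDelta).
  + exact: (full_rank_affine iota_inj iota_tp domainE he hDelta).
- have [iota iotaE] := linear_of (@sym_mx_linear R n).
  have iota_inj : injective iota by move=> x y; rewrite !iotaE => /(can_inj (@sym_mxK R n)).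
  have iota_tp x y z : iota (sym_coord (mx_triple (sym_mx x) (sym_mx y) (sym_mx z))) =
      mx_triple (iota x) (iota y) (iota z).
    by rewrite !iotaE sym_coordK// tr_mx_triple !tr_sym_mx.
  have domainE z : @domain R (TypeII n) z <-> opnorm (iota z) < 1 by rewrite iotaE.
  split.
  + exact: (matrix_absorbing domainE).
  + exact: (full_rank_homogeneous iota_inj iota_tp domainE he hDelta).
  + exact: (full_rank_affine iota_inj iota_tp domainE he hDelta).
- have [iota iotaE] := linear_of (@asym_mx_linear R n).
  have iota_inj : injective iota by move=> x y; rewrite !iotaE => /(can_inj (@asym_mxK R n)).
  have iota_tp x y z : iota (asym_coord (mx_triple (asym_mx x) (asym_mx y) (asym_mx z))) =
      mx_triple (iota x) (iota y) (iota z).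
    by rewrite !iotaE asym_coordK// tr_mx_triple !tr_asym_mx mx_tripleN.
  have domainE z : @domain R (TypeIII n) z <-> opnorm (iota z) < 1 by rewrite iotaE.
  have iota_skew z : (iota z)^T = - iota z by rewrite iotaE tr_asym_mx.
  have rank_n : (n <= (n./2 + n./2).+1)%N.
    by rewrite -{1}(odd_double_half n) addnn -add1n leq_add2r leq_b1.
  split.
  + exact: (matrix_absorbing domainE).
  + exact: (skew_homogeneous iota_inj iota_tp domainE iota_skew rank_n he hDelta).
  + exact: (skew_affine iota_inj iota_tp domainE iota_skew rank_n he hDelta).
- split.
  + exact: spin_absorbing.
  + exact: (spin_homogeneous he hDelta).
  + exact: (spin_affine he hDelta).
Qed.

(** * Unitary equivalence of the models *)

Theorem theorem5p1 (R : realType) (t : cartan_type) (ht : cartan_valid t)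
    (e : 'I_(crank t) -> 'rV[R[i]]_(cdim t))
    (he : is_frame (@triple R t) e)
    (Delta : 'I_(crank t) -> mpoly.mpoly (cdim t) R[i])
    (hDelta : forall j : 'I_(crank t),
       is_jordan_minor (@triple R t) e j.+1 (Delta j))
    (H1 H2 : hilbert R)
    (T1 : 'I_(cdim t) -> {linear H1 -> H1})
    (T2 : 'I_(cdim t) -> {linear H2 -> H2})
    (hT1 : class_AK (@domain R t) T1)
    (hT2 : class_AK (@domain R t) T2)
    (a b : signature (crank t) -> R)
    (a_gt0 : forall s, 0 < a s) (b_gt0 : forall s, 0 < b s)
    (a_0 : a (sig0 (crank t)) = 1) (b_0 : b (sig0 (crank t)) = 1)
    (a_kernel : defines_kernel (@domain R t) Delta a)
    (b_kernel : defines_kernel (@domain R t) Delta b)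
    (Ha : rkhs (@domain R t) (kernel_sum (@domain R t) Delta a))
    (Hb : rkhs (@domain R t) (kernel_sum (@domain R t) Delta b))
    (Ma : 'I_(cdim t) -> {linear Ha -> Ha})
    (Mb : 'I_(cdim t) -> {linear Hb -> Hb})
    (hMa : multiplication_tuple Ma) (hMb : multiplication_tuple Mb)
    (h1 : unitarily_equivalent T1 Ma) (h2 : unitarily_equivalent T2 Mb) :
  (unitarily_equivalent T1 T2 <-> (forall s, a s = b s)) /\
  ((forall s, a s = b s) <->
   (forall z w, domain z -> domain w ->
      kernel_sum (@domain R t) Delta a z w =
      kernel_sum (@domain R t) Delta b z w)).
Proof.
have [absorbing homDelta affDelta] := cartan_minor_geometry he hDelta.
have normDelta j : peval (Delta j) (\sum_(i < crank t | (i < j.+1)%N) e i) = 1.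
  by have [[]] := hDelta j.
have K1 := groupK1 (@domain R t).
have O0 : domain (0 : 'rV[R[i]]_(cdim t)) := absorbing0 absorbing.
have inj := kernel_sum_inj homDelta affDelta normDelta K1 absorbing a_kernel b_kernel.
have equivalent_of_eq : (forall s, a s = b s) -> unitarily_equivalent T1 T2.
  move=> ab; have eqK z w : domain z -> domain w ->
      kernel_sum (@domain R t) Delta a z w = kernel_sum (@domain R t) Delta b z w.
    by move=> _ _; rewrite (funext ab).
  apply: unitarily_equivalent_trans h1 _.
  apply: unitarily_equivalent_trans (same_kernel_equivalent hMa hMb eqK) _.
  exact: unitarily_equivalent_sym.
have eq_of_equivalent : unitarily_equivalent T1 T2 -> forall s, a s = b s.
  move=> h12; apply: inj.
  have [kappa kappa_gt0 kappaE] := Kker_sig0 homDelta K1.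
  apply: (equivalent_kernel_eq hMa hMb hT1 h1 (unitarily_equivalent_trans h12 h2) O0
    (lt0r_neq0 kappa_gt0)) => z.
    by rewrite kernel_sum_at0.
  by rewrite kernel_sum_at0.
split; split=> //.
by move=> ab z w _ _; rewrite (funext ab).
Qed.
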